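(* The $C^{*}$-algebra $U[\mathbb{Z}]$ is simple.
   Context: $U[\mathbb{Z}]$ is the universal $C^*$-algebra generated by a set of unitaries $\{u^{n}:n\in\mathbb{Z}\}$ and a set of isometries $\{s_{m}:m\in\mathbb{Z}^{\times}\}$ ($\mathbb{Z}^{\times}$ = non-zero integers) satisfying, for all admissible indices, $s_{m}s_{n}=s_{mn}$, $u^{n}u^{m}=u^{n+m}$, $s_{m}u^{n}=u^{mn}s_{m}$, and $\sum_{n\in\mathbb{Z}/(m)}u^{n}e_{m}u^{-n}=1$, where $e_{m}:=s_{m}s_{m}^{*}$ is the final projection of $s_{m}$. *)

(* Defs.v *)
From HB Require Import structures.
From mathcomp Require Import all_boot all_order all_algebra.
From mathcomp Require Import complex.
From mathcomp Require Import all_classical all_reals all_analysis.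

Set Implicit Arguments.
Unset Strict Implicit.
Unset Printing Implicit Defensive.

Import Order.TTheory GRing.Theory Num.Theory.
Import numFieldNormedType.Exports.

Local Open Scope classical_set_scope.
Local Open Scope ring_scope.

(* Unital C*-algebras over the complex numbers R[i].  The norm is the
   R[i]-valued one of normedModType.  The ring laws are part of this mixin, and
   pzRingType is derived from it afterwards, because Hierarchy Builder accepts
   no new join of the ring and normed module hierarchies.  No axiom says that
   the unit is nonzero: the zero algebra is a C*-algebra, so that a universal
   C*-algebra is not assumed to be nonzero. *)
HB.mixin Record CompleteNormedModule_isCStarAlgebra (R : realType) A
    of CompleteNormedModule R[i] A := {
  cstar_one : A;
  cstar_mul : A -> A -> A;
  star : A -> A;
  cstar_mulA : associative cstar_mul;
  cstar_mul1l : left_id cstar_one cstar_mul;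
  cstar_mul1r : right_id cstar_one cstar_mul;
  cstar_mulDl : left_distributive cstar_mul +%R;
  cstar_mulDr : right_distributive cstar_mul +%R;
  cstar_scaleAl_subproof : forall (k : R[i]) (x y : A),
    k *: cstar_mul x y = cstar_mul (k *: x) y;
  cstar_scaleAr_subproof : forall (k : R[i]) (x y : A),
    k *: cstar_mul x y = cstar_mul x (k *: y);
  cstar_normM_subproof : forall x y : A, `|cstar_mul x y| <= `|x| * `|y|;
  starK : involutive star;
  starD : forall x y : A, star (x + y) = star x + star y;
  starZ : forall (k : R[i]) (x : A), star (k *: x) = (k^*)%C *: star x;
  starM_subproof : forall x y : A,
    star (cstar_mul x y) = cstar_mul (star y) (star x);
  cstar_identity_subproof : forall x : A, `|cstar_mul (star x) x| = `|x| ^+ 2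
}.

#[short(type="cstarAlgType")]
HB.structure Definition CStarAlgebra (R : realType) :=
  {A of CompleteNormedModule R[i] A & CompleteNormedModule_isCStarAlgebra R A}.

HB.instance Definition _ (R : realType) (A : cstarAlgType R) :=
  GRing.Zmodule_isPzRing.Build (CStarAlgebra.sort A) cstar_mulA cstar_mul1l
    cstar_mul1r cstar_mulDl cstar_mulDr.

Section CStarAlgebraTheory.
Context {R : realType}.

Section Laws.
Variable A : cstarAlgType R.
Implicit Types (k : R[i]) (x y : A).

Lemma cstar_scaleAl k x y : k *: (x * y) = (k *: x) * y.
Proof. exact: cstar_scaleAl_subproof. Qed.

Lemma cstar_scaleAr k x y : k *: (x * y) = x * (k *: y).
Proof. exact: cstar_scaleAr_subproof. Qed.

Lemma cstar_normM x y : `|x * y| <= `|x| * `|y|.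
Proof. exact: cstar_normM_subproof. Qed.

Lemma starM x y : star (x * y) = star y * star x.
Proof. exact: starM_subproof. Qed.

Lemma cstar_identity x : `|star x * x| = `|x| ^+ 2.
Proof. exact: cstar_identity_subproof. Qed.

End Laws.

(* Continuity is not required: it is automatic between C*-algebras. *)
Record is_star_hom (A B : cstarAlgType R) (f : A -> B) : Prop := {
  star_homD : forall x y, f (x + y) = f x + f y;
  star_homZ : forall (k : R[i]) x, f (k *: x) = k *: f x;
  star_homM : forall x y, f (x * y) = f x * f y;
  star_hom1 : f 1 = 1;
  star_hom_star : forall x, f (star x) = star (f x)
}.

Record is_cstar_subalgebra (A : cstarAlgType R) (S : set A) : Prop := {
  cstar_sub0 : S 0;
  cstar_subD : forall x y, S x -> S y -> S (x + y);
  cstar_subZ : forall (k : R[i]) x, S x -> S (k *: x);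
  cstar_subM : forall x y, S x -> S y -> S (x * y);
  cstar_sub_star : forall x, S x -> S (star x);
  cstar_sub_closed : closed S
}.

Definition cstar_generated_by (A : cstarAlgType R) (G : set A) : Prop :=
  forall S : set A, is_cstar_subalgebra S -> G `<=` S -> S = setT.

Record is_closed_ideal (A : cstarAlgType R) (J : set A) : Prop := {
  ideal0 : J 0;
  idealD : forall x y, J x -> J y -> J (x + y);
  idealZ : forall (k : R[i]) x, J x -> J (k *: x);
  idealMl : forall a x, J x -> J (a * x);
  idealMr : forall a x, J x -> J (x * a);
  ideal_closed : closed J
}.

Definition cstar_simple (A : cstarAlgType R) : Prop :=
  (1 : A) <> 0 /\
  forall J : set A, is_closed_ideal J -> J = [set 0] \/ J = setT.

Definition is_unitary (A : cstarAlgType R) (x : A) : Prop :=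
  star x * x = 1 /\ x * star x = 1.

Definition is_isometry (A : cstarAlgType R) (x : A) : Prop := star x * x = 1.

Definition final_projection (A : cstarAlgType R) (x : A) : A := x * star x.

(* The generators s m are indexed by the nonzero integers; the value s 0 is a
   dummy that is never referred to.  In UZ_sum the classes of Z/(m) are
   represented by 0, ..., |m| - 1; by the other relations the summand does not
   depend on the chosen representatives. *)
Record UZ_relations (A : cstarAlgType R) (u s : int -> A) : Prop := {
  UZ_unitary : forall n, is_unitary (u n);
  UZ_isometry : forall m, m != 0 -> is_isometry (s m);
  UZ_sM : forall m n, m != 0 -> n != 0 -> s m * s n = s (m * n);
  UZ_uD : forall n m, u n * u m = u (n + m);
  UZ_su : forall m n, m != 0 -> s m * u n = u (m * n) * s m;
  UZ_sum : forall m, m != 0 ->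
    \sum_(0 <= n < `|m|%N) u n%:Z * final_projection (s m) * u (- n%:Z) = 1
}.

Definition UZ_generators (A : cstarAlgType R) (u s : int -> A) : set A :=
  [set x | (exists n, x = u n) \/ (exists2 m, m != 0 & x = s m)].

(* (A, u, s) is the universal C*-algebra U[Z] with its canonical generators.
   The *-homomorphism f is unique, since A is generated by u and s and f is
   automatically continuous; hence A is determined up to isomorphism. *)
Record is_UZ (A : cstarAlgType R) (u s : int -> A) : Prop := {
  is_UZ_relations : UZ_relations u s;
  is_UZ_generated : cstar_generated_by (UZ_generators u s);
  is_UZ_universal : forall (B : cstarAlgType R) (v t : int -> B),
    UZ_relations v t ->
    exists f : A -> B, [/\ is_star_hom f, forall n, f (u n) = v n
      & forall m, m != 0 -> f (s m) = t m]
}.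

End CStarAlgebraTheory.

(* Main.v *)
From HB Require Import structures.
Require Import Defs.
From mathcomp Require Import all_boot all_order all_algebra.
From mathcomp Require Import complex.
From mathcomp Require Import all_classical all_reals all_analysis.
From mathcomp Require Import ring lra.
From mathcomp Require Import zify.
From mathcomp Require Import cyclic separable cyclotomic.


(** The algebra is nonzero because its relations hold in a nonzero algebra: on
    the Hilbert space of square-summable functions on the integers, let [u n]
    translate by [n] and let [s m] dilate by [m]. Universality maps the unit of
    U[Z] to the unit of the algebra of bounded operators, which is not zero.

    Let [J] be a closed ideal that does not contain the unit. Words in the
    generators and their adjoints span a dense subalgebra, and a word [w] acts on
    the isometries [u c * s N], for [N] divisible enough, as the partial affine
    map [c |-> (num w * c + shift w) / den w] acts on [c] ([word_act]). Call [w]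
    diagonal when this map is the identity. Averaging over automorphisms, as
    described below, keeps the diagonal words and annihilates the others; in the
    limit it is the canonical conditional expectation onto the diagonal
    subalgebra, which is generated by the projections [u i * e_M * u (- i)]. The
    proof has two halves.

    The expectation vanishes on [J] ([vanishing_avg_diag]). Let [y] be a linear
    combination of words close to [x] in [J]. Compress by the isometry
    [V = u c * s N], where [c] is fixed by none of the affine maps of the words of
    [y] other than the identity, and [N] is very divisible: the words that are
    not diagonal disappear ([generic_compression]), and [V^* y V] is the value at
    [c] of the expectation of [y], a scalar. This scalar is close to [V^* x V],
    an element of [J], hence it is small: an ideal that contains an element close
    to a nonzero scalar contains 1 ([ideal_scalar]). Diagonal elements have the
    norm of the supremum of their values ([diag_nrm]), so the expectation of [x]
    is small.

    The expectation detects the elements of [J]: if it vanishes on an ideal, then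
    the ideal is zero ([vanishing_avg_above], [proper_ideal_eq0]). The expectation
    is undone one averaging at a time. One step averages over automorphisms
    [beta j], where [j] runs through the integers modulo [M], that multiply one
    isometry [v] by the [j]-th power of a primitive [M]-th root of unity. By
    universality there is such a family for [v = s p], for every prime [p]; the
    sign of [m] gives a last automorphism of this kind. For [v = u 1] the
    automorphisms are conjugations by unitaries of the diagonal subalgebra
    ([clock_u1]). As in Fejer's theorem, the Fejer mean of [x] is at once a convex
    combination of the [beta j x], so that the passage to the mean is a
    contraction, which moves words little, and a combination of the averages of
    [v ^+ a * x * star v ^+ b]. These elements are in the ideal along with [x];
    if their averages tend to zero, so does [x] ([fejer_estimate],
    [fejer_step]). This is where the amenability of the affine group of the
    rational numbers enters.

    All averages are finite: the limit is taken over [M] in the divisibility order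
    ([eventually_dvd]), so that no integration over a compact dual group occurs.
    Two facts of the general theory are proved directly: *-homomorphisms are
    contractive ([star_hom_nrm]), and projections with sum 1 are pairwise
    orthogonal ([projections_orthogonal]). *)

Set Implicit Arguments.
Unset Strict Implicit.
Unset Printing Implicit Defensive.

Import Order.TTheory GRing.Theory Num.Theory.
Import numFieldNormedType.Exports.

Local Open Scope classical_set_scope.
Local Open Scope ring_scope.


(** * Real-valued norms *)
Section Norm.
Context {R : realType}.
Implicit Types A : cstarAlgType R.

(** Norms take values in [R[i]], whose order is partial; the estimates below use
    their real parts, for which linear arithmetic is available. *)
Definition cabs (k : R[i]) : R := complex.Re `|k|.

Definition nrm A (x : A) : R := complex.Re `|x|.

Lemma nrmE A (x : A) : `|x| = (nrm x)%:C%C.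
Proof. by rewrite RRe_real// ger0_real. Qed.

Lemma cabsE (k : R[i]) : `|k| = (cabs k)%:C%C.
Proof. by rewrite RRe_real// ger0_real. Qed.

Lemma nrm_ge0 A (x : A) : 0 <= nrm x.
Proof. by rewrite -ler0c -nrmE. Qed.

Lemma cabs_ge0 (k : R[i]) : 0 <= cabs k.
Proof. by rewrite -ler0c -cabsE. Qed.

Lemma nrm0 A : nrm (0 : A) = 0.
Proof. by rewrite /nrm normr0. Qed.

Lemma nrm0_eq0 A (x : A) : nrm x = 0 -> x = 0.
Proof. by move=> x0; apply/eqP; rewrite -normr_eq0 nrmE x0. Qed.

Lemma nrmN A (x : A) : nrm (- x) = nrm x.
Proof. by rewrite /nrm normrN. Qed.

Lemma nrmD A (x y : A) : nrm (x + y) <= nrm x + nrm y.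
Proof. by rewrite -lecR rmorphD /= -!nrmE ler_normD. Qed.

Lemma nrmB A (x y : A) : nrm (x - y) <= nrm x + nrm y.
Proof. by rewrite -(nrmN y) nrmD. Qed.

Lemma nrmC A (x y : A) : nrm (x - y) = nrm (y - x).
Proof. by rewrite -nrmN opprB. Qed.

Lemma nrmZ A (k : R[i]) (x : A) : nrm (k *: x) = cabs k * nrm x.
Proof.
by apply: (@complexI R); rewrite -nrmE rmorphM /= -nrmE -cabsE normrZ.
Qed.

Lemma nrmM A (x y : A) : nrm (x * y) <= nrm x * nrm y.
Proof. by rewrite -lecR rmorphM /= -!nrmE cstar_normM. Qed.

Lemma nrm_identity A (x : A) : nrm (star x * x) = nrm x ^+ 2.
Proof.
by apply: (@complexI R); rewrite -nrmE rmorphXn /= -nrmE cstar_identity.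
Qed.

Lemma cabsM (k l : R[i]) : cabs (k * l) = cabs k * cabs l.
Proof. by apply: (@complexI R); rewrite -cabsE rmorphM /= -!cabsE normrM. Qed.

Lemma cabs0 : cabs 0 = 0. Proof. by rewrite /cabs normr0. Qed.
Lemma cabs1 : cabs 1 = 1. Proof. by rewrite /cabs normr1. Qed.

Lemma cabs_real (r : R) : 0 <= r -> cabs r%:C%C = r.
Proof. by move=> r0; rewrite /cabs ger0_norm ?ler0c. Qed.

Lemma cabsX (k : R[i]) n : cabs (k ^+ n) = cabs k ^+ n.
Proof. by elim: n => [|n IH]; rewrite ?expr0 ?cabs1// !exprS cabsM IH. Qed.

Lemma cabs_nat n : cabs n%:R = n%:R.
Proof. by rewrite /cabs normr_nat -(rmorph_nat (real_complex R)). Qed.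

Lemma cabsV (k : R[i]) : cabs k^-1 = (cabs k)^-1.
Proof. by apply: (@complexI R); rewrite -cabsE normfV cabsE fmorphV. Qed.

Lemma cabs_sqr (k : R[i]) : (cabs k ^+ 2)%:C%C = k * (k^*)%C.
Proof. by rewrite rmorphXn /= -cabsE sqr_normc. Qed.

Lemma nrm_sum A (I : Type) (r : seq I) (P : pred I) (F : I -> A) :
  nrm (\sum_(i <- r | P i) F i) <= \sum_(i <- r | P i) nrm (F i).
Proof.
elim/big_ind2: _ => [|x a y b xa yb|//]; first by rewrite nrm0.
by rewrite (le_trans (nrmD _ _))// lerD.
Qed.

Lemma nrm_star A (x : A) : nrm (star x) = nrm x.
Proof.
suff le (y : A) : nrm y <= nrm (star y).
  by apply/eqP; rewrite eq_le le andbT -{2}(starK x) le.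
have := nrm_ge0 y; rewrite le_eqVlt => /predU1P[<-|y0]; first exact: nrm_ge0.
by rewrite -(ler_pM2r y0) -expr2 -nrm_identity nrmM.
Qed.

Lemma star0 A : star (0 : A) = 0.
Proof. by apply: (addrI (star 0)); rewrite -starD !addr0. Qed.

Lemma starN A (x : A) : star (- x) = - star x.
Proof. by apply/eqP; rewrite -subr_eq0 opprK -starD addNr star0. Qed.

Lemma starB A (x y : A) : star (x - y) = star x - star y.
Proof. by rewrite starD starN. Qed.

Lemma star1 A : star (1 : A) = 1.
Proof. by rewrite -[LHS]mul1r -[X in X * _](starK 1) -starM mul1r starK. Qed.

Lemma star_sum A (I : Type) (r : seq I) (P : pred I) (F : I -> A) :
  star (\sum_(i <- r | P i) F i) = \sum_(i <- r | P i) star (F i).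
Proof.
by apply: (big_morph (@star R A)) => [x y|]; rewrite ?starD ?star0.
Qed.

Lemma nrm1_le1 A : nrm (1 : A) <= 1.
Proof.
have := nrm_identity (1 : A); rewrite star1 mulr1 => /eqP.
rewrite expr2 -[X in X == _]mulr1 -subr_eq0 -mulrBr mulf_eq0 subr_eq0.
by case/orP=> /eqP; [move=> ->|move=> <-].
Qed.

Lemma nrm_isometry A (x : A) : star x * x = 1 -> nrm x <= 1.
Proof.
move=> x1; rewrite -(@expr_le1 _ 2)// ?nrm_ge0//.
by rewrite -nrm_identity x1 nrm1_le1.
Qed.

(** The norm of a projection equals its square, hence it is 0 or 1. *)
Lemma nrm_projection A (p : A) : star p = p -> p * p = p -> nrm p <= 1.
Proof.
move=> ps pp; have := nrm_identity p; rewrite ps pp => /eqP.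
rewrite expr2 -[X in X == _]mulr1 -subr_eq0 -mulrBr mulf_eq0 subr_eq0.
by case/orP=> /eqP; [move=> ->|move=> <-].
Qed.

Lemma scaler_mulAl A k (x y : A) : (k *: x) * y = k *: (x * y).
Proof. by rewrite -cstar_scaleAl. Qed.
Lemma scaler_mulAr A k (x y : A) : x * (k *: y) = k *: (x * y).
Proof. by rewrite -cstar_scaleAr. Qed.

Lemma nrmZ_le A (k : R[i]) (x : A) : cabs k <= 1 -> nrm (k *: x) <= nrm x.
Proof. by move=> k1; rewrite nrmZ ler_piMl// nrm_ge0. Qed.

(** This lemma and the next two replace filters by real epsilons, once and for
    all. *)
Lemma closed_nrm A (S : set A) (x : A) : closed S ->
  (forall e : R, 0 < e -> exists2 y, S y & nrm (x - y) < e) -> S x.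
Proof.
move=> cS Sx; apply: cS => B /nbhs_ballP[e /= e0 eB].
have e0' : 0 < complex.Re e by move: e0; rewrite ltcE /= => /andP[_].
have eE : e = (complex.Re e)%:C%C by rewrite RRe_real// gtr0_real.
have [y Sy xy] := Sx _ e0'; exists y; split=> //; apply: eB.
by rewrite -ball_normE /= nrmE eE ltcR.
Qed.

Lemma nrm_closed A (S : set A) :
  (forall x, (forall e : R, 0 < e -> exists2 y, S y & nrm (x - y) < e) -> S x) ->
  closed S.
Proof.
move=> Scl x Sx; apply: Scl => e e0.
have [|y [Sy]] := Sx (ball x e%:C%C).
  by apply: nbhsx_ballx; rewrite ltcR.
by rewrite -ball_normE /= nrmE ltcR => xy; exists y.
Qed.

Lemma nrm_complete A (x : nat -> A) :
  (forall e : R, 0 < e ->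
    exists N, forall m n, (N <= m)%N -> (N <= n)%N -> nrm (x m - x n) < e) ->
  exists l, forall e : R, 0 < e ->
    exists N, forall n, (N <= n)%N -> nrm (x n - l) < e.
Proof.
move=> xC.
have /cvg_ex[l xl] : cvg (x @ \oo).
  apply: cauchy_cvg; apply/cauchy_ballP => e e0.
  have e0' : 0 < complex.Re e by move: e0; rewrite ltcE /= => /andP[_].
  have eE : e = (complex.Re e)%:C%C by rewrite RRe_real// gtr0_real.
  have [N NP] := xC _ e0'.
  exists ([set x n | n in [set n | (N <= n)%N]],
          [set x n | n in [set n | (N <= n)%N]]).
    by split; exists N => // n /= Nn; exists n.
  move=> [_ _] /= [[m Nm <-] [n Nn <-]].
  by rewrite -ball_normE /= nrmE eE ltcR NP.
exists l => e e0.
have /= := xl (ball l e%:C%C); case.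
  by apply: nbhsx_ballx; rewrite ltcR.
move=> N _ NP; exists N => n Nn.
by have := NP n Nn; rewrite -ball_normE /= nrmE ltcR nrmC.
Qed.

End Norm.

(** * *-homomorphisms are contractive *)
Section Contractive.
Context {R : realType}.
Implicit Types A B : cstarAlgType R.

Lemma expr_small (k e : R) : 0 <= k < 1 -> 0 < e -> exists N, k ^+ N < e.
Proof.
move=> /andP[k0 k1] e0.
have /cvgrPdist_lt/(_ e e0) : (fun n => k ^+ n) @ \oo --> (0 : R).
  by apply: cvg_expr; rewrite ger0_norm.
move=> -[N _ /(_ N (leqnn _))] /=.
by rewrite sub0r normrN ger0_norm ?exprn_ge0// => ?; exists N.
Qed.

Lemma nrm_small A (x : A) (C : R) :
  (forall e, 0 < e -> nrm x <= C * e) -> x = 0.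
Proof.
move=> xC; apply: nrm0_eq0; apply/eqP; rewrite eq_le nrm_ge0 andbT.
have C1 : 0 < `|C| + 1 by rewrite ltr_wpDl.
apply/ler_addgt0Pl => e e0; rewrite addr0.
have := xC (e / (`|C| + 1)) (divr_gt0 e0 C1); move=> /le_trans; apply.
rewrite mulrCA; apply: ler_piMr; first exact: ltW.
rewrite ler_pdivrMr// mul1r.
by rewrite (le_trans (ler_norm C))// lerDl.
Qed.

Lemma eq_nrm_small A (x y : A) (C : R) :
  (forall e, 0 < e -> nrm (x - y) <= C * e) -> x = y.
Proof. by move=> /nrm_small/eqP; rewrite subr_eq0 => /eqP. Qed.

(** If [w] is a fixed point of [w |-> (c + w ^ 2) / 2], then [1 - w] is a square
    root of [1 - c]. For [nrm c < 1] this map is a contraction of the ball of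
    radius [nrm c], and its iterates from 0 are real polynomials in [c]. *)
Fixpoint sqrt_iter A (c : A) n : A :=
  if n is n'.+1 then 2%:R^-1 *: (c + sqrt_iter c n' * sqrt_iter c n') else 0.

Lemma sqrt_iterS A (c : A) n : sqrt_iter c n.+1 =
  2%:R^-1 *: (c + sqrt_iter c n * sqrt_iter c n).
Proof. by []. Qed.

Lemma cabs_half : cabs (2%:R^-1 : R[i]) = 2^-1.
Proof. by rewrite cabsV cabs_nat. Qed.

Lemma nrm_half A (x : A) : nrm (2%:R^-1 *: x) = 2^-1 * nrm x.
Proof. by rewrite nrmZ cabs_half. Qed.

Lemma scale_half A (x : A) : 2%:R^-1 *: (x + x) = x.
Proof. by rewrite -mulr2n -(scaler_nat 2 x) scalerA mulVf ?scale1r// pnatr_eq0. Qed.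

Lemma nrm_sqrB A (x y : A) (k : R) : nrm x <= k -> nrm y <= k ->
  nrm (x * x - y * y) <= 2 * k * nrm (x - y).
Proof.
move=> xk yk; have -> : x * x - y * y = x * (x - y) + (x - y) * y.
  by rewrite mulrBr mulrBl addrA subrK.
rewrite (le_trans (nrmD _ _))// (le_trans (lerD (nrmM _ _) (nrmM _ _)))//.
have := nrm_ge0 (x - y); nra.
Qed.

Lemma sqrt_iter_nrm A (c : A) (k : R) n : nrm c <= k -> k <= 1 ->
  nrm (sqrt_iter c n) <= k.
Proof.
move=> ck k1; have k0 := le_trans (nrm_ge0 _) ck.
elim: n => [|n IH] /=; first by rewrite nrm0.
rewrite nrm_half.
have := nrmD c (sqrt_iter c n * sqrt_iter c n).
have := nrmM (sqrt_iter c n) (sqrt_iter c n).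
have := nrm_ge0 (sqrt_iter c n); nra.
Qed.

Lemma sqrt_iter_step A (c : A) (k : R) n : nrm c <= k -> k <= 1 ->
  nrm (sqrt_iter c n.+1 - sqrt_iter c n) <= k ^+ n.
Proof.
move=> ck k1; have k0 := le_trans (nrm_ge0 _) ck.
elim: n => [|n IH].
  by rewrite expr0 (le_trans _ k1)//= subr0 (sqrt_iter_nrm 1).
rewrite [sqrt_iter c n.+2]sqrt_iterS [X in _ - X]sqrt_iterS.
rewrite -scalerBr opprD addrACA subrr add0r nrm_half exprS.
have := nrm_sqrB (sqrt_iter_nrm n.+1 ck k1) (sqrt_iter_nrm n ck k1).
have := nrm_ge0 (sqrt_iter c n.+1 - sqrt_iter c n).
nra.
Qed.

Lemma sqrt_iter_cauchy A (c : A) (k : R) n d : nrm c <= k -> k < 1 ->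
  nrm (sqrt_iter c (n + d) - sqrt_iter c n) <= k ^+ n / (1 - k).
Proof.
move=> ck k1; have k0 := le_trans (nrm_ge0 _) ck.
rewrite ler_pdivlMr ?subr_gt0//.
have kn := exprn_ge0 n k0; have kd := exprn_ge0 d k0.
apply: (@le_trans _ _ (k ^+ n * (1 - k ^+ d))); last by nra.
elim: d {kd} => [|d IH]; first by rewrite addn0 !subrr nrm0 mul0r mulr0.
rewrite addnS -(subrKA (sqrt_iter c (n + d))).
have := nrmD (sqrt_iter c (n + d).+1 - sqrt_iter c (n + d))
             (sqrt_iter c (n + d) - sqrt_iter c n).
have := sqrt_iter_step (n + d) ck (ltW k1); rewrite exprD exprS.
nra.
Qed.

(** The square root commutes with [h] and is self-adjoint because both
    properties pass from the iterates to their limit. *)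
Lemma sqrt_exists A (h : A) : star h = h -> nrm h < 1 ->
  exists b : A, [/\ star b = b, b * h = h * b & h * h + b * b = 1].
Proof.
move=> hs h1; pose k := nrm h; have k0 : 0 <= k := nrm_ge0 h.
set c := h * h; have ck : nrm c <= k.
  by rewrite (le_trans (nrmM _ _))// ler_piMr// ltW.
have cs : star c = c by rewrite starM hs.
pose w := sqrt_iter c.
have ws n : star (w n) = w n.
  elim: n => [|n IH]; first exact: star0.
  rewrite /w sqrt_iterS -/(w n) starZ starD starM IH cs; congr (_ *: _).
  by rewrite conjc_inv conjc_nat.
have wh n : w n * h = h * w n.
  elim: n => [|n IH]; first by rewrite mul0r mulr0.
  rewrite /w sqrt_iterS -/(w n) scaler_mulAl scaler_mulAr mulrDl mulrDr -!mulrA.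
  by rewrite IH [w n * (h * _)]mulrA IH !mulrA.
have [l wl] : exists l, forall e : R, 0 < e ->
    exists N, forall n, (N <= n)%N -> nrm (w n - l) < e.
  apply: nrm_complete => e e0.
  have [||N Ne] := @expr_small k (e * (1 - k)).
  - by rewrite k0.
  - by rewrite mulr_gt0// subr_gt0.
  have bound m n : (N <= m <= n)%N -> nrm (w n - w m) < e.
    move=> /andP[Nm mn]; rewrite -(subnKC mn).
    apply: (le_lt_trans (sqrt_iter_cauchy _ _ ck h1)).
    rewrite ltr_pdivrMr ?subr_gt0// (le_lt_trans _ Ne)//.
    by apply: ler_wiXn2l => //; exact: ltW.
  exists N => m n Nm Nn; have [mn|/ltnW nm] := leqP m n.
    by rewrite nrmC bound// Nm.
  by rewrite bound// Nn.
have ls : star l = l.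
  apply: (@eq_nrm_small _ _ _ 2) => e e0.
  have [N /(_ _ (leqnn _)) Ne] := wl e e0.
  rewrite -(subrKA (w N)) -{1}(ws N) -starB.
  rewrite (le_trans (nrmD _ _))// nrm_star nrmC mulrDl mul1r.
  by rewrite lerD// ltW.
have lh : l * h = h * l.
  apply: (@eq_nrm_small _ _ _ 2) => e e0.
  have [N /(_ _ (leqnn _)) Ne] := wl e e0.
  have -> : l * h - h * l = h * (w N - l) - (w N - l) * h.
    by rewrite mulrBr mulrBl wh opprB [RHS]addrC addrA subrK.
  rewrite (le_trans (nrmB _ _))// (le_trans (lerD (nrmM _ _) (nrmM _ _)))//.
  by have := nrm_ge0 (w N - l); rewrite -/k; nra.
have lfix : 2%:R^-1 *: (c + l * l) = l.
  apply: (@eq_nrm_small _ _ _ (1 + k + nrm l)) => e e0.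
  have [N NP] := wl e e0.
  have Ne := NP N (leqnn _); have Ne1 := NP N.+1 (leqnSn _).
  rewrite -(subrKA (w N.+1)) {1}/w sqrt_iterS -/(w N).
  rewrite -scalerBr opprD addrACA subrr add0r.
  rewrite (le_trans (nrmD _ _))// nrm_half.
  have wk : nrm (w N) <= k + nrm l.
    by rewrite (le_trans (sqrt_iter_nrm N ck (ltW h1)))// lerDl nrm_ge0.
  have lk : nrm l <= k + nrm l by rewrite lerDr.
  have := nrm_sqrB lk wk; rewrite (nrmC l (w N)).
  have := nrm_ge0 (w N - l); have := nrm_ge0 l.
  nra.
have l2 : c + l * l = l + l.
  by rewrite -{3 4}lfix -scalerDr scale_half.
exists (1 - l); split.
- by rewrite starB star1 ls.
- by rewrite mulrBl mulrBr mul1r mulr1 lh.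
- have -> : (1 - l) * (1 - l) = 1 - (l + l - l * l).
    by rewrite !(mulrBl, mulrBr) !mul1r mulr1 -[LHS]addrA -opprD addrA.
  by rewrite -l2 addrK addrC subrK.
Qed.

(** For [h] self-adjoint of norm less than 1, choose [b] with
    [h ^ 2 + b ^ 2 = 1]. Then [f h + i f b] is a unitary with real part [f h], so
    that [nrm (f h) <= 1]. The general case follows by the C*-identity. No
    spectral theory is involved. *)
Lemma star_hom_nrm A B (f : A -> B) : is_star_hom f ->
  forall x, nrm (f x) <= nrm x.
Proof.
move=> fh.
have fsa1 h : star h = h -> nrm h < 1 -> nrm (f h) <= 1.
  move=> hs h1; have [b [bs bh hb]] := sqrt_exists hs h1.
  have fs : star (f h) = f h by rewrite -(star_hom_star fh) hs.
  have fbs : star (f b) = f b by rewrite -(star_hom_star fh) bs.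
  pose w := f h + 'i%C *: f b.
  have ws : star w = f h - 'i%C *: f b.
    rewrite starD starZ fs fbs; congr (_ + _).
    by rewrite -scaleNr; congr (_ *: _); apply/eqP; rewrite eq_complex /= oppr0 !eqxx.
  have w1 : nrm w <= 1.
    apply: nrm_isometry; rewrite ws mulrBl !mulrDr.
    rewrite !scaler_mulAl !scaler_mulAr scalerA -(expr2 'i%C) sqr_i scaleN1r.
    rewrite -!(star_homM fh) bh opprD opprK addrA addrK.
    by rewrite -(star_homD fh) hb (star_hom1 fh).
  have -> : f h = 2%:R^-1 *: (w + star w).
    by rewrite ws addrACA subrr addr0 scale_half.
  rewrite nrm_half; have := nrmD w (star w); rewrite nrm_star.
  by move: w1; lra.
have fsa h : star h = h -> nrm (f h) <= nrm h.
  move=> hs; apply/ler_addgt0Pl => e e0.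
  pose r := e + nrm h; have r0 : 0 < r by rewrite ltr_pwDl// nrm_ge0.
  have := @fsa1 (r^-1%:C%C *: h); rewrite starZ hs conjc_real => /(_ erefl).
  rewrite (star_homZ fh) !nrmZ cabs_real ?invr_ge0 ?(ltW r0)//.
  rewrite mulrC ltr_pdivrMr// mul1r ltrDr mulrC ler_pdivrMr// mul1r; exact.
move=> x; rewrite -(@ler_sqr _ _) ?nnegrE ?nrm_ge0//.
rewrite -!nrm_identity -(star_hom_star fh) -(star_homM fh) fsa//.
by rewrite starM starK.
Qed.

End Contractive.

(** * Finite averages and Fejer means *)
Section RootsOfUnity.
Context {R : realType}.

Lemma primitive_root_exists M : (0 < M)%N ->
  exists z : R[i], M.-primitive_root z.
Proof.
move=> M0; pose p : {poly R[i]} := 'X^M - 1.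
have [r Dp] := closed_field_poly_normal p.
rewrite (monicP _) ?monicXnsubC // scale1r in Dp.
have rn1 : all M.-unity_root r by apply/allP => z; rewrite -root_prod_XsubC -Dp.
have sz_r : (M < (size r).+1)%N.
  by rewrite -(size_prod_XsubC r id) -Dp size_XnsubC.
have [|z] := hasP (has_prim_root M0 rn1 _ sz_r); last by exists z.
by rewrite -separable_prod_XsubC -Dp separable_Xn_sub_1 // pnatr_eq0 -lt0n.
Qed.

Definition zeta M : R[i] := xget 1 [set z : R[i] | M.-primitive_root z].

Lemma zetaP M : (0 < M)%N -> M.-primitive_root (zeta M).
Proof.
by move=> /primitive_root_exists[z zM]; rewrite /zeta; case: xgetP => [_ -> //|/(_ z)].
Qed.

Lemma zeta_unit M : (0 < M)%N -> zeta M != 0.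
Proof.
move=> M0; apply/eqP => z0; have := prim_expr_order (zetaP M0).
by rewrite z0 expr0n gtn_eqF// => /esym/eqP; rewrite oner_eq0.
Qed.

Lemma cabs_zeta M : (0 < M)%N -> cabs (zeta M) = 1.
Proof.
move=> M0; apply/eqP; rewrite -(@pexpr_eq1 _ _ M) ?cabs_ge0//.
by rewrite -cabsX (prim_expr_order (zetaP M0)) cabs1.
Qed.

Lemma conj_unimodular (k : R[i]) : cabs k = 1 -> (k^*)%C = k^-1.
Proof.
move=> k1; have k0 : k != 0.
  by apply/eqP => k0; move: k1; rewrite k0 cabs0 => /eqP; rewrite eq_sym oner_eq0.
by apply: (mulfI k0); rewrite -cabs_sqr k1 expr1n divff.
Qed.

Lemma zetaX_eq1 M (k : int) : (0 < M)%N ->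
  (zeta M ^ k == 1) = (M %| `|k|)%N.
Proof.
move=> M0; case: k => n.
  by rewrite /= -exprnP (prim_order_dvd (zetaP M0)).
by rewrite -[zeta M ^ _]/(zeta M ^- n.+1) invr_eq1 (prim_order_dvd (zetaP M0)).
Qed.

Lemma zeta_sum M (k : int) : (0 < M)%N ->
  \sum_(j < M) (zeta M ^ k) ^+ j = (M * (M %| `|k|)%N)%:R.
Proof.
move=> M0; rewrite -zetaX_eq1//; have [->|zk1] := eqVneq.
  by under eq_bigr do rewrite expr1n; rewrite sumr_const card_ord muln1.
rewrite muln0; have: (zeta M ^ k) ^+ M - 1 = 0.
  rewrite exprnP exprzAC -exprnP (prim_expr_order (zetaP M0)) exp1rz subrr//.
by rewrite subrX1 => /eqP; rewrite mulf_eq0 subr_eq0 (negPf zk1) => /eqP.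
Qed.

End RootsOfUnity.

Section Averages.
Context {R : realType}.
Implicit Types A : cstarAlgType R.

Definition avg A M (F : nat -> A) : A := M%:R^-1 *: \sum_(j < M) F j.

Lemma avgD A M (F G : nat -> A) :
  avg M (fun j => F j + G j) = avg M F + avg M G.
Proof. by rewrite /avg big_split scalerDr. Qed.

Lemma avgZ A M k (F : nat -> A) : avg M (fun j => k *: F j) = k *: avg M F.
Proof. by rewrite /avg -scaler_sumr !scalerA mulrC. Qed.

Lemma eq_avg A M (F G : nat -> A) : F =1 G -> avg M F = avg M G.
Proof. by move=> FG; rewrite /avg; under eq_bigr do rewrite FG. Qed.

Lemma avg_mull A M a (F : nat -> A) : avg M (fun j => a * F j) = a * avg M F.
Proof. by rewrite /avg scaler_mulAr -mulr_sumr. Qed.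

Lemma avg_mulr A M a (F : nat -> A) : avg M (fun j => F j * a) = avg M F * a.
Proof. by rewrite /avg scaler_mulAl -mulr_suml. Qed.

Lemma avg_nrm A M (F : nat -> A) (C : R) : (0 < M)%N ->
  (forall j, nrm (F j) <= C) -> nrm (avg M F) <= C.
Proof.
move=> M0 FC; rewrite nrmZ cabsV cabs_nat mulrC ler_pdivrMr ?ltr0n//.
rewrite (le_trans (nrm_sum _ _ _))//.
apply: (@le_trans _ _ (\sum_(j < M) C)); first exact: ler_sum.
by rewrite sumr_const card_ord mulr_natr.
Qed.

Lemma avg_eigen A M (k : int) (w : A) : (0 < M)%N ->
  avg M (fun j => (zeta M ^ k) ^+ j *: w) =
  if (M %| `|k|)%N then w else 0.
Proof.
move=> M0; rewrite /avg -scaler_suml zeta_sum// scalerA.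
case: ifP => _; last by rewrite muln0 mulr0 scale0r.
by rewrite muln1 mulVf ?scale1r// pnatr_eq0 -lt0n.
Qed.

End Averages.

(** Here [ker] is the Fejer kernel of order [n], sampled at the [M]-th roots of
    unity, and [T] is the corresponding mean of the [beta j]. *)
Section Fejer.
Context {R : realType} (A : cstarAlgType R).
Variables (M n : nat) (beta : nat -> A -> A) (v : A).
Hypotheses (n0 : (0 < n)%N) (nM : (n <= M)%N).
Hypothesis betaP : forall j, is_star_hom (beta j).
Hypothesis betav : forall j, beta j v = zeta M ^+ j *: v.
Hypothesis vv : star v * v = 1.

Let M0 : (0 < M)%N := leq_trans n0 nM.

Let ker j : R[i] := \sum_(a < n) \sum_(b < n) (zeta M ^ (a%:Z - b%:Z)) ^+ j.

Let T z := (n * M)%:R^-1 *: \sum_(j < M) ker j *: beta j z.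

Let kerE j : ker j = (cabs (\sum_(a < n) (zeta M ^+ a) ^+ j) ^+ 2)%:C%C.
Proof.
rewrite cabs_sqr rmorph_sum mulr_suml; apply: eq_bigr => a _.
rewrite mulr_sumr; apply: eq_bigr => b _.
rewrite !rmorphXn /= conj_unimodular ?cabs_zeta//.
by rewrite expfzDr ?zeta_unit// exprMn -exprnP -exprz_inv.
Qed.

(** The number of pairs [a], [b] below [n] with [a - b = - k] modulo [M]: up to
    the factor [1 / n], the multiplier by which [T] acts on an eigenvector of
    weight [k]. It is at least [n - |k|], so that this multiplier tends to 1 when
    [n] grows, whatever [M >= n] is. *)
Let hits (k : int) := (\sum_(a < n) \sum_(b < n) (M %| absz (a%:Z - b%:Z + k)%R)%N)%N.

Let count_le1 (P : pred 'I_n) :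
  (forall a b : 'I_n, P a -> P b -> a = b) -> (\sum_(b < n) P b <= 1)%N.
Proof.
move=> Puniq; have -> : (\sum_(b < n) P b)%N = #|P|.
  by rewrite -sum1_card [RHS]big_mkcond; apply: eq_bigr => b _; rewrite unfold_in; case: (P b).
by apply/card_le1_eqP => a b Pa Pb /=; exact: Puniq.
Qed.

Let hits_le k : (hits k <= n)%N.
Proof.
rewrite -[leqRHS]card_ord -sum1_card; apply: leq_sum => a _.
apply: count_le1 => b c hb hc; apply/val_inj => /=.
have bM := leq_trans (ltn_ord b) nM; have cM := leq_trans (ltn_ord c) nM.
rewrite -(modn_small bM) -(modn_small cM).
wlog bc : b c hb hc bM cM / (b <= c)%N.
  move=> H; have [bc|/ltnW cb] := leqP b c; first exact: H.
  by apply/esym/H.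
apply/eqP; rewrite eq_sym eqn_mod_dvd//.
have : (M %| (a%:Z - b%:Z + k) - (a%:Z - c%:Z + k))%Z.
  by rewrite rpredB.
have -> : (a%:Z - b%:Z + k) - (a%:Z - c%:Z + k) = (c - b)%N%:Z.
  by rewrite -subzn//; ring.
by [].
Qed.

Let hits_ge k : (n <= hits k + `|k|)%N.
Proof.
have hit (a b : 'I_n) : a%:Z + k = b%:Z ->
    (0 < \sum_(b < n) (M %| absz (a%:Z - b%:Z + k)%R)%N)%N.
  move=> ab; rewrite (bigD1 b)//= (_ : a%:Z - b%:Z + k = 0) ?absz0 ?dvdn0//.
  by rewrite -ab; ring.
suff : (n - `|k| <= hits k)%N by rewrite leq_subLR addnC.
have [kn|/ltnW kn] := leqP `|k| n; last by move: (kn); rewrite -subn_eq0 => /eqP->.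
rewrite /hits; case: k kn hit => [k|k]; rewrite ?NegzE ?abszN /= => kn hit.
  rewrite -[leqLHS]card_ord -sum1_card.
  rewrite -(big_mkord xpredT (fun=> 1%N)).
  pose G a := (\sum_(b < n) (M %| absz (a%:Z - b%:Z + k%:Z)%R)%N)%N.
  rewrite -(big_mkord xpredT G) [leqRHS](big_cat_nat (n := n - k)) ?leq_subr//=.
  rewrite (leq_trans _ (leq_addr _ _))// big_nat [leqRHS]big_nat.
  apply: leq_sum => a /= ank; have an : (a < n)%N by rewrite (leq_trans ank) ?leq_subr.
  have akn : (a + k < n)%N by rewrite addnC -ltn_subRL.
  exact: (hit (Ordinal an) (Ordinal akn)).
rewrite -[leqLHS]card_ord -sum1_card.
rewrite -(big_mkord xpredT (fun=> 1%N)).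
pose G a := (\sum_(b < n) (M %| absz (a%:Z - b%:Z - k.+1%:Z)%R)%N)%N.
rewrite -(big_mkord xpredT G) [leqRHS](big_cat_nat (n := k.+1))//=.
rewrite (leq_trans _ (leq_addl _ _))// -{2}(add0n k.+1) big_addn.
rewrite big_nat [leqRHS]big_nat.
apply: leq_sum => a /= ank.
have akn : (a + k.+1 < n)%N by rewrite addnC -ltn_subRL.
have an : (a < n)%N by apply: leq_trans akn; rewrite ltnS leq_addr.
apply: (hit (Ordinal akn) (Ordinal an)) => /=.
by rewrite PoszD; ring.
Qed.

Let sum_hits (k : int) :
  \sum_(j < M) ker j * (zeta M ^ k) ^+ j = (hits k * M)%:R.
Proof.
under eq_bigr do rewrite mulr_suml; rewrite exchange_big /=.
rewrite /hits big_distrl natr_sum; apply: eq_bigr => a _.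
under eq_bigr do rewrite mulr_suml; rewrite exchange_big /=.
rewrite big_distrl natr_sum; apply: eq_bigr => b _ /=.
by under eq_bigr do rewrite -exprMn -expfzDr ?zeta_unit//; rewrite zeta_sum// mulnC.
Qed.

Let sum_ker : \sum_(j < M) cabs (ker j) = (n * M)%:R.
Proof.
have hits0 : hits 0 = n.
  by apply/eqP; rewrite eqn_leq hits_le; have := hits_ge 0; rewrite addn0.
apply: (@complexI R); rewrite rmorph_sum rmorph_nat -[X in (X * _)%N]hits0 -sum_hits.
apply: eq_bigr => j _; rewrite expr1n mulr1 kerE cabs_real//.
by rewrite exprn_ge0// cabs_ge0.
Qed.

(** The kernel is nonnegative with mean value 1, so that [T] is a convex
    combination of contractions. *)
Let T_nrm z : nrm (T z) <= nrm z.
Proof.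
rewrite nrmZ cabsV cabs_nat mulrC ler_pdivrMr; last first.
  by rewrite ltr0n muln_gt0 n0.
rewrite (le_trans (nrm_sum _ _ _))// -sum_ker mulr_sumr; apply: ler_sum => j _.
rewrite nrmZ mulrC ler_wpM2r ?cabs_ge0//; exact: star_hom_nrm.
Qed.

Let TD x y : T (x + y) = T x + T y.
Proof.
rewrite /T -scalerDr -big_split; congr (_ *: _); apply: eq_bigr => j _ /=.
by rewrite -scalerDr (star_homD (betaP j)).
Qed.

Let T0 : T 0 = 0.
Proof. by apply: (addrI (T 0)); rewrite -TD !addr0. Qed.

Let TB x y : T (x - y) = T x - T y.
Proof. by rewrite -{2}(subrK y x) (TD (x - y)) addrK. Qed.

Let T_eigen (k : int) w : (forall j, beta j w = (zeta M ^ k) ^+ j *: w) ->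
  nrm (T w - w) <= `|k|%N%:R / n%:R * nrm w.
Proof.
move=> wk; have -> : T w = ((hits k)%:R / n%:R) *: w.
  rewrite /T; under eq_bigr do rewrite wk scalerA.
  rewrite -scaler_suml sum_hits scalerA !natrM; congr (_ *: _); field.
  by rewrite !pnatr_eq0 -!lt0n n0.
rewrite -[X in _ - X]scale1r -scalerBl nrmZ ler_wpM2r ?nrm_ge0//.
have nn : (n%:R : R[i]) != 0 by rewrite pnatr_eq0 -lt0n.
rewrite -[X in cabs (_ - X)](divff nn) -mulrBl cabsM cabsV cabs_nat ler_wpM2r ?invr_ge0 ?ler0n//.
rewrite -opprB -natrB ?hits_le// /cabs normrN normr_nat.
rewrite -(rmorph_nat (real_complex R)) /= ler_nat leq_subLR; exact: hits_ge.
Qed.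

(** Expanding the square in the kernel, the factor of weight [a - b] is absorbed
    by [v ^+ a] on the left and [star v ^+ b] on the right. *)
Let T_expand z : T z = n%:R^-1 *: \sum_(a < n) \sum_(b < n)
  star v ^+ a * avg M (fun j => beta j (v ^+ a * z * star v ^+ b)) * v ^+ b.
Proof.
have bX j a : beta j (v ^+ a) = (zeta M ^+ a) ^+ j *: v ^+ a.
  elim: a => [|a IH]; first by rewrite !expr0 expr1n scale1r (star_hom1 (betaP j)).
  rewrite exprS (star_homM (betaP j)) IH betav scaler_mulAl scaler_mulAr scalerA.
  by rewrite [zeta M ^+ a.+1]exprS exprMn.
have sX a : star (v ^+ a) = star v ^+ a.
  elim: a => [|a IH]; first by rewrite !expr0 star1.
  by rewrite exprSr starM IH -exprS.
have vX a : star v ^+ a * v ^+ a = 1.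
  elim: a => [|a IH]; first by rewrite !expr0 mulr1.
  by rewrite exprSr exprS mulrA -(mulrA _ (star v)) vv mulr1.
have key j a b : star v ^+ a * beta j (v ^+ a * z * star v ^+ b) * v ^+ b =
    (zeta M ^ (a%:Z - b%:Z)) ^+ j *: beta j z.
  rewrite -!sX !(star_homM (betaP j)) (star_hom_star (betaP j)) !bX starZ.
  rewrite !(scaler_mulAl, scaler_mulAr) !scalerA !mulrA !sX vX mul1r.
  rewrite -mulrA vX mulr1; congr (_ *: _).
  rewrite expfzDr ?zeta_unit// exprMn -exprnP -exprz_inv mulrC.
  by rewrite !rmorphXn /= conj_unimodular ?cabs_zeta.
rewrite /T natrM invfM -scalerA; congr (_ *: _).
transitivity (\sum_(a < n) \sum_(b < n) avg M (fun j =>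
    (zeta M ^ (a%:Z - b%:Z)) ^+ j *: beta j z)).
  rewrite /avg; under [RHS]eq_bigr do rewrite -scaler_sumr.
  rewrite -scaler_sumr; congr (_ *: _).
  under [RHS]eq_bigr do rewrite exchange_big.
  rewrite exchange_big; apply: eq_bigr => j _.
  by rewrite /ker scaler_suml; apply: eq_bigr => a _; rewrite scaler_suml.
apply: eq_bigr => a _; apply: eq_bigr => b _.
by rewrite -avg_mull -avg_mulr; apply: eq_avg => j; rewrite key.
Qed.

(** The norm of [x] is at most the sum of the three terms on the right: the error of the
    approximation by eigenvectors together with its image under the contraction
    [T], the distance by which [T] moves these eigenvectors, and the norm of
    [T x], bounded with [T_expand]. The number [n] stays fixed while [e] tends to 0. *)
Lemma fejer_estimate (e : R) (I : Type) (r : seq I) (w : I -> A) (k : I -> int)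
    (x : A) :
  (forall i j, beta j (w i) = (zeta M ^ k i) ^+ j *: w i) ->
  (forall a b, (a < n)%N -> (b < n)%N ->
     nrm (avg M (fun j => beta j (v ^+ a * x * star v ^+ b))) <= e) ->
  nrm x <= 2 * nrm (x - \sum_(i <- r) w i)
    + (\sum_(i <- r) `|k i|%N%:R * nrm (w i)) / n%:R + n%:R * e.
Proof.
move=> wk xe; set y := \sum_(i <- r) w i.
have Tx : nrm (T x) <= n%:R * e.
  rewrite T_expand nrmZ cabsV cabs_nat mulrC ler_pdivrMr ?ltr0n//.
  have vn : nrm v <= 1 by exact: nrm_isometry.
  have svn : nrm (star v) <= 1 by rewrite nrm_star.
  have nX (u : A) a : nrm u <= 1 -> nrm (u ^+ a) <= 1.
    move=> u1; elim: a => [|a IH]; first by rewrite expr0 nrm1_le1.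
    by rewrite exprS (le_trans (nrmM _ _))// mulr_ile1 ?nrm_ge0.
  rewrite (le_trans (nrm_sum _ _ _))//.
  have -> : n%:R * e * n%:R = \sum_(a < n) \sum_(b < n) e.
    by rewrite !sumr_const !card_ord -mulrnA -[RHS]mulr_natr natrM; ring.
  apply: ler_sum => a _; rewrite (le_trans (nrm_sum _ _ _))//.
  apply: ler_sum => b _; rewrite (le_trans (nrmM _ _))//.
  rewrite (le_trans (ler_wpM2l (nrm_ge0 _) (nX _ b vn)))// mulr1.
  rewrite (le_trans (nrmM _ _))// (le_trans (ler_wpM2r (nrm_ge0 _) (nX _ a svn)))//.
  by rewrite mul1r xe.
have Ty : nrm (T y - y) <= (\sum_(i <- r) `|k i|%N%:R * nrm (w i)) / n%:R.
  have -> : T y - y = \sum_(i <- r) (T (w i) - w i).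
    by rewrite sumrB (big_morph T TD T0).
  rewrite (le_trans (nrm_sum _ _ _))// mulr_suml; apply: ler_sum => i _.
  by rewrite mulrAC T_eigen.
have xE : x = (x - y) - (T x - T y) + (T x - (T y - y)).
  by rewrite !opprB -[RHS]addrA [X in _ + X]addrA subrK [T y + _]addrC !subrK.
rewrite [X in nrm X <= _]xE (le_trans (nrmD _ _))//.
have := nrmB (x - y) (T x - T y); have := nrmB (T x) (T y - y).
have := T_nrm (x - y); rewrite TB; lra.
Qed.

End Fejer.

(** * Projections with sum 1 *)
Section Orthogonality.
Context {R : realType}.
Implicit Types A : cstarAlgType R.

Lemma avg_sum A M (I : Type) (r : seq I) (F : I -> nat -> A) :
  avg M (fun j => \sum_(i <- r) F i j) = \sum_(i <- r) avg M (F i).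
Proof. by rewrite /avg exchange_big scaler_sumr. Qed.

Lemma cabs_unit_ReIm (k : R[i]) : cabs k = 1 ->
  exists a b : R, [/\ k = a%:C%C + 'i%C * b%:C%C, `|a| <= 1 & `|b| <= 1].
Proof.
move=> k1; exists (complex.Re k), (complex.Im k); rewrite -complexE; split=> //.
  by have := normc_ge_Re k; rewrite cabsE k1 lecR.
have := normc_ge_Re (k * 'i%C); rewrite ReiNIm normrN cabsE cabsM k1 mul1r lecR.
by rewrite /cabs normc_def /= expr0n expr1n add0r sqrtr1.
Qed.

(** The hypotheses say that [h] is both nonnegative and nonpositive. Then [h] is
    zero because [p + k h / (2 t)] is a contraction for every complex [k] of
    modulus 1, and hence so are its powers: in [p (1 + k h / (2 t)) ^ m], the
    coefficient of [k] is a mean over roots of unity, so [m h / (2 t)] has norm at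
    most 1 for every [m]. *)
Lemma corner_eq0 A (p h : A) (t : R) : 0 < t ->
  star p = p -> p * p = p -> star h = h -> p * h = h -> h * p = h ->
  nrm (t%:C%C *: p + h) <= t -> nrm (t%:C%C *: p - h) <= t -> h = 0.
Proof.
move=> t0 ps pp hs ph hp tph tmh.
have real_comb a : `|a| <= 1 -> nrm (t%:C%C *: p + a%:C%C *: h) <= t.
  rewrite ler_norml => /andP[a1 a2].
  have -> : t%:C%C *: p + a%:C%C *: h = ((1 + a) / 2)%:C%C *: (t%:C%C *: p + h)
      + ((1 - a) / 2)%:C%C *: (t%:C%C *: p - h).
    rewrite !scalerDr scalerN addrACA -scalerDl -scalerBl -rmorphD -rmorphB /=.
    have -> : (1 + a) / 2 + (1 - a) / 2 = 1 by field.
    have -> : (1 + a) / 2 - (1 - a) / 2 = a by field.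
    by rewrite scale1r.
  rewrite (le_trans (nrmD _ _))// !nrmZ !cabs_real; [|lra|lra].
  nra.
(* The square of this norm is the norm of [t ^ 2 p + b ^ 2 h ^ 2], which is half
   the sum of the squares of [t p + b h] and [t p - b h]. *)
have imag_comb b : `|b| <= 1 -> nrm (t%:C%C *: p + ('i%C * b%:C%C) *: h) <= t.
  move=> b1; have tt : 0 <= t by exact: ltW.
  rewrite -(@ler_sqr _ _ t) ?nnegrE ?nrm_ge0// -nrm_identity.
  have pos := real_comb _ b1.
  have neg : nrm (t%:C%C *: p + (- b)%:C%C *: h) <= t by rewrite real_comb// normrN.
  set x := t%:C%C *: p + b%:C%C *: h in pos.
  set y := t%:C%C *: p + _ in neg.
  rewrite (_ : star _ * _ = 2%:R^-1 *: (x * x + y * y)).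
    rewrite nrm_half (le_trans _ (_ : 2^-1 * (t * t + t * t) <= _))//; last by lra.
    rewrite ler_wpM2l// (le_trans (nrmD _ _))// lerD//.
      by rewrite (le_trans (nrmM _ _))// ler_pM ?nrm_ge0.
    by rewrite (le_trans (nrmM _ _))// ler_pM ?nrm_ge0.
  have mulL (k l k' l' : R[i]) : (k *: p + l *: h) * (k' *: p + l' *: h) =
      (k * k') *: p + (k * l' + l * k') *: h + (l * l') *: (h * h).
    rewrite !(mulrDl, mulrDr) !(scaler_mulAl, scaler_mulAr) !scalerA pp ph hp.
    by rewrite scalerDl !addrA.
  rewrite /x /y starD !starZ ps hs !mulL.
  rewrite addrACA [X in _ = _ *: (X + _)]addrACA -!scalerDl !scalerDr !scalerA.
  have i2 : 'i%C * 'i%C = -1 :> R[i] by rewrite -expr2 sqr_i.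
  have cib : (('i%C * b%:C%C)^*)%C = - 'i%C * b%:C%C :> R[i].
    by apply/eqP; rewrite eq_complex /=; apply/andP; split; apply/eqP; ring.
  have nb : (- b)%:C%C = - b%:C%C :> R[i] by rewrite rmorphN.
  rewrite cib nb !conjc_real.
  move: ('i%C : R[i]) (t%:C%C : R[i]) (b%:C%C : R[i]) i2 => i t' b' i2.
  have h2 : (2%:R : R[i]) != 0 by rewrite pnatr_eq0.
  congr (_ *: _ + _ *: _ + _ *: _); [by field|by field|].
  by transitivity (- (i * i) * (b' * b')); [ring|rewrite i2; field].
have comb k : cabs k = 1 -> nrm (p + (k * (2 * t)^-1%:C%C) *: h) <= 1.
  case/cabs_unit_ReIm => a [b [-> a1 b1]].
  have tE : t%:C%C != 0 :> R[i] by rewrite eq_complex /= eqxx andbT gt_eqF.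
  rewrite (_ : p + _ = ((2 * t)^-1)%:C%C *:
     ((t%:C%C *: p + a%:C%C *: h) + (t%:C%C *: p + ('i%C * b%:C%C) *: h))).
    have t2 : 0 < 2 * t by rewrite mulr_gt0.
    rewrite nrmZ cabs_real ?invr_ge0 ?(ltW t2)// mulrC.
    rewrite ler_pdivrMr// mul1r (le_trans (nrmD _ _))//.
    by have := real_comb _ a1; have := imag_comb _ b1; lra.
  rewrite addrACA -!scalerDl scalerDr !scalerA mulrC; congr (_ + _).
  rewrite -rmorphD -rmorphM /= (_ : _ * _ = 1) ?scale1r//.
  by field; rewrite gt_eqF.
pose r := ((2 * t)^-1)%:C%C : R[i].
have pow k m : cabs k = 1 -> nrm (p * ((k * r) *: h + 1) ^+ m) <= 1.
  move=> k1; elim: m => [|m IH]; first by rewrite mulr1 nrm_projection.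
  rewrite exprS mulrA.
  have -> : p * ((k * r) *: h + 1) = (p + (k * r) *: h) * p.
    by rewrite mulrDr mulrDl pp mulr1 scaler_mulAl scaler_mulAr ph hp addrC.
  rewrite -mulrA (le_trans (nrmM _ _))// mulr_ile1 ?nrm_ge0//; exact: comb.
have coef m : m.+1%:R * (2 * t)^-1 * nrm h <= 1.
  have -> : m.+1%:R * (2 * t)^-1 * nrm h = nrm (avg m.+2 (fun j =>
     (zeta m.+2 ^ (-1 : int)) ^+ j *: (p * ((zeta m.+2 ^+ j * r) *: h + 1) ^+ m.+1))).
    have -> : (fun j => (zeta m.+2 ^ (-1 : int)) ^+ j *:
          (p * ((zeta m.+2 ^+ j * r) *: h + 1) ^+ m.+1)) =
        (fun j => \sum_(i < m.+2) (zeta m.+2 ^ (i%:Z - 1)) ^+ j *: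
            (p * (r *: h) ^+ i *+ 'C(m.+1, i))).
      apply/funext => j; rewrite exprD1n mulr_sumr scaler_sumr.
      apply: eq_bigr => i _; rewrite -scalerA.
      have -> : (zeta m.+2 ^+ j *: (r *: h)) ^+ i =
          (zeta m.+2 ^+ j) ^+ i *: (r *: h) ^+ i.
        elim: (i : nat) => [|n IH]; first by rewrite !expr0 scale1r.
        by rewrite exprS IH scaler_mulAl scaler_mulAr scalerA -!exprS.
      rewrite mulrnAr scaler_mulAr scalerMnr scalerA; congr (_ *: _).
      rewrite expfzDr ?zeta_unit// exprMn -exprnP mulrC; congr (_ * _).
      by rewrite -!exprM mulnC.
    rewrite avg_sum (bigD1 (inord 1)) //= big1 ?addr0 => [|i i1].
      rewrite avg_eigen// inordK// subrr dvdn0 bin1 expr1 scaler_mulAr ph.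
      by rewrite -(scaler_nat m.+1 (r *: h)) scalerA nrmZ cabsM cabs_nat cabs_real// invr_ge0 mulr_ge0// ltW.
    rewrite avg_eigen// gtnNdvd//; have := ltn_ord i.
      by move: i1; rewrite -val_eqE /= inordK//; lia.
    by move: i1; rewrite -val_eqE /= inordK//; lia.
  apply: avg_nrm => // j; rewrite (le_trans (nrmZ_le _ _))//.
    by rewrite cabsX exprN1 cabsV cabs_zeta// invr1 expr1n.
  by apply: pow; rewrite cabsX cabs_zeta ?expr1n.
apply: nrm0_eq0; apply/eqP; rewrite eq_le nrm_ge0 andbT.
rewrite leNgt; apply/negP => h0.
pose s := (2 * t)^-1 * nrm h.
have s0 : 0 < s by rewrite mulr_gt0// invr_gt0 mulr_gt0.
have /= := coef (Num.truncn s^-1).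
rewrite -mulrA -/s leNgt => /negP; apply.
by rewrite -ltr_pdivrMr// mul1r truncnS_gt.
Qed.

(** In the corner of [p i], the compressions [p i * p k * p i] for [k != i] are
    positive contractions with sum 0; hence each of them is zero. *)
Lemma projections_orthogonal A (I : finType) (p : I -> A) :
  (forall i, star (p i) = p i) -> (forall i, p i * p i = p i) ->
  \sum_i p i = 1 -> forall i j, i != j -> p i * p j = 0.
Proof.
move=> ps pp p1 i j ij.
have comp1 k : nrm (p i - p i * p k * p i) <= 1.
  have -> : p i - p i * p k * p i = p i * (1 - p k) * p i.
    by rewrite mulrBr mulrBl mulr1 pp.
  have ci : nrm (1 - p k) <= 1.
    apply: nrm_projection; first by rewrite starB star1 ps.
    by rewrite mulrBl mul1r mulrBr mulr1 pp subrr subr0.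
  have pi := nrm_projection (ps i) (pp i).
  by rewrite (le_trans (nrmM _ _))// mulr_ile1 ?nrm_ge0// (le_trans (nrmM _ _))// mulr_ile1 ?nrm_ge0.
set h := p i * p j * p i.
have h0 : h = 0.
  have hs : star h = h by rewrite /h !starM !ps mulrA.
  have ph : p i * h = h by rewrite /h !mulrA pp.
  have hp : h * p i = h by rewrite /h -!mulrA pp.
  pose t := #|I|%:R : R.
  have card1 : (1 < #|I|)%N by apply/card_gt1P; exists i, j.
  have t0 : 0 < t by rewrite ltr0n ltnW.
  have tE : t%:C%C = #|I|%:R :> R[i] by rewrite rmorph_nat.
  apply: (corner_eq0 t0 (ps i) (pp i) hs ph hp).
    have -> : t%:C%C *: p i + h =
        \sum_(k | (k != i) && (k != j)) (p i - p i * p k * p i) + p i + p i.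
      have : \sum_k (p i * p k * p i) = p i.
        by rewrite -mulr_suml -mulr_sumr p1 mulr1 pp.
      rewrite (bigD1 i)//= (bigD1 j) 1?eq_sym//= -/h !pp => sE.
      have -> : h = - \sum_(k | (k != i) && (k != j)) (p i * p k * p i).
        apply/eqP; rewrite -addr_eq0; apply/eqP.
        by apply: (addrI (p i)); rewrite addr0.
      have : \sum_(k : I) p i = t%:C%C *: p i.
        by rewrite sumr_const tE scaler_nat.
      rewrite (bigD1 i)//= (bigD1 j) 1?eq_sym//= => <-.
      by rewrite sumrB [RHS]addrAC -[RHS]addrA [RHS]addrC !addrA.
    rewrite (le_trans (nrmD _ _))// (le_trans (lerD (nrmD _ _) (lexx _)))//.
    have pi := nrm_projection (ps i) (pp i).
    have -> : t = \sum_(k | (k != i) && (k != j)) 1 + 1 + 1.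
      have : \sum_(k : I) 1 = t by rewrite sumr_const.
      rewrite (bigD1 i)//= (bigD1 j) 1?eq_sym//= => <-.
      by ring.
    rewrite lerD// lerD// (le_trans (nrm_sum _ _ _))//.
    by apply: ler_sum.
  have -> : t%:C%C *: p i - h = (t - 1)%:C%C *: p i + (p i - h).
    by rewrite rmorphB /= scalerBl scale1r addrA subrK.
  rewrite (le_trans (nrmD _ _))// nrmZ cabs_real ?subr_ge0 ?ler1n ?(ltnW card1)//.
  have := comp1 j; have := nrm_projection (ps i) (pp i); rewrite -/h.
  have : 1 <= t by rewrite ler1n ltnW.
  nra.
have pji : p j * p i = 0.
  apply: nrm0_eq0; apply/eqP; rewrite -sqrf_eq0 -nrm_identity starM !ps.
  by rewrite mulrA -[X in X * p i]mulrA pp -/h h0 nrm0.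
by rewrite -[LHS]starK starM !ps pji star0.
Qed.

End Orthogonality.

(** * Words in the generators *)
Section Words.
Context {R : realType} (A : cstarAlgType R) (u s : int -> A).
Hypothesis rel : UZ_relations u s.

Lemma UZ_u0 : u 0 = 1.
Proof.
have [u1 _] := UZ_unitary rel 0; have := UZ_uD rel 0 0; rewrite addr0 => uu.
have E : u 0 = star (u 0) * (u 0 * u 0) by rewrite mulrA u1 mul1r.
by rewrite E uu u1.
Qed.

Lemma UZ_star_u n : star (u n) = u (- n).
Proof.
have [u1 _] := UZ_unitary rel n.
by rewrite -[LHS]mulr1 -UZ_u0 -(subrr n) -(UZ_uD rel) mulrA u1 mul1r.
Qed.

Lemma UZ_sV m : m != 0 -> star (s m) * s m = 1.
Proof. exact: (UZ_isometry rel). Qed.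

Lemma UZ_star_su m n : m != 0 -> star (s m) * u (m * n) = u n * star (s m).
Proof.
move=> m0; apply: (can_inj (@starK _ A)).
by rewrite !starM starK !UZ_star_u -mulrN (UZ_su rel).
Qed.

(** The translates of the range of [s N] by different residues modulo [N] are
    orthogonal, because their projections have sum 1. *)
Lemma UZ_orth N l : N != 0 -> ~~ (N %| l)%Z -> star (s N) * u l * s N = 0.
Proof.
move=> N0 Nl; pose n := `|N|%N.
have n0 : (0 < n)%N by rewrite absz_gt0.
pose p (i : 'I_n) := u i%:Z * final_projection (s N) * u (- i%:Z).
have ss : final_projection (s N) * final_projection (s N) = final_projection (s N).
  by rewrite /final_projection mulrA -(mulrA (s N)) UZ_sV// mulr1.
have uK i : u (- i) * u i = 1 by rewrite (UZ_uD rel) addNr UZ_u0.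
have orth : forall i j, i != j -> p i * p j = 0.
  apply: projections_orthogonal => [i|i|].
  - by rewrite /p !starM starK !UZ_star_u opprK mulrA.
  - rewrite /p; move: (final_projection (s N)) ss => e ss.
    by rewrite !mulrA -(mulrA _ (u (- _))) uK mulr1 -(mulrA _ e e) ss.
  - by have := UZ_sum rel N0; rewrite big_mkord.
have lE := divz_eq l N; set q := (l %/ N)%Z in lE; set r := (l %% N)%Z in lE.
have r0 : 0 <= r by rewrite modz_ge0.
have rn : r < n%:Z by rewrite /r -modz_abs; apply: ltz_pmod; rewrite ltz_nat.
have rr0 : r != 0 by apply: contra Nl => /eqP /dvdz_mod0P.
case: r r0 rn rr0 lE => // r _ rn rr0 lE.
suff E : star (s N) * u r%:Z * s N = 0.
  rewrite lE addrC -(UZ_uD rel) mulrC mulrA -(mulrA _ (u _) (s N)).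
  by rewrite -(UZ_su rel)// mulrA E mul0r.
have := orth (Ordinal n0) (Ordinal (rn : (r < n)%N)).
rewrite -val_eqE /= eq_sym => /(_ rr0) /(congr1 (fun x => star (s N) * x * (u r%:Z * s N))).
rewrite mulr0 mul0r /p /= oppr0 UZ_u0 mul1r mulr1 /final_projection => <-.
rewrite !mulrA UZ_sV// mul1r -[in RHS](mulrA _ (u (- r%:Z))) uK mulr1.
by rewrite -[in RHS](mulrA _ (star (s N)) (s N)) UZ_sV// mulr1.
Qed.

Definition nzint := {m : int | m != 0}.

Inductive letter := LU of int | LS of nzint | LSt of nzint.

Definition word := seq letter.

Definition eval_letter (g : letter) : A := match g with
  | LU n => u n | LS m => s (val m) | LSt m => star (s (val m)) end.

Definition eval (w : word) : A := foldr (fun g x => eval_letter g * x) 1 w.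

(** The word acts as [c |-> (num * c + shift) / den], composed from right to
    left. *)
Fixpoint den (w : word) : int := match w with
  | LSt m :: w' => val m * den w' | _ :: w' => den w' | [::] => 1 end.

Fixpoint num (w : word) : int := match w with
  | LS m :: w' => val m * num w' | _ :: w' => num w' | [::] => 1 end.

Fixpoint shift (w : word) : int := match w with
  | LU n :: w' => shift w' + n * den w' | LS m :: w' => val m * shift w'
  | LSt _ :: w' => shift w' | [::] => 0 end.

(** A modulus such that, for [N] divisible by it, every letter [star (s m)] of the
    word, when its turn comes to act on [u c * s N], meets some [u c' * s N'] with
    [N'] divisible by [m]. *)
Fixpoint level (w : word) : nat := match w with
  | LSt m :: w' => level w' * `|(val m * den w')%R| | _ :: w' => level w'
  | [::] => 1%N end.

Lemma den_neq0 w : den w != 0.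
Proof. by elim: w => //= -[] // m w IH; rewrite mulf_neq0// (valP m). Qed.

Lemma num_neq0 w : num w != 0.
Proof. by elim: w => //= -[] // m w IH; rewrite mulf_neq0// (valP m). Qed.

Lemma level_gt0 w : (0 < level w)%N.
Proof.
elim: w => //= -[] // m w IH; rewrite muln_gt0 IH absz_gt0 mulf_neq0 ?den_neq0//.
exact: (valP m).
Qed.

Lemma den_dvd_level w : (`|den w| %| level w)%N.
Proof. by elim: w => //= -[] // m w IH; rewrite dvdn_mull. Qed.

(** The isometry [u c * s N] stands for the arithmetic progression of the numbers
    congruent to [c] modulo [N]; a word maps a fine enough progression to a
    progression or annihilates it. *)
Lemma word_act w c N : N != 0 -> (level w %| `|N|)%N ->
  eval w * (u c * s N) = 0 \/
  exists c' N', [/\ N' != 0, den w * c' = num w * c + shift w,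
    den w * N' = num w * N & eval w * (u c * s N) = u c' * s N'].
Proof.
move=> N0; elim: w => [_|g w IH].
  by right; exists c, N; rewrite /= !mul1r addr0.
move=> lN; have {IH}[] := IH.
- by case: g lN => //= m; apply: dvdn_trans; rewrite dvdn_mulr.
- by move=> w0; left; rewrite /= -mulrA w0 mulr0.
move=> [c' [N' [N'0 dc dN wE]]].
case: g lN => [j|m|m] /= lN; rewrite -/(eval w) -mulrA wE.
- right; exists (j + c'), N'; split=> //; first by rewrite mulrDr dc; ring.
  by rewrite mulrA (UZ_uD rel).
- right; exists (val m * c'), (val m * N'); have m0 := valP m.
  split; first by rewrite mulf_neq0.
  + by rewrite mulrCA dc mulrDr mulrA.
  + by rewrite mulrCA dN mulrA.
  + by rewrite mulrA (UZ_su rel)// -mulrA (UZ_sM rel).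
- have m0 := valP m.
  have /dvdzP[q qN] : (val m * den w %| N)%Z.
    by apply: dvdn_trans lN; rewrite dvdn_mull.
  have N'E : N' = val m * (num w * q).
    apply: (mulfI (den_neq0 w)); rewrite dN qN; ring.
  have nq0 : num w * q != 0 by apply: contra N'0 => /eqP nq0; rewrite N'E nq0 mulr0.
  have sN : s N' = s (val m) * s (num w * q) by rewrite N'E (UZ_sM rel).
  have [/dvdzP[t tc]|mc] := boolP (val m %| c')%Z; last first.
    by left; rewrite sN !mulrA UZ_orth// mul0r.
  right; exists t, (num w * q); split=> //.
  + by rewrite -mulrA mulrCA -dc tc; ring.
  + by rewrite qN; ring.
  + by rewrite tc mulrC sN !mulrA UZ_star_su// -(mulrA (u t)) UZ_sV// mulr1.
Qed.

Lemma eval_cat w1 w2 : eval (w1 ++ w2) = eval w1 * eval w2.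
Proof. by elim: w1 => [|g w IH] /=; rewrite ?mul1r// IH mulrA. Qed.

Definition letter_star (g : letter) := match g with
  | LU n => LU (- n) | LS m => LSt m | LSt m => LS m end.

Lemma eval_star w : star (eval w) = eval (rev (map letter_star w)).
Proof.
elim: w => [|g w IH] /=; first by rewrite star1.
rewrite rev_cons -cats1 eval_cat -IH starM; congr (_ * _).
by rewrite /= mulr1; case: g => [n|m|m] /=; rewrite ?UZ_star_u ?starK.
Qed.

Lemma eval_gauge (chi : int -> R[i]) (f : A -> A) w :
  (forall m n, m != 0 -> n != 0 -> chi (m * n) = chi m * chi n) ->
  (forall m, m != 0 -> cabs (chi m) = 1) ->
  is_star_hom f -> (forall n, f (u n) = u n) ->
  (forall m, m != 0 -> f (s m) = chi m *: s m) ->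
  f (eval w) = (conjc (chi (den w)) * chi (num w)) *: eval w.
Proof.
move=> chiM chi1 fh fu fs.
have chi11 : chi 1 = 1.
  have n1 : (1 : int) != 0 by [].
  have := chiM 1 1 n1 n1; rewrite mulr1 => /esym/eqP.
  rewrite -[X in _ == X]mulr1 -subr_eq0 -mulrBr mulf_eq0 subr_eq0.
  case/orP=> /eqP// chi0; have := chi1 _ n1; rewrite chi0 cabs0 => /eqP.
  by rewrite eq_sym oner_eq0.
elim: w => [|g w IH] /=; first by rewrite chi11 rmorph1 mulr1 scale1r (star_hom1 fh).
rewrite (star_homM fh) IH; case: g => [n|m|m] /=; rewrite ?fu ?(star_hom_star fh).
- by rewrite scaler_mulAr.
- have m0 := valP m; rewrite fs// chiM ?num_neq0// scaler_mulAl scaler_mulAr scalerA.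
  by congr (_ *: _); ring.
- have m0 := valP m; rewrite fs// starZ chiM ?den_neq0// scaler_mulAl scaler_mulAr.
  by rewrite scalerA rmorphM mulrA.
Qed.

Definition lincomb (l : seq (R[i] * word)) : A :=
  \sum_(i <- l) i.1 *: eval i.2.

Hypothesis gen : cstar_generated_by (UZ_generators u s).

(** The elements that linear combinations of words approximate form a
    C*-subalgebra that contains the generators. *)
Lemma words_dense x (e : R) : 0 < e -> exists l, nrm (x - lincomb l) < e.
Proof.
move=> e0; pose S := [set x | forall e : R, 0 < e -> exists l, nrm (x - lincomb l) < e].
suff ST : S = setT.
  have Sx : S x by rewrite ST.
  exact: Sx.
have Slc l : S (lincomb l) by move=> d d0; exists l; rewrite subrr nrm0.
have Sw w : S (eval w).
  by have := Slc [:: (1, w)]; rewrite /lincomb big_seq1 scale1r.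
apply: gen; last first.
  move=> _ [[n ->]|[m m0 ->]].
    by have := Sw [:: LU n]; rewrite /= mulr1.
  by have := Sw [:: LS (Sub m m0)]; rewrite /= mulr1.
split.
- by have := Slc [::]; rewrite /lincomb big_nil.
- move=> y z Sy Sz d d0; have d2 : 0 < d / 2 by rewrite divr_gt0.
  have [l1 l1P] := Sy _ d2; have [l2 l2P] := Sz _ d2; exists (l1 ++ l2).
  rewrite /lincomb big_cat /= opprD addrACA (le_lt_trans (nrmD _ _))//.
  by rewrite [ltRHS](splitr d) ltrD.
- move=> k y Sy d d0; have k1 : 0 < cabs k + 1 by rewrite ltr_wpDl// cabs_ge0.
  have [l lP] := Sy _ (divr_gt0 d0 k1).
  exists [seq (k * i.1, i.2) | i <- l]; rewrite /lincomb big_map /=.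
  under eq_bigr do rewrite -scalerA; rewrite -scaler_sumr -scalerBr nrmZ.
  move: lP; rewrite ltr_pdivlMr// => lP; apply: le_lt_trans lP.
  by rewrite mulrC ler_wpM2l ?nrm_ge0// lerDl.
- move=> y z Sy Sz d d0; pose K := nrm y + nrm z + 1.
  have y0 := nrm_ge0 y; have z0 := nrm_ge0 z.
  have K1 : 1 <= K by rewrite /K; lra.
  have K0 : 0 < K by exact: lt_le_trans K1.
  pose r := Num.min 1 (d / (2 * K)).
  have r0 : 0 < r by rewrite lt_min ltr01 divr_gt0// mulr_gt0.
  have [l1 l1P] := Sy _ r0; have [l2 l2P] := Sz _ r0.
  exists [seq (i.1 * j.1, i.2 ++ j.2) | i <- l1, j <- l2].
  have -> : lincomb [seq (i.1 * j.1, i.2 ++ j.2) | i <- l1, j <- l2] =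
      lincomb l1 * lincomb l2.
    rewrite /lincomb big_allpairs_dep mulr_suml; apply: eq_bigr => i _.
    rewrite mulr_sumr; apply: eq_bigr => j _ /=.
    by rewrite eval_cat scaler_mulAl scaler_mulAr scalerA.
  set a := lincomb l1 in l1P *; set b := lincomb l2 in l2P *.
  have -> : y * z - a * b = (y - a) * z + (a - y) * (z - b) + y * (z - b).
    by rewrite -addrA -mulrDl subrK mulrBl mulrBr addrA subrK.
  have rd : r * (2 * K) <= d.
    by rewrite -ler_pdivlMr ?mulr_gt0// /r ge_min lexx orbT.
  have r1 : r <= 1 by rewrite /r ge_min lexx.
  rewrite (le_lt_trans (nrmD _ _))// (le_lt_trans (lerD (nrmD _ _) (lexx _)))//.
  rewrite (le_lt_trans (lerD (lerD (nrmM _ _) (nrmM _ _)) (nrmM _ _)))//.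
  rewrite (nrmC a y).
  move: l1P l2P (nrm_ge0 (y - a)) (nrm_ge0 (z - b)) rd r1; rewrite /K.
  set n1 := nrm (y - a); set n2 := nrm (z - b) => l1P l2P n10 n20 rd r1.
  have h1 : n1 * nrm z <= r * nrm z by rewrite ler_wpM2r// ltW.
  have h2 : n1 * n2 <= r by rewrite -[leRHS]mulr1 ler_pM ?(ltW l1P)// (le_trans (ltW l2P)).
  have h3 : nrm y * n2 <= r * nrm y by rewrite mulrC ler_wpM2r// ltW.
  nra.
- move=> y Sy d d0; have [l lP] := Sy _ d0.
  exists [seq ((i.1^*)%C, rev (map letter_star i.2)) | i <- l].
  rewrite /lincomb big_map /=; under eq_bigr do rewrite -eval_star -starZ.
  by rewrite -star_sum -starB nrm_star.
- apply: nrm_closed => y Sy d d0; have d2 : 0 < d / 2 by rewrite divr_gt0.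
  have [z Sz yz] := Sy _ d2; have [l lP] := Sz _ d2; exists l.
  rewrite -(subrKA z) (le_lt_trans (nrmD _ _))// [ltRHS](splitr d) ltrD//.
Qed.

End Words.

(** * The diagonal subalgebra *)
Section Diagonal.
Context {R : realType} (A : cstarAlgType R) (u s : int -> A).
Hypothesis rel : UZ_relations u s.
Variable M : nat.
Hypothesis M0 : (0 < M)%N.

Let Mz : M%:Z != 0. Proof. by rewrite -lt0n. Qed.

(** The projection of the residue class of [i] modulo [M]. *)
Definition proj (i : int) : A := u i * (s M%:Z * star (s M%:Z)) * u (- i).

Definition diag (mu : nat -> R[i]) : A := \sum_(i < M) mu i *: proj i%:Z.

Lemma UZ_uK n : u (- n) * u n = 1.
Proof. by rewrite (UZ_uD rel) addNr (UZ_u0 rel). Qed.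

Lemma UZ_uVK n : u n * u (- n) = 1.
Proof. by rewrite (UZ_uD rel) addrN (UZ_u0 rel). Qed.

Lemma proj_star i : star (proj i) = proj i.
Proof. by rewrite /proj !starM starK !(UZ_star_u rel) opprK !mulrA. Qed.

Lemma projE i : proj i = (u i * s M%:Z) * star (u i * s M%:Z).
Proof. by rewrite /proj starM (UZ_star_u rel) !mulrA. Qed.

Lemma UZ_isom_us c N : N != 0 -> star (u c * s N) * (u c * s N) = 1.
Proof.
move=> N0; rewrite starM (UZ_star_u rel) mulrA -(mulrA _ (u (- c))) UZ_uK mulr1.
exact: UZ_sV rel _ N0.
Qed.

Lemma proj_fix (i c N : int) : N != 0 -> (M%:Z %| N)%Z -> (M%:Z %| c - i)%Z ->
  proj i * (u c * s N) = u c * s N.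
Proof.
move=> N0 /dvdzP[q qN] /dvdzP[t tE].
have q0 : q != 0 by apply: contra N0 => /eqP q0; rewrite qN q0 mul0r.
have cE : c = i + M%:Z * t by rewrite mulrC -tE; ring.
have sN : s N = s M%:Z * s q by rewrite (UZ_sM rel)// qN mulrC.
have -> : u c * s N = (u i * s M%:Z) * (u t * s q).
  by rewrite cE -(UZ_uD rel) sN !mulrA -(mulrA (u i) (s _) (u t)) (UZ_su rel)// !mulrA.
by rewrite projE -mulrA [star _ * _]mulrA UZ_isom_us// mul1r.
Qed.

Lemma proj_idem i : proj i * proj i = proj i.
Proof. by rewrite {2 3}projE mulrA proj_fix ?subrr ?dvdz0. Qed.

Lemma proj_per (i j : int) : (M%:Z %| j - i)%Z -> proj i = proj j.
Proof.
move=> ij; have E a b : (M%:Z %| b - a)%Z -> proj a * proj b = proj b.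
  by move=> ab; rewrite {1}[proj b]projE mulrA proj_fix// -projE.
have ji : (M%:Z %| i - j)%Z by rewrite -opprB rpredN.
have : star (proj j * proj i) = proj i * proj j by rewrite starM !proj_star.
by rewrite (E i j ij) (E j i ji) proj_star.
Qed.

Lemma proj_sum : \sum_(i < M) proj i%:Z = 1.
Proof. by have := UZ_sum rel Mz; rewrite big_mkord. Qed.

Lemma proj_orth (i j : 'I_M) : i != j -> proj i%:Z * proj j%:Z = 0.
Proof.
move=> ij; rewrite !projE mulrA -[X in X * _]mulrA starM (UZ_star_u rel).
rewrite [X in _ * X * _]mulrA -[X in _ * (X * _) * _]mulrA (UZ_uD rel).
rewrite UZ_orth ?mulr0 ?mul0r//.
apply: contra ij => /dvdzP[q qE]; apply/eqP/val_inj => /=.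
have := ltn_ord i; have := ltn_ord j; move: qE.
move: (nat_of_ord i) (nat_of_ord j) => {i}i {j}j qE jM iM.
have : q = 0 \/ q <= -1 \/ 1 <= q by lia.
by case=> [q0|[q0|q0]]; [rewrite q0 mul0r in qE; lia|nia|nia].
Qed.

Lemma proj_u i n : proj i * u n = u n * proj (i - n).
Proof.
by rewrite /proj opprB -!mulrA (UZ_uD rel) !mulrA (UZ_uD rel) subrKC addrC.
Qed.

Lemma diag_mul mu nu : diag mu * diag nu = diag (fun i => mu i * nu i).
Proof.
rewrite /diag mulr_suml; apply: eq_bigr => i _; rewrite mulr_sumr (bigD1 i)//= big1 ?addr0.
  by rewrite scaler_mulAl scaler_mulAr scalerA proj_idem.
move=> j ji; rewrite scaler_mulAl scaler_mulAr proj_orth ?scaler0//.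
by rewrite eq_sym.
Qed.

Lemma diag_star mu : star (diag mu) = diag (fun i => (mu i)^*)%C.
Proof. by rewrite /diag star_sum; apply: eq_bigr => i _; rewrite starZ proj_star. Qed.

Lemma diag1 : diag (fun=> 1) = 1.
Proof. by rewrite -proj_sum; apply: eq_bigr => i _; rewrite scale1r. Qed.

Lemma eq_diag mu nu : mu =1 nu -> diag mu = diag nu.
Proof. by move=> E; apply: eq_bigr => i _; rewrite E. Qed.

Lemma diagZ k mu : k *: diag mu = diag (fun i => k * mu i).
Proof. by rewrite /diag scaler_sumr; apply: eq_bigr => i _; rewrite scalerA. Qed.

Lemma diagD mu nu : diag mu + diag nu = diag (fun i => mu i + nu i).
Proof. by rewrite /diag -big_split; apply: eq_bigr => i _; rewrite scalerDl. Qed.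

(** With [nu = |mu| ^ 2], the element [star (diag mu) * diag mu = diag nu] is the
    real part of the unitary with values [nu + i sqrt (1 - nu ^ 2)]. *)
Lemma diag_nrm_le1 mu : (forall i, (i < M)%N -> cabs (mu i) <= 1) ->
  nrm (diag mu) <= 1.
Proof.
move=> mu1.
pose nu i : R := if (i < M)%N then cabs (mu i) ^+ 2 else 0.
have nu01 i : 0 <= nu i <= 1.
  rewrite /nu; case: ifP => [/mu1 mi|_]; last by rewrite lexx ler01.
  by rewrite exprn_ge0 ?cabs_ge0// expr_le1 ?cabs_ge0.
pose z i : R[i] := (nu i +i* Num.sqrt (1 - nu i ^+ 2))%C.
have zz i : (z i)^*%C * z i = 1.
  have nn : 0 <= 1 - nu i ^+ 2.
    by rewrite subr_ge0 expr_le1//; have /andP[] := nu01 i.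
  rewrite /z; apply/eqP; rewrite eq_complex /=.
  have := sqr_sqrtr nn; set q := Num.sqrt _ => qE.
  by apply/andP; split; apply/eqP; nra.
have U1 : nrm (diag z) <= 1.
  by apply: nrm_isometry; rewrite diag_star diag_mul -diag1; exact: eq_diag.
have E : star (diag mu) * diag mu = 2%:R^-1 *: (diag z + star (diag z)).
  rewrite !diag_star diag_mul diagD diagZ /diag; apply: eq_bigr => i _.
  congr (_ *: _); rewrite [LHS]mulrC -cabs_sqr /z /nu ltn_ord.
  apply/eqP; rewrite eq_complex; apply/andP.
  have h2 : (2^-1 : R[i]) = (2^-1)%:C%C by rewrite fmorphV rmorph_nat.
  by rewrite h2 /=; split; apply/eqP; field.
rewrite -(@expr_le1 _ 2)// ?nrm_ge0// -nrm_identity E nrm_half.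
by have := nrmD (diag z) (star (diag z)); rewrite nrm_star; lra.
Qed.

Lemma diag_nrm mu (d : R) : 0 < d -> (forall i, (i < M)%N -> cabs (mu i) <= d) ->
  nrm (diag mu) <= d.
Proof.
move=> d0 mud; have d00 : d%:C%C != 0 :> R[i] by rewrite eq_complex /= eqxx andbT gt_eqF.
have -> : diag mu = d%:C%C *: diag (fun i => d^-1%:C%C * mu i).
  rewrite diagZ; apply: eq_diag => i; rewrite mulrA -rmorphM /= divff ?mul1r//.
  by rewrite gt_eqF.
rewrite nrmZ cabs_real ?(ltW d0)// ler_piMr ?(ltW d0)// diag_nrm_le1// => i iM.
by rewrite cabsM cabs_real ?invr_ge0 ?(ltW d0)// mulrC ler_pdivrMr// mul1r mud.
Qed.

(** The clock unitary of the pair clock and shift: it has the eigenvalue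
    [zeta ^ (i j)] on the residue class of [i]. *)
Definition clock j : A := diag (fun i => (zeta M ^+ i) ^+ j).

Lemma clock_star j : star (clock j) = diag (fun i => ((zeta M ^+ i) ^+ j)^-1).
Proof.
rewrite diag_star; apply: eq_diag => i; rewrite conj_unimodular//.
by rewrite !cabsX cabs_zeta// !expr1n.
Qed.

Lemma clock_unitary j : star (clock j) * clock j = 1 /\ clock j * star (clock j) = 1.
Proof.
have z0 i : (zeta M ^+ i) ^+ j != 0 :> R[i] by rewrite !expf_neq0// zeta_unit.
rewrite clock_star; split; rewrite diag_mul -diag1; apply: eq_diag => i.
  by rewrite mulVf.
by rewrite divff.
Qed.

(** Conjugation by [clock j] multiplies [u 1] by a root of unity: this inner
    automorphism takes the place of the dual action for the translations, which
    does not extend to the dilations. *)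
Lemma clock_u1 j : clock j * u 1 = zeta M ^+ j *: (u 1 * clock j).
Proof.
pose f (i : int) : R[i] := (zeta M ^ i) ^+ j.
have fS i : f (i + 1) = zeta M ^+ j * f i.
  by rewrite /f expfzDr ?zeta_unit// expr1z exprMn mulrC.
have LE : clock j * u 1 = u 1 * \sum_(0 <= i < M) (f i%:Z *: proj (i%:Z - 1)).
  rewrite big_mkord /clock /diag mulr_suml mulr_sumr; apply: eq_bigr => i _.
  by rewrite scaler_mulAl scaler_mulAr proj_u.
have RE : zeta M ^+ j *: (u 1 * clock j) =
    u 1 * \sum_(0 <= i < M) (f i.+1%:Z *: proj i%:Z).
  rewrite big_mkord /clock /diag -scaler_mulAr scaler_sumr; congr (_ * _).
  by apply: eq_bigr => i _; rewrite scalerA -addn1 PoszD fS.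
rewrite LE RE; congr (_ * _).
have [m mE] : exists m, M = m.+1 by case: (M) M0 => // m _; exists m.
rewrite mE big_nat_recl// [RHS]big_nat_recr//= addrC; congr (_ + _); last first.
  by apply: eq_bigr => i _; rewrite -addn1 PoszD addrK.
congr (_ *: _).
  by rewrite -mE /f expr0z -exprnP (prim_expr_order (zetaP M0)).
apply: proj_per; rewrite mE sub0r opprK -[1]/(1%N%:Z) -PoszD addn1; exact: dvdzz.
Qed.

Lemma clock_u j n : clock j * u n = (zeta M ^ n) ^+ j *: (u n * clock j).
Proof.
have pos (k : nat) : clock j * u k%:Z = (zeta M ^ k%:Z) ^+ j *: (u k%:Z * clock j).
  elim: k => [|k IH]; first by rewrite (UZ_u0 rel) expr0z expr1n scale1r mulr1 mul1r.
  rewrite -addn1 PoszD -(UZ_uD rel) mulrA IH scaler_mulAl -mulrA clock_u1.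
  rewrite scaler_mulAr scalerA mulrA; congr (_ *: _).
  by rewrite expfzDr ?zeta_unit// expr1z exprMn.
case: n => k; first exact: pos.
rewrite NegzE; set m := k.+1; have z0 : (zeta M ^ m%:Z) ^+ j != 0 :> R[i].
  by rewrite expf_neq0// expfz_neq0// zeta_unit.
have := congr1 (fun x => u (- m%:Z) * x * u (- m%:Z)) (pos m).
rewrite scaler_mulAr scaler_mulAl !mulrA UZ_uK mul1r -mulrA -mulrA UZ_uVK mulr1.
move=> ->; rewrite scalerA -exprMn -expfzDr ?zeta_unit// addNr expr0z expr1n.
by rewrite scale1r.
Qed.

Lemma unitary_conj_star_hom (w : A) : star w * w = 1 -> w * star w = 1 ->
  is_star_hom (fun x => w * x * star w).
Proof.
move=> ww1 ww2; split.
- by move=> x y; rewrite mulrDr mulrDl.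
- by move=> k x; rewrite scaler_mulAr scaler_mulAl.
- by move=> x y; rewrite !mulrA -(mulrA _ (star w) w) ww1 mulr1.
- by rewrite mulr1.
- by move=> x; rewrite !starM starK mulrA.
Qed.

(** A word with [den w = num w] acts as a translation, so that on the residue
    classes modulo [M] it is this translation times 0 or 1. *)
Lemma word_diag w : den w = num w -> (level w %| M)%N ->
  exists theta : nat -> bool,
  (forall i, theta i -> (den w %| shift w)%Z) /\
  (forall c N i, N != 0 -> (M%:Z %| N)%Z -> (M%:Z %| c - i%:Z)%Z -> (i < M)%N ->
    eval u s w * (u c * s N) = (theta i)%:R *: (u (shift w %/ den w)%Z * (u c * s N))).
Proof.
move=> dn lM; have d0 := den_neq0 w.
have act i := word_act rel (i%:Z) Mz lM.
exists (fun i => `[< eval u s w * (u i%:Z * s M%:Z) <> 0 >]); split.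
  move=> i /asboolP w0; case: (act i) => // -[c' [N' [_ cE _ _]]].
  by apply/dvdzP; exists (c' - i%:Z); move: cE; rewrite -dn => cE; rewrite mulrBl mulrC cE; ring.
move=> c N i N0 MN Mc iM.
have tail x : eval u s w * (u i%:Z * s M%:Z) = x ->
    eval u s w * (u c * s N) = x * star (u i%:Z * s M%:Z) * (u c * s N).
  by move=> <-; rewrite -[in RHS](mulrA (eval u s w)) -projE -[RHS]mulrA proj_fix.
case: (pselect (eval u s w * (u i%:Z * s M%:Z) = 0)) => [w0|wn0].
  by rewrite asboolF ?scale0r ?(tail _ w0) ?mul0r//; apply.
rewrite asboolT// scale1r; case: (act i) => // -[c' [N' [_ cE NE wE]]].
have c'E : c' = (shift w %/ den w)%Z + i%:Z.
  apply: (mulfI d0); rewrite cE -dn mulrDr [RHS]addrC; congr (_ + _).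
  have dS : (den w %| shift w)%Z.
    by apply/dvdzP; exists (c' - i%:Z); move: cE; rewrite -dn => cE; rewrite mulrBl mulrC cE; ring.
  by rewrite mulrC divzK.
have N'E : N' = M%:Z by apply: (mulfI d0); rewrite NE -dn.
rewrite (tail _ wE) c'E N'E -(UZ_uD rel) -(mulrA (u _) (u i%:Z)).
by rewrite -(mulrA (u _) (u i%:Z * _)) -projE -mulrA proj_fix.
Qed.

Lemma word_diagE w : den w = num w -> (level w %| M)%N ->
  exists theta : nat -> bool,
  [/\ (forall i, theta i -> (den w %| shift w)%Z),
  (forall c N i, N != 0 -> (M%:Z %| N)%Z -> (M%:Z %| c - i%:Z)%Z -> (i < M)%N ->
    eval u s w * (u c * s N) = (theta i)%:R *: (u (shift w %/ den w)%Z * (u c * s N)))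
  & eval u s w = u (shift w %/ den w)%Z * diag (fun i => (theta i)%:R)].
Proof.
move=> dn lM; have [theta [H1 H2]] := word_diag dn lM; exists theta; split=> //.
rewrite -[LHS]mulr1 -proj_sum /diag !mulr_sumr; apply: eq_bigr => i _.
by rewrite projE mulrA (H2 _ _ i) ?dvdzz ?subrr ?dvdz0// scaler_mulAl scaler_mulAr !mulrA.
Qed.

Lemma clock_word j w : den w = num w -> (level w %| M)%N ->
  clock j * eval u s w * star (clock j) =
  (zeta M ^ (shift w %/ den w)%Z) ^+ j *: eval u s w.
Proof.
move=> dn lM; have [theta [_ _ ->]] := word_diagE dn lM.
rewrite mulrA clock_u !scaler_mulAl -!mulrA; congr (_ *: _); congr (_ * _).
rewrite clock_star !diag_mul; apply: eq_diag => i.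
by rewrite mulrCA divff ?mulr1// !expf_neq0// zeta_unit.
Qed.

Lemma word_eq0 w : den w = num w -> (level w %| M)%N -> ~~ (den w %| shift w)%Z ->
  eval u s w = 0.
Proof.
move=> dn lM ds; have [theta [th0 _ ->]] := word_diagE dn lM.
rewrite (@eq_diag _ (fun=> 0)); last first.
  by move=> i; case: (theta i) (th0 i) => // /(_ isT) ds'; rewrite ds' in ds.
by rewrite /diag big1 ?mulr0// => i _; rewrite scale0r.
Qed.

End Diagonal.

(** * Limits along divisibility *)
Section Ideals.
Context {R : realType} (A : cstarAlgType R) (J : set A).
Hypothesis JI : is_closed_ideal J.

(** [1 - (1 - z) ^ n] is in the ideal and tends to 1. *)
Lemma ideal_one z : J z -> nrm (1 - z) < 1 -> J 1.
Proof.
move=> Jz z1; apply: closed_nrm (ideal_closed JI) _ => e e0.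
have [|n ne] := @expr_small R (nrm (1 - z)) e _ e0; first by rewrite nrm_ge0.
exists (1 - (1 - z) ^+ n).
  elim: n {ne} => [|n IH]; first by rewrite expr0 subrr; exact: ideal0 JI.
  have -> : 1 - (1 - z) ^+ n.+1 = (1 - (1 - z) ^+ n) + (1 - z) ^+ n * z.
    by rewrite exprSr mulrBr mulr1 opprB addrA [RHS]addrAC.
  by apply: (idealD JI) => //; apply: (Defs.idealMl JI).
rewrite opprB addrC subrK; apply: le_lt_trans ne.
elim: n => [|n IH]; first by rewrite !expr0 nrm1_le1.
by rewrite !exprS (le_trans (nrmM _ _))// ler_wpM2l// nrm_ge0.
Qed.

Lemma ideal_scalar z (k : R[i]) (d : R) : ~ J 1 -> J z ->
  nrm (z - k *: (1 : A)) < d -> cabs k <= d.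
Proof.
move=> J1 Jz zk; rewrite leNgt; apply/negP => dk; apply: J1.
have k0 : 0 < cabs k by apply: lt_trans dk; apply: le_lt_trans zk; exact: nrm_ge0.
have kn0 : k != 0 by apply: contraTneq k0 => ->; rewrite cabs0 ltxx.
apply: (@ideal_one (k^-1 *: z)); first exact: (idealZ JI).
have -> : 1 - k^-1 *: z = - (k^-1 *: (z - k *: (1 : A))).
  by rewrite scalerBr scalerA mulVf// scale1r opprB.
rewrite nrmN nrmZ cabsV mulrC ltr_pdivrMr// mul1r; exact: lt_trans dk.
Qed.

End Ideals.

Section Eventually.

(** The limit filter of the averages: the moduli [M] in the divisibility order.
    A multiple of every given number is both large and divisible as required. *)
Definition eventually_dvd (P : nat -> Prop) :=
  exists M1, (0 < M1)%N /\ forall M, (0 < M)%N -> (M1 %| M)%N -> P M.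

Lemma eventually_and P Q : eventually_dvd P -> eventually_dvd Q ->
  eventually_dvd (fun M => P M /\ Q M).
Proof.
move=> [M1 [M10 PM]] [M2 [M20 QM]]; exists (M1 * M2)%N; rewrite muln_gt0 M10 M20.
split=> // M M0 dM; split; [apply: PM|apply: QM] => //; apply: dvdn_trans dM.
  exact: dvdn_mulr.
exact: dvdn_mull.
Qed.

Lemma eventually_imp (P Q : nat -> Prop) : (forall M, (0 < M)%N -> P M -> Q M) ->
  eventually_dvd P -> eventually_dvd Q.
Proof. by move=> PQ [M1 [M10 PM]]; exists M1; split=> // M M0 dM; apply: PQ; auto. Qed.

Lemma eventually_all (T : finType) (P : T -> nat -> Prop) :
  (forall t, eventually_dvd (P t)) -> eventually_dvd (fun M => forall t, P t M).
Proof.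
move=> Pt; suff : eventually_dvd (fun M => {in enum T, forall t, P t M}).
  by apply: eventually_imp => M _ H t; apply: H; rewrite mem_enum.
elim: (enum T) => [|t r IH]; first by exists 1%N.
apply: eventually_imp (eventually_and (Pt t) IH) => M _ [Pm Pr] t'.
by rewrite inE => /predU1P[->//|]; exact: Pr.
Qed.

Lemma eventually_lt n (P : nat -> nat -> Prop) :
  (forall a, (a < n)%N -> eventually_dvd (P a)) ->
  eventually_dvd (fun M => forall a, (a < n)%N -> P a M).
Proof.
elim: n => [|n IH] Pa; first by exists 1%N.
have := eventually_and (Pa n (ltnSn n)) (IH (fun a an => Pa a (leqW an))).
apply: eventually_imp => M _ [Pn Plt] a; rewrite ltnS leq_eqVlt => /predU1P[->//|].
exact: Plt.
Qed.

Lemma eventually_dvdn n : (0 < n)%N -> eventually_dvd (fun M => n %| M)%N.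
Proof. by move=> n0; exists n. Qed.

End Eventually.

Section LinearContractions.
Context {R : realType} (A : cstarAlgType R).

Record lin_contr (f : A -> A) : Prop := {
  lcD : forall x y, f (x + y) = f x + f y;
  lcZ : forall k x, f (k *: x) = k *: f x;
  lc_nrm : forall x, nrm (f x) <= nrm x }.

Lemma lc0 f : lin_contr f -> f 0 = 0.
Proof. by move=> fl; rewrite -(scale0r 0) (lcZ fl) !scale0r. Qed.

Lemma lcB f x y : lin_contr f -> f (x - y) = f x - f y.
Proof. by move=> fl; rewrite (lcD fl) -(scaleN1r y) (lcZ fl) scaleN1r. Qed.

Lemma lc_sum f (I : Type) (r : seq I) (F : I -> A) : lin_contr f ->
  f (\sum_(i <- r) F i) = \sum_(i <- r) f (F i).
Proof. by move=> fl; rewrite (big_morph f (lcD fl) (lc0 fl)). Qed.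

Lemma lc_id : lin_contr id. Proof. by []. Qed.

Lemma lc_comp f g : lin_contr f -> lin_contr g -> lin_contr (f \o g).
Proof.
move=> fl gl; split=> [x y|k x|x] /=; first by rewrite (lcD gl) (lcD fl).
  by rewrite (lcZ gl) (lcZ fl).
exact: le_trans (lc_nrm fl _) (lc_nrm gl _).
Qed.

Lemma lc_hom f : is_star_hom f -> lin_contr f.
Proof.
move=> fh; split; [exact: (star_homD fh)|exact: (star_homZ fh)|].
exact: star_hom_nrm fh.
Qed.

Lemma lc_avg M (f : nat -> A -> A) : (0 < M)%N -> (forall j, lin_contr (f j)) ->
  lin_contr (fun x => avg M (fun j => f j x)).
Proof.
move=> M0 fl; split=> [x y|k x|x].
- by rewrite -avgD; apply: eq_avg => j; rewrite (lcD (fl j)).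
- by rewrite -avgZ; apply: eq_avg => j; rewrite (lcZ (fl j)).
- by apply: avg_nrm => // j; exact: lc_nrm.
Qed.

End LinearContractions.

Section Step.
Context {R : realType} (A : cstarAlgType R) (u s : int -> A).
Hypotheses (rel : UZ_relations u s).
Hypothesis gen : cstar_generated_by (UZ_generators u s).
Variable J : set A.
Hypothesis JI : is_closed_ideal J.

(** [F M] tends to 0 at each element of the ideal. *)
Definition vanishing (F : nat -> A -> A) := forall x, J x -> forall e : R, 0 < e ->
  eventually_dvd (fun M => nrm (F M x) <= e).

(** Removes the last averaging [beta] from a composite of averagings. The
    hypothesis on words holds because words are eigenvectors of all the
    automorphisms, and [Phi M] maps a word to a multiple of it. *)
Lemma fejer_step (Phi : nat -> A -> A) (beta : nat -> nat -> A -> A) (v : A) :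
  (forall M, (0 < M)%N -> lin_contr (Phi M)) ->
  (forall M j, (0 < M)%N -> is_star_hom (beta M j)) ->
  (forall M j, (0 < M)%N -> beta M j v = zeta M ^+ j *: v) ->
  star v * v = 1 ->
  (forall M a b x, (0 < M)%N ->
    Phi M (v ^+ a * x * star v ^+ b) = v ^+ a * Phi M x * star v ^+ b) ->
  (forall w, exists k : int, eventually_dvd (fun M => forall j,
     beta M j (Phi M (eval u s w)) = (zeta M ^ k) ^+ j *: Phi M (eval u s w))) ->
  vanishing (fun M x => avg M (fun j => beta M j (Phi M x))) ->
  vanishing Phi.
Proof.
move=> Phil betah betav vv Phiv eig van x Jx e e0.
have e8 : 0 < e / 8 by rewrite divr_gt0.
have [l xl] := words_dense rel gen x e8.
pose k w := projT1 (cid (eig w)).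
pose K := \sum_(i <- l) `|k i.2|%N%:R * (cabs i.1 * nrm (eval u s i.2)) : R.
have K0 : 0 <= K by apply: sumr_ge0 => i _; rewrite !mulr_ge0// ?cabs_ge0 ?nrm_ge0.
pose n := (Num.truncn (K / (e / 4))).+1.
have e4 : 0 < e / 4 by rewrite divr_gt0.
have Kn : K / n%:R <= e / 4.
  rewrite ler_pdivrMr ?ltr0n// mulrC -ler_pdivrMr//; apply: ltW; exact: truncnS_gt.
have en : 0 < e / 4 / n%:R by rewrite divr_gt0// ltr0n.
have Ev1 := @eventually_dvdn n isT.
have Ev2 := @eventually_all 'I_(size l) _ (fun i => projT2 (cid (eig (tnth (in_tuple l) i).2))).
have Ev3 : eventually_dvd (fun M => forall a, (a < n)%N -> forall b, (b < n)%N ->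
    nrm (avg M (fun j => beta M j (Phi M (v ^+ a * x * star v ^+ b)))) <= e / 4 / n%:R).
  apply: eventually_lt => a _; apply: eventually_lt => b _; apply: van => //.
  by apply: (Defs.idealMr JI); apply: (Defs.idealMl JI).
apply: eventually_imp (eventually_and Ev1 (eventually_and Ev2 Ev3)) => M M0 [nM [wM xM]].
have nM' : (n <= M)%N by exact: dvdn_leq.
have P := Phil M M0.
pose w (i : R[i] * word) := i.1 *: Phi M (eval u s i.2).
have := @fejer_estimate _ A M n (beta M) v isT nM' (fun j => betah M j M0)
  (fun j => betav M j M0) vv (e / 4 / n%:R) 'I_(size l) (index_enum _)
  (fun i => w (tnth (in_tuple l) i)) (fun i => k (tnth (in_tuple l) i).2) (Phi M x).
have E1 : \sum_(i < size l) w (tnth (in_tuple l) i) = Phi M (lincomb u s l).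
  rewrite -(big_tnth _ _ _ xpredT w) /lincomb lc_sum//.
  by apply: eq_bigr => i _; rewrite /w (lcZ P).
have E2 : \sum_(i < size l) `|k (tnth (in_tuple l) i).2|%N%:R *
    nrm (w (tnth (in_tuple l) i)) <= K.
  rewrite -(big_tnth _ _ _ xpredT (fun i => `|k i.2|%N%:R * nrm (w i))).
  apply: ler_sum => i _; rewrite ler_wpM2l// nrmZ ler_wpM2l ?cabs_ge0//.
  exact: lc_nrm.
rewrite E1 -lcB//; set S := \sum_(i < _) _ in E2 *.
have Sn : S / n%:R <= K / n%:R by rewrite ler_wpM2r// invr_ge0 ler0n.
have xl' := le_trans (lc_nrm P (x - lincomb u s l)) (ltW xl).
have ne : n%:R * (e / 4 / n%:R) = e / 4.
  by rewrite mulrC divfK// pnatr_eq0.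
move=> /(_ _ _)/le_trans; apply.
- move=> i j; rewrite /w (star_homZ (betah M j M0)) scalerA mulrC -scalerA; congr (_ *: _).
  exact: wM.
- by move=> a b an bn; rewrite -Phiv//; exact: xM.
rewrite ne; lra.
Qed.

End Step.

(** * Gauge automorphisms *)
Section Gauge.
Context {R : realType} (A : cstarAlgType R) (u s : int -> A).
Hypothesis UZ : is_UZ u s.

Let rel := is_UZ_relations UZ.
Let gen := is_UZ_generated UZ.

Definition character (chi : int -> R[i]) :=
  (forall m n, m != 0 -> n != 0 -> chi (m * n) = chi m * chi n) /\
  (forall m, m != 0 -> cabs (chi m) = 1).

Definition gauge_spec chi (f : A -> A) :=
  [/\ is_star_hom f, forall n, f (u n) = u n
    & forall m, m != 0 -> f (s m) = chi m *: s m].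

(** The family [chi m *: s m] satisfies the relations of [s], because [chi] is
    multiplicative of modulus 1. *)
Lemma gauge_exists chi : character chi -> exists f, gauge_spec chi f.
Proof.
move=> [chiM chi1]; apply: (is_UZ_universal UZ).
have cc m : m != 0 -> (chi m)^*%C * chi m = 1.
  by move=> m0; rewrite mulrC -cabs_sqr chi1// expr1n.
split.
- exact: (UZ_unitary rel).
- move=> m m0; rewrite /is_isometry starZ scaler_mulAl scaler_mulAr scalerA cc//.
  by rewrite scale1r (UZ_sV rel).
- move=> m n m0 n0; rewrite scaler_mulAl scaler_mulAr scalerA chiM//.
  by rewrite (UZ_sM rel).
- exact: (UZ_uD rel).
- by move=> m n m0; rewrite scaler_mulAl scaler_mulAr (UZ_su rel).
- move=> m m0; rewrite -[RHS](UZ_sum rel m0); apply: eq_bigr => n _.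
  rewrite /final_projection starZ scaler_mulAl !scaler_mulAr scalerA mulrC cc//.
  by rewrite scale1r.
Qed.

Definition gauge chi : A -> A :=
  if pselect (exists f, gauge_spec chi f) is left h then projT1 (cid h) else id.

Lemma gaugeP chi : character chi -> gauge_spec chi (gauge chi).
Proof.
rewrite /gauge => chiP; case: pselect => [h|]; first exact: (projT2 (cid h)).
by case; exact: gauge_exists.
Qed.

(** For [p] not prime the logarithm [logn p] is zero and the character is
    trivial; this allows [p] to run through all natural numbers. *)
Definition prime_char p M j (m : int) : R[i] := (zeta M ^+ j) ^+ logn p `|m|.

Lemma prime_charP p M j : (0 < M)%N -> character (prime_char p M j).
Proof.
move=> M0; split=> [m n m0 n0|m _].
  by rewrite /prime_char abszM lognM ?absz_gt0// exprD.
by rewrite /prime_char !cabsX cabs_zeta// !expr1n.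
Qed.

Definition sign_char (m : int) : R[i] := (sgz m)%:~R.

Lemma sign_charP : character sign_char.
Proof.
split=> [m n _ _|m m0]; first by rewrite /sign_char sgzM rmorphM.
by rewrite /sign_char; case: sgzP m0 => // _ _; rewrite /cabs ?normrN normr1.
Qed.

Definition prime_avg p M x := avg M (fun j => gauge (prime_char p M j) x).

(** The averages for the primes [p] with [k <= p < k + d]. *)
Fixpoint tail_avg d k M x :=
  if d is d'.+1 then prime_avg k M (tail_avg d' k.+1 M x) else x.

Definition sign_avg x := 2%:R^-1 *: (x + gauge sign_char x).

Lemma gauge_hom chi : character chi -> is_star_hom (gauge chi).
Proof. by move=> /gaugeP[]. Qed.

Lemma gauge_word chi w : character chi ->
  gauge chi (eval u s w) = (conjc (chi (den w)) * chi (num w)) *: eval u s w.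
Proof. by move=> chiP; have [? ? ?] := gaugeP chiP; apply: eval_gauge => //; case: chiP. Qed.

Lemma prime_avg_lc p M : (0 < M)%N -> lin_contr (prime_avg p M).
Proof. by move=> M0; apply: lc_avg => // j; apply/lc_hom/gauge_hom/prime_charP. Qed.

Lemma tail_avg_lc d k M : (0 < M)%N -> lin_contr (tail_avg d k M).
Proof.
move=> M0; elim: d k => [|d IH] k; first exact: lc_id.
exact: (lc_comp (prime_avg_lc k M0) (IH k.+1)).
Qed.

Lemma sign_avg_lc : lin_contr sign_avg.
Proof.
have L := lc_hom (gauge_hom sign_charP); rewrite /sign_avg; split=> [x y|k x|x].
- by rewrite (lcD L) addrACA scalerDr.
- by rewrite (lcZ L) -scalerDr !scalerA mulrC.
- by rewrite nrm_half; have := nrmD x (gauge sign_char x); have := lc_nrm L x; lra.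
Qed.

(** The exponent of [p] in the rational number [num w / den w]. *)
Definition prime_weight p w : int := (logn p `|num w|)%:Z - (logn p `|den w|)%:Z.

Lemma gauge_prime_word p M j w : (0 < M)%N ->
  gauge (prime_char p M j) (eval u s w) = (zeta M ^ prime_weight p w) ^+ j *: eval u s w.
Proof.
move=> M0; rewrite gauge_word; last exact: prime_charP.
congr (_ *: _); rewrite /prime_char /prime_weight conj_unimodular; last first.
  by rewrite !cabsX cabs_zeta// !expr1n.
rewrite expfzDr ?zeta_unit// exprMn -exprnP -exprz_inv mulrC -exprnP.
by rewrite !exprVn -!exprM [(j * _)%N]mulnC [(j * logn p `|den w|)%N]mulnC.
Qed.

Lemma prime_avg_word p M w : (0 < M)%N -> prime_avg p M (eval u s w) =
  if (M %| `|prime_weight p w|)%N then eval u s w else 0.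
Proof.
move=> M0; rewrite -avg_eigen//; apply: eq_avg => j; exact: gauge_prime_word.
Qed.

Lemma tail_avg_word d k M w : (0 < M)%N -> exists b : bool,
  tail_avg d k M (eval u s w) = b%:R *: eval u s w.
Proof.
move=> M0; elim: d k => [|d IH] k; first by exists true; rewrite scale1r.
have [b /= ->] := IH k.+1; rewrite (lcZ (prime_avg_lc k M0)) prime_avg_word//.
case: ifP => _; first by exists b.
by exists false; rewrite scaler0 scale0r.
Qed.

Lemma tail_avg_fix d k M w : (0 < M)%N ->
  (forall p, (k <= p)%N -> prime_weight p w = 0) ->
  tail_avg d k M (eval u s w) = eval u s w.
Proof.
move=> M0; elim: d k => [//|d IH] k wk /=; rewrite IH; last first.
  by move=> p kp; apply: wk; exact: ltnW.
by rewrite prime_avg_word// wk// dvdn0.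
Qed.

Lemma tail_avg_kill d k M w p : (0 < M)%N -> (k <= p < k + d)%N ->
  ~~ (M %| `|prime_weight p w|)%N -> tail_avg d k M (eval u s w) = 0.
Proof.
move=> M0; elim: d k => [|d IH] k /=; first by rewrite addn0; case: ltngtP.
move=> /andP[kp pd] wp; have [kp'|kp'|kp'] := ltngtP k p; last first.
- have [b ->] := tail_avg_word d k.+1 w M0.
  by rewrite (lcZ (prime_avg_lc k M0)) prime_avg_word// kp' (negPf wp) scaler0.
- by move: kp'; rewrite ltnNge kp.
- by rewrite IH ?kp' ?addSnnS// (lc0 (prime_avg_lc k M0)).
Qed.

Lemma sign_avg_word w : sign_avg (eval u s w) =
  (sgz (num w) == sgz (den w))%:R *: eval u s w.
Proof.
rewrite /sign_avg gauge_word; last exact: sign_charP.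
rewrite /sign_char rmorph_int -rmorphM /=.
have h2 : (2%:R : R[i]) != 0 by rewrite pnatr_eq0.
rewrite -[X in _ *: (X + _)]scale1r -scalerDl scalerA; congr (_ *: _).
have := den_neq0 w; have := num_neq0 w.
case: (sgzP (num w)) => // _ _; case: (sgzP (den w)) => // _ _ /=; by field.
Qed.

Lemma star_hom_fix (f : A -> A) x v a b : is_star_hom f -> f v = v ->
  f (v ^+ a * x * star v ^+ b) = v ^+ a * f x * star v ^+ b.
Proof.
move=> fh fv.
have fX y n : f y = y -> f (y ^+ n) = y ^+ n.
  move=> fy; elim: n => [|n IH]; first by rewrite !expr0 (star_hom1 fh).
  by rewrite !exprS (star_homM fh) fy IH.
by rewrite !(star_homM fh) !fX// (star_hom_star fh) fv.
Qed.

Lemma prime_avg_bimod p M v a b x : (0 < M)%N ->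
  (forall j, gauge (prime_char p M j) v = v) ->
  prime_avg p M (v ^+ a * x * star v ^+ b) = v ^+ a * prime_avg p M x * star v ^+ b.
Proof.
move=> M0 fv; rewrite /prime_avg -avg_mull -avg_mulr; apply: eq_avg => j.
by apply: star_hom_fix => //; exact/gauge_hom/prime_charP.
Qed.

Lemma tail_avg_bimod d k M v a b x : (0 < M)%N ->
  (forall p j, (k <= p)%N -> gauge (prime_char p M j) v = v) ->
  tail_avg d k M (v ^+ a * x * star v ^+ b) = v ^+ a * tail_avg d k M x * star v ^+ b.
Proof.
move=> M0; elim: d k => [//|d IH] k fv /=; rewrite IH; last first.
  by move=> p j kp; apply: fv; exact: ltnW.
by apply: prime_avg_bimod => // j; exact: fv.
Qed.

Lemma sign_avg_bimod v a b x : gauge sign_char v = v ->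
  sign_avg (v ^+ a * x * star v ^+ b) = v ^+ a * sign_avg x * star v ^+ b.
Proof.
move=> fv; rewrite /sign_avg (star_hom_fix _ _ _ (gauge_hom sign_charP) fv).
by rewrite scaler_mulAr scaler_mulAl mulrDr mulrDl.
Qed.

End Gauge.

(** * A proper closed ideal is zero *)
Section Simplicity.
Context {R : realType} (A : cstarAlgType R) (u s : int -> A).
Hypothesis UZ : is_UZ u s.
Variable J : set A.
Hypothesis JI : is_closed_ideal J.
Hypothesis J1 : ~ J 1.

Let rel := is_UZ_relations UZ.
Let gen := is_UZ_generated UZ.

Definition bound (w : word) : nat := (`|num w| + `|den w| + `|shift w|)%N.

(** A multiple of [depth w] is divisible by the level of [w] and larger than all
    the integers that describe its affine map. *)
Definition depth (w : word) : nat := (level w * (bound w).+1)%N.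

Lemma depth_gt0 w : (0 < depth w)%N.
Proof. by rewrite muln_gt0 level_gt0. Qed.

Lemma depth_level w M : (depth w %| M)%N -> (level w %| M)%N.
Proof. by apply: dvdn_trans; exact: dvdn_mulr. Qed.

Lemma depth_bound w M : (0 < M)%N -> (depth w %| M)%N -> (bound w < M)%N.
Proof.
move=> M0 /(dvdn_leq M0); apply: leq_trans.
by rewrite /depth leq_pmull// level_gt0.
Qed.

(** The averages over all primes from [k] to [M]. For [k = 0] they keep the words
    whose affine map has slope 1 or -1; [avg_dilations] also removes the slope -1,
    and [avg_diag] removes the translations other than the identity. *)
Definition avg_above k M : A -> A := tail_avg u s (M - k) k M.

Definition avg_dilations M : A -> A := fun x => sign_avg u s (avg_above 0 M x).

Definition clock_conj M j x := clock u s M j * x * star (clock u s M j).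

Definition avg_diag M : A -> A := fun x => avg M (fun j => clock_conj M j (avg_dilations M x)).

Lemma clock_conj_hom M j : (0 < M)%N -> is_star_hom (clock_conj M j).
Proof. by move=> M0; have [? ?] := clock_unitary rel M0 j; exact: unitary_conj_star_hom. Qed.

Lemma avg_above_lc k M : (0 < M)%N -> lin_contr (avg_above k M).
Proof. by move=> M0; exact: tail_avg_lc. Qed.

Lemma avg_dilations_lc M : (0 < M)%N -> lin_contr (avg_dilations M).
Proof. by move=> M0; apply: (lc_comp (sign_avg_lc UZ) (avg_above_lc 0 M0)). Qed.

Lemma avg_diag_lc M : (0 < M)%N -> lin_contr (avg_diag M).
Proof.
move=> M0; have := @lc_avg _ A M (fun j => clock_conj M j \o avg_dilations M) M0; apply => j.
by apply: lc_comp (avg_dilations_lc M0); apply/lc_hom/clock_conj_hom.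
Qed.

Lemma logn_lt p m : (0 < m)%N -> (logn p m < m)%N.
Proof.
move=> m0; case: (posnP (logn p m)) => [->//|l0].
have p1 : (1 < p)%N by apply: prime_gt1; move: l0; rewrite logn_gt0 mem_primes => /andP[].
by apply: leq_trans (ltn_expl _ p1) (dvdn_leq m0 (pfactor_dvdnn p m)).
Qed.

Lemma prime_weight_large p w : (bound w < p)%N -> prime_weight p w = 0.
Proof.
move=> wp; have small m : (m < p)%N -> (0 < m)%N -> logn p m = 0%N.
  move=> mp m0; apply/eqP; rewrite -leqn0 leqNgt logn_gt0 mem_primes.
  by apply/negP => /and3P[_ _ /(dvdn_leq m0)]; rewrite leqNgt mp.
rewrite /prime_weight !small ?absz_gt0 ?num_neq0 ?den_neq0//.
  by apply: leq_ltn_trans wp; rewrite /bound addnAC leq_addl.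
by apply: leq_ltn_trans wp; rewrite /bound -addnA leq_addr.
Qed.

Lemma prime_weight_small p w : (`|prime_weight p w| <= bound w)%N.
Proof.
have := @logn_lt p `|num w|%N; have := @logn_lt p `|den w|%N.
rewrite !absz_gt0 num_neq0 den_neq0 => /(_ isT) h1 /(_ isT) h2.
rewrite /prime_weight /bound; lia.
Qed.

Lemma avg_above0_word M w : (0 < M)%N -> (depth w %| M)%N -> avg_above 0 M (eval u s w) =
  (`|num w|%N == `|den w|%N)%:R *: eval u s w.
Proof.
move=> M0 dM; have bM := depth_bound M0 dM.
have [E|nE] := eqVneq `|num w|%N `|den w|%N.
  rewrite scale1r /avg_above tail_avg_fix// => p _; by rewrite /prime_weight E subrr.
rewrite scale0r.
have [p wp] : exists p, prime_weight p w != 0.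
  apply/not_existsP => w0; move/eqP: nE; apply.
  apply: eqn_from_log; rewrite ?absz_gt0 ?num_neq0 ?den_neq0// => p.
  have /negP := w0 p; rewrite negbK /prime_weight subr_eq0 => /eqP; lia.
apply: (@tail_avg_kill _ _ _ _ UZ _ _ _ _ p M0).
  rewrite subn0 add0n leq0n /= ltnNge; apply/negP => Mp; move: wp.
  by rewrite prime_weight_large ?eqxx//; exact: leq_trans bM Mp.
rewrite gtnNdvd ?absz_gt0//; exact: leq_ltn_trans (prime_weight_small p w) bM.
Qed.

Lemma avg_dilations_word M w : (0 < M)%N -> (depth w %| M)%N ->
  avg_dilations M (eval u s w) = (num w == den w)%:R *: eval u s w.
Proof.
move=> M0 dM; rewrite /avg_dilations avg_above0_word// (lcZ (sign_avg_lc UZ)) (sign_avg_word UZ) scalerA.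
congr (_ *: _); rewrite -natrM mulnb; congr (nat_of_bool _)%:R.
by apply/idP/idP; [move=> /andP[/eqP a /eqP b]; apply/eqP; lia|move=> /eqP->; rewrite !eqxx].
Qed.

Lemma clock_avg_dilations w M j : (0 < M)%N -> (depth w %| M)%N ->
  clock_conj M j (avg_dilations M (eval u s w)) =
  (zeta M ^ (shift w %/ den w)%Z) ^+ j *: avg_dilations M (eval u s w).
Proof.
move=> M0 dM; rewrite avg_dilations_word//.
have [E|_] := eqVneq; last first.
  by rewrite !scale0r scaler0 (lc0 (lc_hom (clock_conj_hom j M0))).
by rewrite !scale1r /clock_conj (clock_word rel)// (depth_level dM).
Qed.

Lemma avg_diag_word M w : (0 < M)%N -> (depth w %| M)%N ->
  avg_diag M (eval u s w) = ((num w == den w) && (shift w == 0))%:R *: eval u s w.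
Proof.
move=> M0 dM; have bM := depth_bound M0 dM.
rewrite /avg_diag (eq_avg M (fun j => clock_avg_dilations j M0 dM)) avg_eigen// avg_dilations_word//.
have [E|_] := eqVneq; last by rewrite !scale0r; case: ifP.
have d0 := den_neq0 w; rewrite /= !scale1r.
have [->|s0] := eqVneq (shift w) 0; first by rewrite div0z dvdn0 scale1r.
rewrite scale0r; have [/dvdzP[q qE]|ds] := boolP (den w %| shift w)%Z; last first.
  by rewrite (word_eq0 rel M0 _ (depth_level dM))//; case: ifP.
have q0 : q != 0 by apply: contra s0 => /eqP q0; rewrite qE q0 mul0r.
rewrite qE mulzK// gtnNdvd ?absz_gt0//; apply: leq_ltn_trans bM.
rewrite /bound qE abszM; have : (0 < `|den w|)%N by rewrite absz_gt0.
by nia.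
Qed.

Let abs_shift (M i : nat) : (i < M)%N -> (M <= absz (i%:Z + M%:Z)%R < 2 * M)%N.
Proof. lia. Qed.

Let absz_add (a b : int) : (absz (a + b)%R <= absz a + absz b)%N.
Proof. lia. Qed.

(** The point [c = i + M] is larger than the coefficients of the affine map of
    [w], hence not fixed by it. The progressions of [c] and of its image lie in
    progressions modulo [N / den w]; these are disjoint because the displacement
    of [c] is not zero and at most [2 M ^ 2], less than the factor [2 M ^ 2 + 1]
    of [N / den w]. *)
Lemma generic_compression M w (i : nat) : (0 < M)%N -> (depth w %| M)%N -> (i < M)%N ->
  ~~ ((num w == den w) && (shift w == 0)) ->
  let c : int := i%:Z + M%:Z in let N : int := (M * (2 * M * M).+1)%N%:Z in
  star (u c * s N) * eval u s w * (u c * s N) = 0.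
Proof.
move=> M0 dM iM nd c N.
have lM := depth_level dM; have bM := depth_bound M0 dM.
have N0 : N != 0 by rewrite -lt0n muln_gt0 M0.
have lN : (level w %| `|N|)%N by rewrite dvdn_mulr.
rewrite -mulrA; have [->|[c' [N' [N'0 cE NE ->]]]] := word_act rel c N0 lN.
  by rewrite mulr0.
have d0 := den_neq0 w; have n0 := num_neq0 w.
have /dvdnP[q qE] : (`|den w| %| M)%N by exact: dvdn_trans (den_dvd_level w) lM.
have [e eE] : exists e : int, M%:Z = e * den w.
  by apply/dvdzP; rewrite /dvdz qE; apply/dvdnP; exists q.
set X := (2 * M * M).+1.
have NX : N = (e * X%:Z) * den w by rewrite /N PoszM eE -/X; ring.
have NX' : N' = (e * X%:Z) * num w.
  by apply: (mulfI d0); rewrite NE NX; ring.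
have eX0 : e * X%:Z != 0 by apply: contra N0 => /eqP eX; rewrite NX eX mul0r.
have sN : s N = s (e * X%:Z) * s (den w) by rewrite NX (UZ_sM rel).
have sN' : s N' = s (e * X%:Z) * s (num w) by rewrite NX' (UZ_sM rel).
rewrite starM (UZ_star_u rel) mulrA -(mulrA _ (u _) (u _)) (UZ_uD rel).
rewrite sN sN' starM !mulrA -(mulrA (star (s (den w)))) -(mulrA _ (_ * u _)).
rewrite (UZ_orth rel) ?mulr0 ?mul0r//.
have eN : (den w * (- c + c') = (num w - den w) * c + shift w).
  by rewrite mulrDr cE; ring.
have cM : (M <= `|c| < 2 * M)%N by exact: abs_shift.
have l0 : - c + c' != 0.
  apply/eqP => l0; move: eN; rewrite l0 mulr0 => /esym/eqP.
  move: nd; have [nE|nE] := eqVneq (num w) (den w).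
    by rewrite nE subrr mul0r add0r /= => /negPf->.
  move=> _ /eqP H.
  have k0 : (0 < `|(num w - den w)%R|)%N by rewrite absz_gt0 subr_eq0.
  have H2 : (`|shift w| = `|(num w - den w)%R| * `|c|)%N.
    by rewrite -abszM; move/eqP: H; rewrite addrC addr_eq0 => /eqP->; rewrite abszN.
  have : (M <= `|shift w|)%N.
    by rewrite H2 (leq_trans (proj1 (andP cM)))// leq_pmull.
  by apply/negP; rewrite -ltnNge; apply: leq_ltn_trans bM; exact: leq_addl.
rewrite dvdzE gtnNdvd ?absz_gt0//.
have lB : (`|(- c + c')%R| <= 2 * M * M)%N.
  have h1 : (`|(- c + c')%R| <= `|(den w * (- c + c'))%R|)%N.
    by rewrite abszM leq_pmull// absz_gt0.
  apply: leq_trans h1 _; rewrite eN.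
  have h2 : (`|((num w - den w) * c + shift w)%R| <=
             (`|num w| + `|den w|) * `|c| + `|shift w|)%N.
    apply: leq_trans (absz_add _ _) _; rewrite leq_add2r abszM leq_mul2r.
    by apply/orP; right; apply: leq_trans (absz_add _ _) _; rewrite abszN.
  apply: leq_trans h2 _.
  have h3 : ((`|num w| + `|den w|) * `|c| + `|shift w| <= bound w * (2 * M))%N.
    have /andP[_ /ltnW cM2] := cM; have M2 : (0 < 2 * M)%N by rewrite muln_gt0.
    by rewrite /bound [leqRHS]mulnDl leq_add ?leq_pmulr ?leq_mul.
  by apply: leq_trans h3 _; rewrite mulnC leq_mul// ltnW.
rewrite abszM /=; apply: leq_ltn_trans lB _; rewrite leq_pmull// absz_gt0.
by apply: contra eX0 => /eqP->; rewrite mul0r.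
Qed.

(** For [y] close to [x], the average of [y] is diagonal, with values [mu i]; each
    of them is the compression of [y] by an isometry [V], so it is close to
    [star V * x * V], which is in [J]. *)
Lemma vanishing_avg_diag : vanishing J avg_diag.
Proof.
move=> x Jx e e0; have e2 : 0 < e / 2 by rewrite divr_gt0.
have [l xl] := words_dense rel gen x e2.
have Ev := @eventually_all 'I_(size l) (fun i M => depth (tnth (in_tuple l) i).2 %| M)%N
  (fun i => eventually_dvdn (depth_gt0 _)).
apply: eventually_imp Ev => M M0 dM.
pose D w := (num w == den w) && (shift w == 0).
have Mz : M%:Z != 0 by rewrite -lt0n.
have pt (t : 'I_(size l)) : exists theta : nat -> bool,
    D (tnth (in_tuple l) t).2 ->
    (forall c N i, N != 0 -> (M%:Z %| N)%Z -> (M%:Z %| c - i%:Z)%Z -> (i < M)%N ->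
      eval u s (tnth (in_tuple l) t).2 * (u c * s N) = (theta i)%:R *: (u c * s N)) /\
    eval u s (tnth (in_tuple l) t).2 = diag u s M (fun i => (theta i)%:R).
  have [/andP[/eqP nd /eqP sh]|] := boolP (D _); last by exists (fun=> true).
  have [th [_ th1 th2]] := word_diagE rel M0 (esym nd) (depth_level (dM t)).
  exists th => _; move: th1 th2; rewrite sh div0z (UZ_u0 rel) => th1 th2; split.
    by move=> c N i N0 MN Mc iM; rewrite (th1 c N i)// mul1r.
  by rewrite th2 mul1r.
have [T' T'P] := choice pt.
pose ct (t : 'I_(size l)) := (tnth (in_tuple l) t).1.
pose wt (t : 'I_(size l)) := (tnth (in_tuple l) t).2.
pose mu i : R[i] := \sum_(t < size l) ct t * ((D (wt t))%:R * (T' t i)%:R).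
have lE : lincomb u s l = \sum_(t < size l) ct t *: eval u s (wt t).
  by rewrite /lincomb (big_tnth _ _ l).
have avgE : avg_diag M (lincomb u s l) = diag u s M mu.
  rewrite lE (lc_sum _ _ (avg_diag_lc M0)) /diag /mu.
  under [RHS]eq_bigr do rewrite scaler_suml.
  rewrite exchange_big; apply: eq_bigr => t _ /=.
  rewrite (lcZ (avg_diag_lc M0)) (avg_diag_word M0 (dM t)) -/(D _) -/(wt t).
  under eq_bigr do rewrite -scalerA.
  rewrite -scaler_sumr; congr (_ *: _).
  have [Dt|Dt] := boolP (D (wt t)); last first.
    by rewrite scale0r big1// => i _; rewrite mul0r scale0r.
  by rewrite scale1r (T'P t Dt).2; apply: eq_bigr => i _; rewrite mul1r.
have mu_le i : (i < M)%N -> cabs (mu i) <= e / 2.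
  move=> iM; pose c : int := i%:Z + M%:Z.
  pose N : int := (M * (2 * M * M).+1)%N%:Z.
  have N0 : N != 0 by rewrite -lt0n muln_gt0 M0.
  pose V := u c * s N.
  have VV : star V * V = 1 by exact: UZ_isom_us.
  have yE : star V * lincomb u s l * V = mu i *: (1 : A).
    rewrite lE mulr_sumr mulr_suml /mu scaler_suml; apply: eq_bigr => t _.
    rewrite scaler_mulAr scaler_mulAl -scalerA; congr (_ *: _).
    have [Dt|Dt] := boolP (D (wt t)); last first.
      by rewrite mul0r scale0r; apply: generic_compression => //; exact: dM.
    rewrite mul1r -mulrA ((T'P t Dt).1 c N i)//.
    + by rewrite scaler_mulAr VV.
    + by rewrite dvdzE dvdn_mulr.
    + by rewrite /c addrAC subrr add0r dvdzz.
  apply: (ideal_scalar JI J1 (z := star V * x * V)).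
    by apply: (Defs.idealMr JI); apply: (Defs.idealMl JI).
  rewrite -yE -mulrBl -mulrBr.
  have V1 := nrm_isometry VV.
  rewrite (le_lt_trans _ xl)// (le_trans (nrmM _ _))//.
  have sV1 : nrm (star V) <= 1 by rewrite nrm_star.
  have := nrmM (star V) (x - lincomb u s l).
  have := nrm_ge0 (x - lincomb u s l); have := nrm_ge0 (star V).
  have := nrm_ge0 V; have := nrm_ge0 (star V * (x - lincomb u s l)).
  nra.
rewrite -(subrK (lincomb u s l) x) (lcD (avg_diag_lc M0)) (le_trans (nrmD _ _))//.
rewrite [leRHS](splitr e) lerD//; last by rewrite avgE diag_nrm.
exact: le_trans (lc_nrm (avg_diag_lc M0) _) (ltW xl).
Qed.

Lemma vanishing_avg_dilations : vanishing J avg_dilations.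
Proof.
apply: (@fejer_step _ _ u s rel gen J JI avg_dilations clock_conj (u 1)).
- exact: avg_dilations_lc.
- by move=> M j; exact: clock_conj_hom.
- move=> M j M0; rewrite /clock_conj (clock_u1 rel)// scaler_mulAl -mulrA.
  by rewrite (clock_unitary rel M0 j).2 mulr1.
- by have [] := UZ_unitary rel 1.
- move=> M a b x M0; rewrite /avg_dilations /avg_above tail_avg_bimod// => [|p j _].
    rewrite sign_avg_bimod//; have [_ fu _] := gaugeP UZ sign_charP; exact: fu.
  have [_ fu _] := gaugeP UZ (prime_charP p j M0); exact: fu.
- move=> w; exists (shift w %/ den w)%Z.
  apply: eventually_imp (eventually_dvdn (depth_gt0 w)) => M M0 dM j.
  exact: clock_avg_dilations.
- exact: vanishing_avg_diag.
Qed.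

(** The sign takes only two values, so no Fejer mean is needed: [z] is the sum of
    the even part of [z] and [star (s (-1))] times the even part of
    [s (-1) * z]. *)
Lemma vanishing_avg_above0 : vanishing J (avg_above 0).
Proof.
move=> x Jx e e0; have e2 : 0 < e / 2 by rewrite divr_gt0.
have m0 : (-1 : int) != 0 by [].
have Jy : J (s (-1) * x) by exact: Defs.idealMl.
apply: eventually_imp (eventually_and (vanishing_avg_dilations Jx e2) (vanishing_avg_dilations Jy e2)).
move=> M M0 [xe ye].
have [fh _ fs] := gaugeP UZ sign_charP.
have sE : avg_above 0 M (s (-1) * x) = s (-1) * avg_above 0 M x.
  have := @tail_avg_bimod _ _ _ _ UZ (M - 0) 0 M (s (-1)) 1 0 x M0.
  rewrite !expr0 !expr1 !mulr1; apply => p j _.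
  have [_ _ ->//] := gaugeP UZ (prime_charP p j M0).
  by rewrite /prime_char logn1 expr0 scale1r.
have f1 : gauge u s sign_char (s (-1)) = - s (-1) by rewrite fs// scaleN1r.
have ss : star (s (-1)) * s (-1) = 1 by rewrite (UZ_sV rel).
move: xe ye; rewrite /avg_dilations sE; set z := avg_above 0 M x => xe ye.
have zE : z = sign_avg u s z + star (s (-1)) * sign_avg u s (s (-1) * z).
  rewrite /sign_avg (star_homM fh) f1 scaler_mulAr -scalerDr mulrDr mulrA ss mul1r.
  by rewrite mulNr mulrN mulrA ss mul1r addrACA subrr addr0 scale_half.
rewrite zE [leRHS](splitr e) (le_trans (nrmD _ _))// lerD//.
rewrite (le_trans (nrmM _ _))// (le_trans _ ye)// ler_piMl ?nrm_ge0//.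
by rewrite nrm_star nrm_isometry.
Qed.

Lemma lin_contr_id (f : A -> A) x : lin_contr f ->
  (forall w, f (eval u s w) = eval u s w) -> f x = x.
Proof.
move=> fl fw; apply: (@eq_nrm_small _ _ _ _ 2) => e e0.
have [l xl] := words_dense rel gen x e0.
have yE : f (lincomb u s l) = lincomb u s l.
  by rewrite /lincomb (lc_sum _ _ fl); apply: eq_bigr => i _; rewrite (lcZ fl) fw.
rewrite -(subrKA (lincomb u s l)) -{1}yE -(lcB _ _ fl).
have := nrmD (f (x - lincomb u s l)) (lincomb u s l - x).
by have := lc_nrm fl (x - lincomb u s l); rewrite (nrmC _ x); lra.
Qed.

Lemma avg_aboveS k M x : (k < M)%N -> avg_above k M x = prime_avg u s k M (avg_above k.+1 M x).
Proof. by move=> kM; rewrite /avg_above -(subnSK kM). Qed.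

(** By induction on [k], one prime at a time; the averages for the larger primes
    commute with the multiplication by [s k]. *)
Lemma vanishing_avg_above k : vanishing J (avg_above k).
Proof.
elim: k => [|k IH]; first exact: vanishing_avg_above0.
have vanS : vanishing J (fun M x => prime_avg u s k M (avg_above k.+1 M x)).
  move=> x Jx e e0.
  apply: eventually_imp (eventually_and (IH x Jx e e0) (@eventually_dvdn k.+1 isT)).
  by move=> M M0 [xe kM]; rewrite -avg_aboveS// (dvdn_leq M0 kM).
have [pk|npk] := boolP (prime k); last first.
  move=> x Jx e e0; apply: eventually_imp (vanS x Jx e e0) => M M0.
  rewrite (lin_contr_id _ (prime_avg_lc UZ k M0))// => w.
  have lk m : logn k m = 0%N by rewrite lognE (negPf npk).
  by rewrite (prime_avg_word UZ)// /prime_weight !lk subrr dvdn0.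
apply: (@fejer_step _ _ u s rel gen J JI (avg_above k.+1)
   (fun M j => if (0 < M)%N then gauge u s (prime_char k M j) else id) (s k%:Z)).
- by move=> M M0; exact: avg_above_lc.
- by move=> M j M0; rewrite M0; exact/(gauge_hom UZ)/prime_charP.
- move=> M j M0; rewrite M0; have [_ _ ->] := gaugeP UZ (prime_charP k j M0).
    by rewrite /prime_char /= logn_prime// eqxx expr1.
  by rewrite -lt0n prime_gt0.
- by rewrite (UZ_sV rel)// -lt0n prime_gt0.
- move=> M a b x M0; rewrite /avg_above tail_avg_bimod// => p j kp.
  have [_ _ ->] := gaugeP UZ (prime_charP p j M0); last by rewrite -lt0n prime_gt0.
  by rewrite /prime_char /= logn_prime// gtn_eqF// expr0 scale1r.
- move=> w; exists (prime_weight k w); exists 1%N; split=> // M M0 _ j; rewrite M0.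
  rewrite /avg_above; have [b ->] := tail_avg_word UZ (M - k.+1) k.+1 w M0.
  have gh := gauge_hom UZ (prime_charP k j M0).
  by rewrite (star_homZ gh) (gauge_prime_word UZ)// !scalerA mulrC.
- move=> x Jx e e0; apply: eventually_imp (vanS x Jx e e0) => M M0.
  by rewrite M0.
Qed.

(** The words of a given approximation of [x] involve no prime above some [k], so
    that the averages over the primes above [k] fix this approximation. *)
Lemma proper_ideal_eq0 x : J x -> x = 0.
Proof.
move=> Jx; apply: (@nrm_small _ _ _ 3) => e e0.
have [l xl] := words_dense rel gen x e0.
pose k := (\max_(t < size l) bound (tnth (in_tuple l) t).2).+1.
have [M1 [M10 /(_ M1 M10 (dvdnn _)) xe]] := vanishing_avg_above k Jx e0.
have yE : avg_above k M1 (lincomb u s l) = lincomb u s l.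
  rewrite /lincomb (lc_sum _ _ (avg_above_lc k M10)) (big_tnth _ _ l) [RHS](big_tnth _ _ l).
  apply: eq_bigr => t _; rewrite (lcZ (avg_above_lc k M10)) /avg_above (tail_avg_fix UZ)// => p kp.
  apply: prime_weight_large; apply: leq_trans kp; rewrite /k ltnS.
  exact: (@leq_bigmax _ (fun t => bound (tnth (in_tuple l) t).2)).
have -> : x = (x - lincomb u s l) - avg_above k M1 (x - lincomb u s l) + avg_above k M1 x.
  by rewrite (lcB _ _ (avg_above_lc k M10)) yE opprB addrA !subrK.
have h1 := nrmD (x - lincomb u s l - avg_above k M1 (x - lincomb u s l)) (avg_above k M1 x).
have h2 := nrmB (x - lincomb u s l) (avg_above k M1 (x - lincomb u s l)).
have h3 := lc_nrm (avg_above_lc k M10) (x - lincomb u s l).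
lra.
Qed.

End Simplicity.

(** * Square-summable functions on the integers *)
Section Summation.
Context {R : realType}.
Implicit Types (f g : int -> R) (r : seq int).

Definition sums f := [set \sum_(i <- r) f i | r in [set r | uniq r]].

Definition summable f := (forall i, 0 <= f i) /\ has_ubound (sums f).

(** For a nonnegative family, its unordered sum. *)
Definition total f : R := sup (sums f).

Lemma summableP f (K : R) : (forall i, 0 <= f i) ->
  (forall r, uniq r -> \sum_(i <- r) f i <= K) -> summable f.
Proof. by move=> f0 fK; split=> //; exists K => _ [r ur <-]; exact: fK. Qed.

Lemma sums_nonempty f : sums f !=set0.
Proof. by exists 0, [::] => //; rewrite big_nil. Qed.

Lemma total_ub f r : summable f -> uniq r -> \sum_(i <- r) f i <= total f.
Proof. by move=> [_ fb] ur; apply: ub_le_sup => //; exists r. Qed.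

Lemma total_le f (K : R) : (forall r, uniq r -> \sum_(i <- r) f i <= K) -> total f <= K.
Proof. by move=> fK; apply: ge_sup => [|_ [r ur <-]]; [exact: sums_nonempty|exact: fK]. Qed.

Lemma total_ge0 f : summable f -> 0 <= total f.
Proof. by move=> fs; have := @total_ub f [::] fs isT; rewrite big_nil. Qed.

Lemma total_ub1 f i : summable f -> f i <= total f.
Proof. by move=> fs; have := @total_ub f [:: i] fs isT; rewrite big_seq1. Qed.

Lemma eq_total f g : f =1 g -> total f = total g.
Proof. by move=> /funext->. Qed.

Lemma le_summable f g : (forall i, 0 <= f i) -> (forall i, f i <= g i) ->
  summable g -> summable f.
Proof.
move=> f0 fg gs; apply: (@summableP _ (total g)) => // r ur.
by apply: le_trans (total_ub gs ur); apply: ler_sum => i _.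
Qed.

Lemma sum_sub_le f r t : (forall i, 0 <= f i) -> uniq r -> uniq t -> {subset r <= t} ->
  \sum_(i <- r) f i <= \sum_(i <- t) f i.
Proof.
move=> f0 ur ut rt; rewrite [leRHS](bigID (mem r))/=.
have <- : \sum_(i <- r) f i = \sum_(i <- t | i \in r) f i.
  rewrite -[RHS]big_filter; apply: perm_big; apply: uniq_perm => //; first exact: filter_uniq.
  by move=> i; rewrite mem_filter; case: (boolP (i \in r)) => // /rt->.
by rewrite lerDl sumr_ge0.
Qed.

Lemma summableD f g : summable f -> summable g -> summable (fun i => f i + g i).
Proof.
move=> fs gs; apply: (@summableP _ (total f + total g)) => [i|r ur].
  by rewrite addr_ge0//; [exact: fs.1|exact: gs.1].
by rewrite big_split lerD// total_ub.
Qed.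

Lemma totalD f g : summable f -> summable g ->
  total (fun i => f i + g i) = total f + total g.
Proof.
move=> fs gs; have fgs := summableD fs gs; apply/eqP; rewrite eq_le; apply/andP; split.
  by apply: total_le => r ur; rewrite big_split lerD// total_ub.
rewrite -lerBrDr; apply: total_le => r ur; rewrite lerBrDr addrC -lerBrDr.
apply: total_le => t ut; rewrite lerBrDr.
have uu := undup_uniq (r ++ t); apply: le_trans (total_ub fgs uu).
rewrite big_split addrC; apply: lerD; apply: sum_sub_le => //.
- exact: fs.1.
- by move=> i ir; rewrite mem_undup mem_cat ir.
- exact: gs.1.
- by move=> i it; rewrite mem_undup mem_cat it orbT.
Qed.

Lemma summableZ (c : R) f : 0 <= c -> summable f -> summable (fun i => c * f i).
Proof.
move=> c0 fs; apply: (@summableP _ (c * total f)) => [i|r ur].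
  by rewrite mulr_ge0//; exact: fs.1.
by rewrite -mulr_sumr ler_wpM2l// total_ub.
Qed.

Lemma totalZ (c : R) f : 0 <= c -> summable f -> total (fun i => c * f i) = c * total f.
Proof.
have le d g : 0 <= d -> summable g -> total (fun i => d * g i) <= d * total g.
  by move=> d0 gs; apply: total_le => r ur; rewrite -mulr_sumr ler_wpM2l// total_ub.
move=> c0 fs; apply/eqP; rewrite eq_le le//=.
have [->|cn0] := eqVneq c 0.
  by rewrite mul0r total_ge0//; exact: (summableZ (lexx 0)).
have cp : 0 < c by rewrite lt_def cn0.
rewrite mulrC -ler_pdivlMr// mulrC.
apply: le_trans (le _ _ _ (summableZ c0 fs)); last by rewrite invr_ge0.
by rewrite le_eqVlt; apply/orP; left; apply/eqP/eq_total => i; rewrite mulrA mulVf ?mul1r.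
Qed.

(** [p] is an injective partial map, so that the values of [f], where they are
    not zero, are values of [g] at different places. *)
Lemma total_reindex_le (p p' : int -> option int) f g :
  (forall i j, p i = Some j -> p' j = Some i) ->
  (forall i j, p i = Some j -> f i = g j) -> (forall i, p i = None -> f i = 0) ->
  (forall i, 0 <= f i) -> summable g -> summable f /\ total f <= total g.
Proof.
move=> pp' fg f0 fp gs.
have fr r : uniq r -> \sum_(i <- r) f i <= total g.
  move=> ur; have up : uniq (pmap p r).
    elim: r ur => //= i r IH /andP[ir ur]; case E : (p i) => [j|] /=; last exact: IH.
    rewrite IH// andbT; apply/negP => /[!mem_pmap] /mapP[i' i'r E'].
    by move: (pp' _ _ E) (pp' i' j (esym E')) => -> [ii']; rewrite ii' i'r in ir.
  apply: le_trans (total_ub gs up).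
  elim: r {ur up} => [|i r IH]; rewrite ?big_nil// big_cons /=.
  by case E : (p i) => [j|] /=; [rewrite big_cons (fg _ _ E) lerD2l|rewrite f0// add0r].
by split; [exact: summableP fr|exact: total_le].
Qed.

End Summation.

Section SquareSummable.
Context {R : realType}.

Definition nsq (z : R[i]) : R := complex.Re z ^+ 2 + complex.Im z ^+ 2.

Lemma nsq_ge0 z : 0 <= nsq z.
Proof. by rewrite addr_ge0// sqr_ge0. Qed.

Lemma nsq_eq0 z : nsq z = 0 -> z = 0.
Proof.
move/eqP; rewrite paddr_eq0 ?sqr_ge0// !sqrf_eq0 => /andP[/eqP a /eqP b].
by apply/eqP; rewrite eq_complex a b !eqxx.
Qed.

Lemma nsqM k z : nsq (k * z) = nsq k * nsq z.
Proof. by case: k z => [a b] [c d]; rewrite /nsq /=; ring. Qed.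

Lemma nsq_cabs k : nsq k = cabs k ^+ 2.
Proof. by rewrite /nsq /cabs normc_def /= sqr_sqrtr// addr_ge0 ?sqr_ge0. Qed.

Lemma nsqD2 y z : nsq (y + z) + nsq (y - z) = 2 * nsq y + 2 * nsq z.
Proof. by case: y z => [a b] [c d]; rewrite /nsq /=; ring. Qed.

Definition l2 : {pred (int -> R[i])} := fun x => `[< summable (fun i => nsq (x i)) >].

Lemma l2P (x : int -> R[i]) : reflect (summable (fun i => nsq (x i))) (x \in l2).
Proof. exact: asboolP. Qed.

Fact l2_closed : submod_closed l2.
Proof.
split.
  apply/l2P; apply: (@summableP _ _ 0) => [i|r _]; first exact: nsq_ge0.
  by rewrite big1// => i _; rewrite /nsq /= expr0n addr0.
move=> k x y /l2P xs /l2P ys; apply/l2P.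
have h : summable (fun i => 2 * (nsq k * nsq (x i)) + 2 * nsq (y i)).
  apply: summableD; apply: summableZ => //; apply: summableZ => //; exact: nsq_ge0.
apply: le_summable h => i; first exact: nsq_ge0.
rewrite -nsqM -nsqD2 -[X in X <= _]addr0 lerD ?nsq_ge0//.
Qed.

HB.instance Definition _ := GRing.isSubmodClosed.Build R[i] (int -> R[i]) l2 l2_closed.

Record hilbert := Hilbert { hval :> int -> R[i]; hvalP : hval \in l2 }.
HB.instance Definition _ := [isSub for hval].
HB.instance Definition _ := [Choice of hilbert by <:].
HB.instance Definition _ := [SubChoice_isSubLmodule of hilbert by <:].

Implicit Types x y z : hilbert.

Lemma hvalD x y i : hval (x + y) i = hval x i + hval y i. Proof. by []. Qed.
Lemma hvalN x i : hval (- x) i = - hval x i. Proof. by []. Qed.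
Lemma hvalZ k x i : hval (k *: x) i = k * hval x i. Proof. by []. Qed.

Lemma hilbertP x y : (forall i, hval x i = hval y i) -> x = y.
Proof. by move=> xy; apply: val_inj; apply: funext. Qed.

Definition energy x : R := total (fun i => nsq (hval x i)).

Lemma hsummable x : summable (fun i => nsq (hval x i)).
Proof. exact/l2P/hvalP. Qed.

Lemma energy_ge0 x : 0 <= energy x.
Proof. exact/total_ge0/hsummable. Qed.

Lemma energy_eq0 x : energy x = 0 -> x = 0.
Proof.
move=> x0; apply: hilbertP => i; apply: nsq_eq0; apply/eqP.
by rewrite eq_le nsq_ge0 andbT -x0; exact: (total_ub1 i (hsummable x)).
Qed.

Lemma energyZ k x : energy (k *: x) = nsq k * energy x.
Proof.
rewrite -totalZ ?nsq_ge0//; last exact: hsummable.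
by apply: eq_total => i; rewrite hvalZ nsqM.
Qed.

(** The real part of the inner product, by polarization. Only unordered sums of
    nonnegative numbers occur in it, so its properties reduce to pointwise
    identities between squares. For complex-linear maps the real part of the inner
    product determines the adjoint. *)
Definition dot x y : R := (energy (x + y) - energy (x - y)) / 4.

Lemma energyN x : energy (- x) = energy x.
Proof. by apply: eq_total => i; rewrite hvalN /nsq; case: (hval x i) => a b /=; ring. Qed.

Lemma dotC x y : dot x y = dot y x.
Proof. by rewrite /dot [x + y]addrC -(energyN (x - y)) opprB. Qed.


Lemma energyD2 x y : energy (x + y) + energy (x - y) = 2 * energy x + 2 * energy y.
Proof.
rewrite /energy -!totalZ//; try exact: hsummable.
rewrite -!totalD; do ?[exact: hsummable|apply: summableZ => //; exact: hsummable].
by apply: eq_total => i; rewrite hvalD hvalD hvalN nsqD2.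
Qed.

Lemma dotDl x y z : dot (x + y) z = dot x z + dot y z.
Proof.
suff : energy (x + y + z) + (energy (x - z) + energy (y - z)) =
       energy (x + y - z) + (energy (x + z) + energy (y + z)).
  by rewrite /dot; lra.
rewrite /energy -!totalD; do ?[exact: hsummable|apply: summableD; exact: hsummable].
apply: eq_total => i; rewrite !hvalD hvalN /nsq.
by case: (hval x i) (hval y i) (hval z i) => [a b] [c d] [e f] /=; ring.
Qed.

Lemma dotDr x y z : dot x (y + z) = dot x y + dot x z.
Proof. by rewrite !(dotC x) dotDl. Qed.

Lemma dotNl x y : dot (- x) y = - dot x y.
Proof.
rewrite /dot -(energyN (- x + y)) opprD opprK -(energyN (- x - y)) opprD !opprK.
by ring.
Qed.

Lemma dotNr x y : dot x (- y) = - dot x y.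
Proof. by rewrite dotC dotNl dotC. Qed.

Lemma dot_conj (k : R[i]) x y : dot (k *: x) y = dot x ((conjc k) *: y).
Proof.
suff : energy (k *: x + y) + energy (x - conjc k *: y) =
       energy (k *: x - y) + energy (x + conjc k *: y) by rewrite /dot; lra.
rewrite /energy -!totalD; try exact: hsummable.
apply: eq_total => i; rewrite !hvalD !hvalN !hvalZ /nsq.
by case: k (hval x i) (hval y i) => [a b] [c d] [e f] /=; ring.
Qed.

Lemma dotZr (c : R) x y : 0 <= c -> dot x (c%:C%C *: y) = c * dot x y.
Proof.
move=> c0; suff : energy (x + c%:C%C *: y) + c * energy (x - y) =
       energy (x - c%:C%C *: y) + c * energy (x + y) by rewrite /dot; lra.
rewrite /energy -!totalZ//; try exact: hsummable.
rewrite -!totalD; do ?[exact: hsummable|apply: summableZ => //; exact: hsummable].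
apply: eq_total => i; rewrite !hvalD !hvalN !hvalZ /nsq.
by case: (hval x i) (hval y i) => [a b] [e f] /=; ring.
Qed.

Lemma dotxx x : dot x x = energy x.
Proof.
have e0 : energy 0 = 0.
  by rewrite -(scale0r 0) energyZ /nsq /= expr0n addr0 mul0r.
by have := energyD2 x x; rewrite /dot subrr e0; lra.
Qed.

Lemma dot_eq0 x : (forall y, dot y x = 0) -> x = 0.
Proof. by move=> x0; apply: energy_eq0; rewrite -dotxx. Qed.

Definition hnorm x : R := Num.sqrt (energy x).

Lemma hnorm_ge0 x : 0 <= hnorm x. Proof. exact: sqrtr_ge0. Qed.

Lemma hnorm_sqr x : hnorm x ^+ 2 = energy x.
Proof. by rewrite sqr_sqrtr// energy_ge0. Qed.

Lemma hnorm_eq0 x : hnorm x = 0 -> x = 0.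
Proof. by move=> x0; apply: energy_eq0; rewrite -hnorm_sqr x0 expr0n. Qed.

Lemma hnorm0 : hnorm 0 = 0.
Proof. by apply/eqP; rewrite -sqrf_eq0 hnorm_sqr -(scale0r 0) energyZ /nsq /= expr0n addr0 mul0r. Qed.

Lemma hnormZ k x : hnorm (k *: x) = cabs k * hnorm x.
Proof.
rewrite /hnorm energyZ sqrtrM ?nsq_ge0//; congr (_ * _).
by rewrite nsq_cabs sqrtr_sqr ger0_norm// cabs_ge0.
Qed.

Lemma hnormN x : hnorm (- x) = hnorm x.
Proof. by rewrite /hnorm energyN. Qed.

Lemma energyD x y : energy (x + y) = energy x + 2 * dot x y + energy y.
Proof. by have := energyD2 x y; rewrite /dot; lra. Qed.

Lemma cauchy_schwarz x y : dot x y <= hnorm x * hnorm y.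
Proof.
have [x0|x0] := eqVneq (hnorm x) 0.
  rewrite x0 mul0r (hnorm_eq0 x0) -(scale0r y) dot_conj conjc0 scale0r /dot.
  by rewrite subr0 addr0 subrr mul0r.
have [y0|y0] := eqVneq (hnorm y) 0.
  rewrite y0 mulr0 (hnorm_eq0 y0) /dot.
  by rewrite subr0 addr0 subrr mul0r.
have a0 : 0 < hnorm x by rewrite lt_def x0 hnorm_ge0.
have b0 : 0 < hnorm y by rewrite lt_def y0 hnorm_ge0.
have := energy_ge0 ((hnorm y)%:C%C *: x - (hnorm x)%:C%C *: y).
rewrite energyD energyN !energyZ dotNr dotZr ?(ltW a0)// dotC dotZr ?(ltW b0)// (dotC y x).
rewrite !nsq_cabs !cabs_real ?(ltW a0) ?(ltW b0)// -!hnorm_sqr.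
have := mulr_gt0 a0 b0; nra.
Qed.

Lemma hnormD x y : hnorm (x + y) <= hnorm x + hnorm y.
Proof.
rewrite -(@ler_sqr _ _ _) ?nnegrE ?addr_ge0 ?hnorm_ge0//.
rewrite sqrrD !hnorm_sqr energyD lerD2r lerD2l -[leRHS]mulr_natl ler_wpM2l//.
exact: cauchy_schwarz.
Qed.

Lemma hnormB x y : hnorm (x - y) <= hnorm x + hnorm y.
Proof. by rewrite -(hnormN y) hnormD. Qed.

Lemma hnorm_le x (K : R) : 0 <= K ->
  (forall r, uniq r -> \sum_(i <- r) nsq (hval x i) <= K ^+ 2) -> hnorm x <= K.
Proof.
move=> K0 xK; rewrite -(@ler_sqr _ _ _) ?nnegrE ?hnorm_ge0// hnorm_sqr.
exact: total_le.
Qed.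

Lemma hnorm_coord x i : nsq (hval x i) <= hnorm x ^+ 2.
Proof. by rewrite hnorm_sqr; exact: total_ub1 (hsummable x). Qed.

(** The limit is taken in each coordinate; the bounds on the distances hold for
    the finite partial sums, hence for the limit. *)
Lemma hilbert_complete (x : nat -> hilbert) (c : nat -> R) :
  (forall n m, (n <= m)%N -> hnorm (x m - x n) <= c n) ->
  (forall e, 0 < e -> exists n, c n < e) ->
  exists l, forall n, hnorm (l - x n) <= c n.
Proof.
move=> xc c0.
have cn0 n : 0 <= c n by rewrite (le_trans (hnorm_ge0 _) (xc n n (leqnn n))).
have coord (h : R[i] -> R) : (forall a b, h (a - b) = h a - h b) ->
    (forall a, h a ^+ 2 <= nsq a) -> forall i,
    exists l : R, (fun m => h (hval (x m) i)) @ \oo --> l.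
  move=> hB hn i; apply/cvg_ex; apply: cauchy_cvg; apply/cauchy_ballP => e e0.
  have [n ne] := c0 _ (divr_gt0 e0 (ltr0n R 2)).
  have close m : (n <= m)%N -> `|h (hval (x m) i) - h (hval (x n) i)| < e / 2.
    move=> nm; apply: le_lt_trans ne; rewrite -hB.
    rewrite -(@ler_sqr _ _ _) ?nnegrE// real_normK ?num_real//.
    apply: le_trans (hn _) _; rewrite -hvalN -hvalD.
    apply: le_trans (hnorm_coord _ _) _.
    by rewrite ler_sqr ?nnegrE ?hnorm_ge0// xc.
  exists ([set h (hval (x m) i) | m in [set m | (n <= m)%N]],
          [set h (hval (x m) i) | m in [set m | (n <= m)%N]]).
    by split; exists n => // m /= nm; exists m.
  move=> [_ _] /= [[m nm <-] [m' nm' <-]]; rewrite -ball_normE /=.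
  rewrite -(subrKA (h (hval (x n) i))) (le_lt_trans (ler_normD _ _))//.
  by rewrite [ltRHS](splitr e) ltrD ?close// distrC close.
have reN (a : R[i]) : complex.Re a ^+ 2 <= nsq a by rewrite lerDl sqr_ge0.
have imN (a : R[i]) : complex.Im a ^+ 2 <= nsq a by rewrite lerDr sqr_ge0.
have reB (a b : R[i]) : complex.Re (a - b) = complex.Re a - complex.Re b.
  by case: a b => [? ?] [? ?].
have imB (a b : R[i]) : complex.Im (a - b) = complex.Im a - complex.Im b.
  by case: a b => [? ?] [? ?].
have [re reC] := choice (coord _ reB reN).
have [im imC] := choice (coord _ imB imN).
pose l0 i : R[i] := (re i +i* im i)%C.
have bound n r : uniq r -> \sum_(i <- r) nsq (l0 i - hval (x n) i) <= c n ^+ 2.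
  move=> ur.
  have C : (fun m => \sum_(i <- r) nsq (hval (x m) i - hval (x n) i)) @ \oo -->
      \sum_(i <- r) nsq (l0 i - hval (x n) i).
    elim: r {ur} => [|i r IH].
      rewrite big_nil; under eq_fun do rewrite big_nil; exact: cvg_cst.
    rewrite big_cons; under eq_fun do rewrite big_cons.
    apply: cvgD IH; rewrite /nsq.
    have E (a b : R[i]) : complex.Re (a - b) ^+ 2 + complex.Im (a - b) ^+ 2 =
        (complex.Re a - complex.Re b) * (complex.Re a - complex.Re b) +
        (complex.Im a - complex.Im b) * (complex.Im a - complex.Im b).
      by case: a b => [? ?] [? ?] /=; rewrite !expr2.
    rewrite E; under eq_fun do rewrite E.
    apply: cvgD; apply: cvgM; apply: cvgB; [exact: reC|exact: cvg_cst|
      exact: reC|exact: cvg_cst|exact: imC|exact: cvg_cst|exact: imC|exact: cvg_cst].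
  rewrite -(cvg_lim _ C)//; apply: limr_le; first by apply/cvg_ex; eexists; exact: C.
  exists n => // m /= nm.
  apply: (@le_trans _ _ (energy (x m - x n))).
    exact: total_ub (hsummable (x m - x n)) ur.
  by rewrite -hnorm_sqr ler_sqr ?nnegrE ?hnorm_ge0// xc.
have dl2 n : (fun i => l0 i - hval (x n) i) \in l2.
  apply/l2P; apply: (@summableP _ _ (c n ^+ 2)); last exact: bound.
  by move=> i; exact: nsq_ge0.
pose d n := Hilbert (dl2 n).
exists (d 0%N + x 0%N) => n.
have -> : d 0%N + x 0%N - x n = d n.
  by apply: hilbertP => i; rewrite !hvalD hvalN /= subrK.
by apply: hnorm_le => //; exact: bound.
Qed.

End SquareSummable.

(** * The C*-algebra of bounded operators *)
Section Operators.
Context {R : realType}.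
Notation H := (@hilbert R).
Implicit Types (x y z : H) (T : H -> H).

Definition adjoint_to T T' := forall x y, dot (T x) y = dot x (T' y).

Definition hbounded T (C : R) := forall x, hnorm (T x) <= C * hnorm x.

(** The existence of an adjoint is part of the definition, which makes a
    representation theorem for functionals unnecessary; it passes to limits with
    the operator, as [opnorm_star] shows. *)
Record is_operator T : Prop := {
  opD : forall x y, T (x + y) = T x + T y;
  opZ : forall k x, T (k *: x) = k *: T x;
  op_bounded : exists C, hbounded T C;
  op_adjoint : exists T', adjoint_to T T' }.

Lemma hilbert_sep x y : (forall z, dot z x = dot z y) -> x = y.
Proof.
move=> xy; apply/eqP; rewrite -subr_eq0; apply/eqP/dot_eq0 => z.
by rewrite dotDr dotNr xy subrr.
Qed.

Lemma dot_conjr k x y : dot x (k *: y) = dot (conjc k *: x) y.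
Proof. by rewrite dot_conj conjcK. Qed.

Lemma adjoint_sym T T' : adjoint_to T T' -> adjoint_to T' T.
Proof. by move=> TT' x y; rewrite dotC -TT' dotC. Qed.

Lemma adjoint_uniq T T' T'' : adjoint_to T T' -> adjoint_to T T'' -> T' = T''.
Proof.
by move=> h1 h2; apply/funext => y; apply: hilbert_sep => z; rewrite -h1 -h2.
Qed.

Lemma adjoint_bounded T T' (C : R) : 0 <= C -> adjoint_to T T' ->
  hbounded T C -> hbounded T' C.
Proof.
move=> C0 TT' TC y; have [->|y0] := eqVneq (hnorm (T' y)) 0.
  by rewrite mulr_ge0// hnorm_ge0.
have p0 : 0 < hnorm (T' y) by rewrite lt_def y0 hnorm_ge0.
rewrite -(ler_pM2r p0) -expr2 hnorm_sqr -dotxx -TT'.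
apply: (le_trans (cauchy_schwarz _ _)).
by rewrite mulrAC ler_wpM2r ?hnorm_ge0.
Qed.

Lemma adjoint_operator T T' : is_operator T -> adjoint_to T T' -> is_operator T'.
Proof.
move=> [TD TZ [C TC] _] TT'; split.
- by move=> x y; apply: hilbert_sep => z; rewrite dotDr -!TT' dotDr.
- move=> k x; apply: hilbert_sep => z.
  by rewrite -TT' !dot_conjr -TZ TT'.
- exists `|C|; apply: adjoint_bounded TT' _ => // x.
  by apply: le_trans (TC x) _; rewrite ler_wpM2r ?hnorm_ge0// ler_norm.
- by exists T; exact: adjoint_sym.
Qed.

Definition operator_pred : {pred (H -> H)} := fun T => `[< is_operator T >].

Lemma operatorP T : reflect (is_operator T) (T \in operator_pred).
Proof. exact: asboolP. Qed.

Fact operator_closed : submod_closed operator_pred.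
Proof.
split.
  apply/operatorP; split.
  - by move=> x y; rewrite addr0.
  - by move=> k x; rewrite scaler0.
  - by exists 0 => x; rewrite mul0r hnorm0.
  - exists 0 => x y; have d0 z : dot 0 z = 0 by rewrite /dot add0r sub0r energyN subrr mul0r.
    by rewrite (dotC x) !d0.
move=> k T S /operatorP[TD TZ [C TC] [T' TT']] /operatorP[SD SZ [D SD'] [S' SS']].
apply/operatorP; split.
- move=> x y.
  change (k *: T (x + y) + S (x + y) = k *: T x + S x + (k *: T y + S y)).
  by rewrite TD SD scalerDr addrACA.
- move=> l x; change (k *: T (l *: x) + S (l *: x) = l *: (k *: T x + S x)).
  by rewrite TZ SZ scalerDr !scalerA mulrC.
- exists (cabs k * C + D) => x; apply: le_trans (hnormD (k *: T x) (S x)) _.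
  rewrite mulrDl; apply: lerD; last exact: SD'.
  by rewrite hnormZ -mulrA ler_wpM2l ?cabs_ge0//; exact: TC.
- exists (fun y => conjc k *: T' y + S' y) => x y.
  change (dot (k *: T x + S x) y = dot x (conjc k *: T' y + S' y)).
  by rewrite dotDl dotDr (SS' x y) dot_conjr conjcK -(TT' _ y) TZ.
Qed.

HB.instance Definition _ := GRing.isSubmodClosed.Build R[i] (H -> H) operator_pred
  operator_closed.

Record operator := Operator { oval :> H -> H; ovalP : oval \in operator_pred }.
HB.instance Definition _ := [isSub for oval].
HB.instance Definition _ := [Choice of operator by <:].
HB.instance Definition _ := [SubChoice_isSubLmodule of operator by <:].

Implicit Types S : operator.

Lemma ovalD S1 S2 x : oval (S1 + S2) x = oval S1 x + oval S2 x. Proof. by []. Qed.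
Lemma ovalN S x : oval (- S) x = - oval S x. Proof. by []. Qed.
Lemma ovalZ k S x : oval (k *: S) x = k *: oval S x. Proof. by []. Qed.

Lemma operator_eq S1 S2 : oval S1 =1 oval S2 -> S1 = S2.
Proof. by move=> E; apply: val_inj; apply/funext. Qed.

Lemma oval_is_operator S : is_operator (oval S). Proof. exact/operatorP/ovalP. Qed.

Definition opnorm S : R := sup [set hnorm (oval S x) | x in [set x | hnorm x <= 1]].

Lemma opnorm_ub S x : hnorm (oval S x) <= opnorm S * hnorm x.
Proof.
have [C SC] := op_bounded (oval_is_operator S).
have hub : has_ubound [set hnorm (oval S x) | x in [set x | hnorm x <= 1]].
  exists `|C| => _ [y /= y1 <-]; apply: le_trans (SC y) _.
  by rewrite -[leRHS]mulr1 (le_trans (ler_norm _))// normrM ler_pM// ger0_norm ?hnorm_ge0.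
have [x0|x0] := eqVneq (hnorm x) 0.
  by rewrite x0 mulr0 (hnorm_eq0 x0) -(scale0r 0) (opZ (oval_is_operator S)) scale0r hnorm0.
have p0 : 0 < hnorm x by rewrite lt_def x0 hnorm_ge0.
rewrite -ler_pdivrMr//.
apply: ub_le_sup => //; exists ((hnorm x)^-1%:C%C *: x) => /=.
  by rewrite hnormZ cabs_real ?invr_ge0 ?(ltW p0)// mulVf.
by rewrite (opZ (oval_is_operator S)) hnormZ cabs_real ?invr_ge0 ?(ltW p0)// mulrC.
Qed.

Lemma opnorm_le S (C : R) : 0 <= C -> hbounded (oval S) C -> opnorm S <= C.
Proof.
move=> C0 SC; apply: ge_sup; first by exists (hnorm (oval S 0)), 0 => //=; rewrite hnorm0.
by move=> _ [x /= x1 <-]; apply: le_trans (SC x) _; rewrite ler_piMr.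
Qed.

(* Arithmetic tactics compare operator norms up to conversion, which would unfold
   the supremum. *)
Local Opaque opnorm.

Lemma opnorm_ge0 S : 0 <= opnorm S.
Proof.
rewrite leNgt; apply/negP => N0.
have S0 x : oval S x = 0.
  apply: hnorm_eq0; apply/eqP; rewrite eq_le hnorm_ge0 andbT.
  by apply: le_trans (opnorm_ub S x) _; rewrite nmulr_rle0// hnorm_ge0.
have : 0 <= opnorm S.
  apply: ub_le_sup; first by exists 0 => _ [y _ <-]; rewrite S0 hnorm0.
  by exists 0; rewrite /= ?hnorm0// S0 hnorm0.
by rewrite leNgt N0.
Qed.

Definition op_norm S : R[i] := (opnorm S)%:C%C.

Lemma opnormD S1 S2 : opnorm (S1 + S2) <= opnorm S1 + opnorm S2.
Proof.
apply: opnorm_le => [|x]; first by rewrite addr_ge0// opnorm_ge0.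
by rewrite ovalD mulrDl (le_trans (hnormD _ _))// lerD// opnorm_ub.
Qed.

Lemma opnormZ k S : opnorm (k *: S) = cabs k * opnorm S.
Proof.
have le c S1 : opnorm (c *: S1) <= cabs c * opnorm S1.
  apply: opnorm_le => [|x]; first by rewrite mulr_ge0 ?cabs_ge0 ?opnorm_ge0.
  by rewrite ovalZ hnormZ -mulrA ler_wpM2l ?cabs_ge0// opnorm_ub.
apply/eqP; rewrite eq_le le /=.
have [->|k0] := eqVneq k 0; first by rewrite cabs0 mul0r opnorm_ge0.
have kp : 0 < cabs k by rewrite lt_def cabs_ge0 andbT; apply: contra k0 => /eqP ck;
  rewrite -normr_eq0 cabsE ck.
rewrite mulrC -ler_pdivlMr// mulrC -cabsV; apply: le_trans (le _ _).
by rewrite scalerA mulVf// scale1r.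
Qed.

Lemma opnorm_eq0 S : opnorm S = 0 -> S = 0.
Proof.
move=> S0; apply: operator_eq => x; apply: hnorm_eq0; apply/eqP.
by rewrite eq_le hnorm_ge0 andbT (le_trans (opnorm_ub S x))// S0 mul0r.
Qed.

Fact op_normD S1 S2 : op_norm (S1 + S2) <= op_norm S1 + op_norm S2.
Proof. by rewrite /op_norm -rmorphD lecR opnormD. Qed.

Fact op_normZ k S : op_norm (k *: S) = `|k| * op_norm S.
Proof. by rewrite /op_norm opnormZ rmorphM cabsE. Qed.

Fact op_norm_eq0 S : op_norm S = 0 -> S = 0.
Proof. by move=> /complexI/opnorm_eq0. Qed.

HB.instance Definition _ := Lmodule_isNormed.Build R[i] operator
  op_normD op_normZ op_norm_eq0.

Lemma op_ballE S (e : R) S' : ball S e%:C%C S' = (opnorm (S - S') < e) :> Prop.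
Proof. by rewrite -ball_normE /= -ltcR. Qed.

Lemma dot_abs x y : `|dot x y| <= hnorm x * hnorm y.
Proof.
by rewrite ler_norml lerNl -dotNl -{1}(hnormN x) !cauchy_schwarz.
Qed.

Definition adj S : H -> H := projT1 (cid (op_adjoint (oval_is_operator S))).

Lemma adjP S : adjoint_to (oval S) (adj S).
Proof. exact: projT2 (cid _). Qed.

Lemma adj_operator S : adj S \in operator_pred.
Proof. by apply/operatorP; exact: adjoint_operator (oval_is_operator S) (adjP S). Qed.

Definition op_star S : operator := Operator (adj_operator S).

Lemma op_starP S1 S2 : adjoint_to (oval S1) (oval S2) -> op_star S1 = S2.
Proof. by move=> h; apply: val_inj; exact: adjoint_uniq (adjP S1) h. Qed.

Lemma op_star_adj S : adjoint_to (oval S) (oval (op_star S)).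
Proof. exact: adjP. Qed.

Lemma op_starK : involutive op_star.
Proof. by move=> S; apply: op_starP; exact/adjoint_sym/op_star_adj. Qed.

Lemma op_starD S1 S2 : op_star (S1 + S2) = op_star S1 + op_star S2.
Proof.
by apply: op_starP => x y; rewrite !ovalD dotDl dotDr !op_star_adj.
Qed.

Lemma op_starZ k S : op_star (k *: S) = conjc k *: op_star S.
Proof.
apply: op_starP => x y; rewrite !ovalZ -(opZ (oval_is_operator S)) op_star_adj.
by rewrite dot_conj.
Qed.

Lemma opnorm_star S : opnorm (op_star S) = opnorm S.
Proof.
have le S1 : opnorm (op_star S1) <= opnorm S1.
  apply: opnorm_le; first exact: opnorm_ge0.
  by apply: adjoint_bounded (op_star_adj S1) _; [exact: opnorm_ge0|exact: opnorm_ub].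
by apply/eqP; rewrite eq_le le /= -{1}(op_starK S) le.
Qed.

(** A sequence of operators [S n], each within [2 ^ - n] of a set of the Cauchy
    filter, converges at each vector, and so does the sequence of adjoints; the
    limits are adjoint to each other. *)
Lemma operator_complete (F : set_system operator) : ProperFilter F -> cauchy F -> cvg F.
Proof.
move=> FF Fc.
(* Real inequalities, stated before operators enter the context, where linear
   arithmetic would compare these up to conversion. *)
have arith (a b d p q : R) : a <= b + d -> b < p -> d < q -> p <= q -> a <= q *+ 2.
  by rewrite mulr2n; lra.
have arith2 (a b d p e : R) : a <= b + d -> b <= p *+ 2 -> d < p ->
    p *+ 2 < e / 2 -> 0 <= p -> a < e.
  by rewrite mulr2n; lra.
have Fball (n : nat) : exists S, F (ball S (2^-1 ^+ n)%:C%C).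
  have /cauchyP /(_ (2^-1 ^+ n)%:C%C) [|S FS] := Fc.
    by rewrite ltcR exprn_gt0// invr_gt0.
  by exists S.
have [S SF] := choice Fball.
pose c n : R := 2^-1 ^+ n *+ 2.
have Sc n m : (n <= m)%N -> opnorm (S m - S n) <= c n.
  move=> nm; have [T [Tn Tm]] := @filter_ex _ F _ _ (filterI (SF n) (SF m)).
  move: Tn Tm; rewrite !op_ballE => Tn Tm.
  have h : opnorm (S m - S n) <= opnorm (S m - T) + opnorm (T - S n).
    by rewrite -[X in opnorm X <= _](subrKA T) opnormD.
  have h1 : opnorm (T - S n) = opnorm (S n - T).
    by rewrite -opprB -scaleN1r opnormZ /cabs normrN normr1 mul1r.
  have h2 : 2^-1 ^+ m <= 2^-1 ^+ n :> R.
    by apply: ler_wiXn2l => //; rewrite ?invr_ge0// invf_le1// ler1n.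
  by apply: arith h Tm _ h2; rewrite h1.
have c0 (e : R) : 0 < e -> exists n, c n < e.
  move=> e0; have /cvgrPdist_lt/(_ e e0) : c @ \oo --> (0 : R).
    rewrite -(mul0rn _ 2); apply: cvgMn; apply: cvg_expr.
    by rewrite ger0_norm ?invr_ge0// invf_lt1// ltr1n.
  move=> -[n _ /(_ n (leqnn n))] /=; rewrite sub0r normrN => cn; exists n.
  exact: le_lt_trans (ler_norm _) cn.
have lim (phi : operator -> H -> H) :
    (forall S1 S2 x, hnorm (phi S1 x - phi S2 x) <= opnorm (S1 - S2) * hnorm x) ->
    exists L : H -> H, forall n x, hnorm (L x - phi (S n) x) <= c n * hnorm x.
  move=> phiB.
  have pt x : exists l, forall n, hnorm (l - phi (S n) x) <= c n * hnorm x.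
    apply: hilbert_complete => [n m nm|e e0].
      by apply: le_trans (phiB _ _ _) _; rewrite ler_wpM2r ?hnorm_ge0// Sc.
    have h1 : 0 < hnorm x + 1 by rewrite ltr_wpDl// hnorm_ge0.
    have [n cn] := c0 _ (divr_gt0 e0 h1); exists n.
    move: cn; rewrite ltr_pdivlMr// => /(le_lt_trans _); apply.
    rewrite ler_wpM2l ?lerDl// /c mulrn_wge0// exprn_ge0// invr_ge0//.
  by have [L LP] := choice pt; exists L => n x; exact: LP.
have [|L LP] := lim (fun S1 => oval S1).
  by move=> S1 S2 x; rewrite -ovalN -ovalD opnorm_ub.
have [|L' LP'] := lim (fun S1 => oval (op_star S1)).
  move=> S1 S2 x; rewrite -ovalN -ovalD.
  have -> : op_star S1 - op_star S2 = op_star (S1 - S2).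
    by rewrite op_starD -scaleN1r -[in RHS]scaleN1r op_starZ rmorphN1.
  by rewrite -opnorm_star opnorm_ub.
have smallR (t C : R) : 0 <= t -> (forall n, t <= C * c n) -> t = 0.
  move=> t0 xC; apply/eqP; rewrite eq_le t0 andbT leNgt; apply/negP => x0.
  have C1 : 0 < `|C| + 1 by rewrite ltr_wpDl.
  have [n cn] := c0 _ (divr_gt0 x0 C1).
  move: cn; rewrite ltr_pdivlMr// ltNge => /negP; apply.
  apply: le_trans (xC n) _; rewrite mulrC ler_wpM2l//.
    by rewrite /c mulrn_wge0// exprn_ge0// invr_ge0.
  by rewrite (le_trans (ler_norm C))// lerDl.
have small x (C : R) : (forall n, hnorm x <= C * c n) -> x = 0.
  by move=> xC; apply: hnorm_eq0; apply: smallR xC; exact: hnorm_ge0.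
have Lop : L \in operator_pred.
  apply/operatorP; split.
  - move=> x y; apply/eqP; rewrite -subr_eq0; apply/eqP.
    apply: (small _ (hnorm (x + y) + (hnorm x + hnorm y))) => n.
    have -> : L (x + y) - (L x + L y) = (L (x + y) - oval (S n) (x + y))
        - ((L x - oval (S n) x) + (L y - oval (S n) y)).
      by rewrite (opD (oval_is_operator (S n))) [(L x - _) + _]addrACA -opprD opprB addrA subrK.
    rewrite mulrC; apply: le_trans (hnormB _ _) _; rewrite mulrDr lerD//.
    by apply: le_trans (hnormD _ _) _; rewrite mulrDr lerD.
  - move=> k x; apply/eqP; rewrite -subr_eq0; apply/eqP.
    apply: (small _ (hnorm (k *: x) + cabs k * hnorm x)) => n.
    have -> : L (k *: x) - k *: L x = (L (k *: x) - oval (S n) (k *: x))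
        - k *: (L x - oval (S n) x).
      by rewrite (opZ (oval_is_operator (S n))) scalerBr opprB addrA subrK.
    rewrite mulrC; apply: le_trans (hnormB _ _) _; rewrite mulrDr lerD//.
    by rewrite hnormZ mulrCA ler_wpM2l ?cabs_ge0.
  - exists (c 0%N + opnorm (S 0%N)) => x; rewrite -(subrK (oval (S 0%N) x) (L x)).
    by rewrite mulrDl (le_trans (hnormD _ _))// lerD// opnorm_ub.
  - exists L' => x y; apply/eqP; rewrite -subr_eq0 -normr_eq0; apply/eqP.
    apply: (smallR _ (2 * hnorm x * hnorm y)) => // n.
    have -> : dot (L x) y - dot x (L' y) =
        dot (L x - oval (S n) x) y - dot x (L' y - oval (op_star (S n)) y).
      by rewrite dotDl dotDr dotNl dotNr (op_star_adj (S n) x y); ring.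
    apply: le_trans (ler_normB _ _) _.
    apply: le_trans (lerD (dot_abs _ _) (dot_abs _ _)) _.
    have k1 := ler_wpM2r (hnorm_ge0 y) (LP n x).
    have k2 := ler_wpM2l (hnorm_ge0 x) (LP' n y).
    apply: le_trans (lerD k1 k2) _; rewrite le_eqVlt; apply/orP; left; apply/eqP.
    by ring.
apply/cvg_ex; exists (Operator Lop : operator).
apply/cvg_ballP => e e0.
have e0' : 0 < complex.Re e by move: e0; rewrite ltcE /= => /andP[_].
have eE : e = (complex.Re e)%:C%C by rewrite RRe_real// gtr0_real.
have [n cn] := c0 _ (divr_gt0 e0' (ltr0n R 2)).
apply: filterS (SF n) => T; rewrite eE !op_ballE => TS.
have LS : opnorm (Operator Lop - S n) <= c n.
  apply: opnorm_le => [|x]; last exact: LP.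
  by rewrite /c mulrn_wge0// exprn_ge0// invr_ge0.
have h : opnorm (Operator Lop - T) <= opnorm (Operator Lop - S n) + opnorm (S n - T).
  by rewrite -[X in opnorm X <= _](subrKA (S n)) opnormD.
by apply: arith2 h LS TS cn _; rewrite exprn_ge0// invr_ge0.
Qed.

HB.instance Definition _ := Uniform_isComplete.Build operator operator_complete.

Fact op_one_subproof : id \in operator_pred.
Proof.
apply/operatorP; split=> //; first by exists 1 => x; rewrite mul1r.
by exists id.
Qed.

Definition op_one : operator := Operator op_one_subproof.

Fact op_mul_subproof S1 S2 : oval S1 \o oval S2 \in operator_pred.
Proof.
apply/operatorP; split.
- by move=> x y /=; rewrite (opD (oval_is_operator S2)) (opD (oval_is_operator S1)).
- by move=> k x /=; rewrite (opZ (oval_is_operator S2)) (opZ (oval_is_operator S1)).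
- exists (opnorm S1 * opnorm S2) => x /=; apply: le_trans (opnorm_ub _ _) _.
  by rewrite -mulrA ler_wpM2l ?opnorm_ge0 ?opnorm_ub.
- exists (oval (op_star S2) \o oval (op_star S1)) => x y /=.
  by rewrite (op_star_adj S1) (op_star_adj S2).
Qed.

Definition op_mul S1 S2 : operator := Operator (op_mul_subproof S1 S2).

Lemma op_starM S1 S2 : op_star (op_mul S1 S2) = op_mul (op_star S2) (op_star S1).
Proof. by apply: op_starP => x y /=; rewrite (op_star_adj S1) (op_star_adj S2). Qed.

Lemma opnormM S1 S2 : opnorm (op_mul S1 S2) <= opnorm S1 * opnorm S2.
Proof.
apply: opnorm_le => [|x /=]; first by rewrite mulr_ge0 ?opnorm_ge0.
by apply: le_trans (opnorm_ub _ _) _; rewrite -mulrA ler_wpM2l ?opnorm_ge0 ?opnorm_ub.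
Qed.

(** [hnorm (S x) ^ 2 = dot x (S^* S x)] is at most
    [opnorm (S^* S) * hnorm x ^ 2]. *)
Lemma opnorm_cstar S : opnorm (op_mul (op_star S) S) = opnorm S ^+ 2.
Proof.
apply/eqP; rewrite eq_le expr2 -{1}(opnorm_star S) opnormM /=.
set N := opnorm (op_mul _ _); have N0 : 0 <= N by exact: opnorm_ge0.
rewrite -expr2 -(sqr_sqrtr N0) ler_sqr ?nnegrE ?opnorm_ge0 ?sqrtr_ge0//.
apply: opnorm_le => [|x]; first exact: sqrtr_ge0.
rewrite -(@ler_sqr _ _ _) ?nnegrE ?mulr_ge0 ?sqrtr_ge0 ?hnorm_ge0//.
rewrite exprMn (sqr_sqrtr N0) hnorm_sqr -dotxx (op_star_adj S).
apply: le_trans (cauchy_schwarz _ _) _; rewrite mulrC expr2 mulrA ler_wpM2r ?hnorm_ge0//.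
exact: (opnorm_ub (op_mul (op_star S) S)).
Qed.

Fact op_mulA : associative op_mul. Proof. by move=> a b c; apply: operator_eq. Qed.
Fact op_mul1l : left_id op_one op_mul. Proof. by move=> a; apply: operator_eq. Qed.
Fact op_mul1r : right_id op_one op_mul. Proof. by move=> a; apply: operator_eq. Qed.
Fact op_mulDl : left_distributive op_mul +%R.
Proof. by move=> a b c; apply: operator_eq. Qed.
Fact op_mulDr : right_distributive op_mul +%R.
Proof. by move=> a b c; apply: operator_eq => x; rewrite /= (opD (oval_is_operator a)). Qed.
Fact op_scaleAl (k : R[i]) S1 S2 : k *: op_mul S1 S2 = op_mul (k *: S1) S2.
Proof. exact: operator_eq. Qed.
Fact op_scaleAr (k : R[i]) S1 S2 : k *: op_mul S1 S2 = op_mul S1 (k *: S2).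
Proof. by apply: operator_eq => x; rewrite /= (opZ (oval_is_operator S1)). Qed.
Fact op_normM S1 S2 : `|op_mul S1 S2| <= `|S1| * `|S2| :> R[i].
Proof. by rewrite -[leRHS]rmorphM lecR opnormM. Qed.
Fact op_cstar S : `|op_mul (op_star S) S| = `|S| ^+ 2 :> R[i].
Proof. by rewrite -[RHS]rmorphXn /= -opnorm_cstar. Qed.

HB.instance Definition _ := CompleteNormedModule_isCStarAlgebra.Build R operator
  op_mulA op_mul1l op_mul1r op_mulDl op_mulDr op_scaleAl op_scaleAr op_normM
  op_starK op_starD op_starZ op_starM op_cstar.

End Operators.

(** * Translations and dilations *)
Section Representation.
Context {R : realType}.

(** The operators with their C*-structure: the ring operations are declared for
    the carrier of a [cstarAlgType]. *)
Definition opalg : cstarAlgType R := @operator R.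
Notation H := (@hilbert R).
Implicit Types (p : int -> option int).

Definition partial_inverse p p' := forall i j, p i = Some j <-> p' j = Some i.

(** Composition with a partial map, extended by 0. When the partial map is
    injective this is a partial isometry, and the adjoint is the composition with
    the inverse. Translations, dilations and the adjoints of dilations all have
    this form. *)
Definition pull p (x : int -> R[i]) : int -> R[i] :=
  fun i => if p i is Some j then x j else 0.

Lemma nsq0 : nsq (0 : R[i]) = 0.
Proof. by rewrite /nsq /= expr0n addr0. Qed.

Lemma pull_total p p' (x : H) : partial_inverse p p' ->
  summable (fun i => nsq (pull p x i)) /\
  total (fun i => nsq (pull p x i)) <= energy x.
Proof.
move=> pp'; apply: (@total_reindex_le _ p p') => [i j /pp'//|i j|i|i|].
- by rewrite /pull => ->.
- by rewrite /pull => ->; rewrite nsq0.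
- exact: nsq_ge0.
- exact: hsummable.
Qed.

Definition transport p (x : H) : H := insubd 0 (pull p x).

Lemma transportE p p' x : partial_inverse p p' -> hval (transport p x) = pull p x.
Proof.
move=> pp'; rewrite /transport; apply: (@insubdK _ _ (@hilbert R)).
by apply/l2P; have [] := pull_total x pp'.
Qed.

Lemma partial_inverse_sym p p' : partial_inverse p p' -> partial_inverse p' p.
Proof. by move=> pp' i j; split=> /pp'. Qed.

(** In the energies whose difference defines both sides, the terms at places that
    [p] matches with one another agree, and the remaining terms do not depend on
    the sign. *)
Lemma transport_adjoint p p' : partial_inverse p p' ->
  adjoint_to (transport p) (transport p').
Proof.
move=> pp' x y; have p'p := partial_inverse_sym pp'.
pose overlap p1 (f : int -> int -> R) i := if p1 i is Some j then f i j else 0.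
pose rest p1 (z : H) i := if p1 i is Some _ then 0 else nsq (hval z i).
have rest_sum p1 z : summable (rest p1 z).
  apply: le_summable (hsummable z) => i; rewrite /rest; case: (p1 i) => *//; exact: nsq_ge0.
have piece (e : R[i]) : nsq e = 1 -> exists t,
    energy (transport p x + e *: y) = t + total (rest p y) /\
    energy (x + e *: transport p' y) = t + total (rest p' x).
  move=> e1.
  pose f i j := nsq (hval x j + e * hval y i).
  pose g j i := nsq (hval x j + e * hval y i).
  have f_le i : overlap p f i <= nsq (hval (transport p x + e *: y) i).
    rewrite /overlap hvalD hvalZ (transportE x pp') /pull /f.
    by case: (p i) => *//; exact: nsq_ge0.
  have f_ge0 i : 0 <= overlap p f i.
    by rewrite /overlap; case: (p i) => *//; exact: nsq_ge0.
  have g_ge0 i : 0 <= overlap p' g i.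
    by rewrite /overlap; case: (p' i) => *//; exact: nsq_ge0.
  have fs : summable (overlap p f).
    exact: le_summable f_ge0 f_le (hsummable _).
  have [gs gf] : summable (overlap p' g) /\ total (overlap p' g) <= total (overlap p f).
    apply: (@total_reindex_le _ p' p) => // [i j /pp'//|i j E|i E]; last by rewrite /overlap E.
    by rewrite /overlap E; move/pp': E => ->.
  have [_ fg] : summable (overlap p f) /\ total (overlap p f) <= total (overlap p' g).
    apply: (@total_reindex_le _ p p') => // [i j /pp'//|i j E|i E]; last by rewrite /overlap E.
    by rewrite /overlap E; move/pp': E => ->.
  exists (total (overlap p f)); split.
    rewrite -totalD//; apply: eq_total => i.
    rewrite /overlap /rest hvalD hvalZ (transportE x pp') /pull.
    by case: (p i) => [j|]; rewrite ?addr0 ?add0r// nsqM e1 mul1r.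
  have -> : total (overlap p f) = total (overlap p' g).
    by apply/eqP; rewrite eq_le fg gf.
  rewrite -totalD//; apply: eq_total => i.
  rewrite /overlap /rest hvalD hvalZ (transportE y p'p) /pull.
  by case: (p' i) => [j|]; rewrite ?addr0 ?mulr0 ?add0r ?addr0.
have [|t [t1 t2]] := piece 1; first by rewrite /nsq /= expr1n expr0n addr0.
have [|s [s1 s2]] := piece (-1).
  by rewrite /nsq /= sqrrN expr1n oppr0 expr0n addr0.
move: t1 t2 s1 s2; rewrite !scale1r !scaleN1r => t1 t2 s1 s2.
by rewrite /dot t1 t2 s1 s2; congr (_ / _); ring.
Qed.

Lemma transport_operator p p' : partial_inverse p p' ->
  transport p \in @operator_pred R.
Proof.
move=> pp'; apply/operatorP; split.
- move=> x y; apply: hilbertP => i; rewrite hvalD !(transportE _ pp') /pull.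
  by case: (p i) => [j|]; rewrite ?hvalD ?addr0.
- move=> k x; apply: hilbertP => i; rewrite hvalZ !(transportE _ pp') /pull.
  by case: (p i) => [j|]; rewrite ?hvalZ ?mulr0.
- exists 1 => x; rewrite mul1r -(@ler_sqr _ _ _) ?nnegrE ?hnorm_ge0// !hnorm_sqr.
  have [_] := pull_total x pp'; apply: le_trans; rewrite le_eqVlt; apply/orP; left.
  by apply/eqP/eq_total => i; rewrite (transportE x pp').
- by exists (transport p'); exact: transport_adjoint.
Qed.

Definition transport_op p : operator := insubd (0 : operator) (transport p).

Lemma transport_opE p p' x : partial_inverse p p' ->
  hval (oval (transport_op p) x) = pull p x.
Proof.
move=> pp'; rewrite -(transportE x pp'); congr (hval (_ x)).
exact: (@insubdK _ _ (@operator R)) (transport_operator pp').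
Qed.

Lemma transport_op_star p p' : partial_inverse p p' ->
  star (transport_op p : opalg) = transport_op p'.
Proof.
move=> pp'; have p'p := partial_inverse_sym pp'.
apply: op_starP => x y.
have := transport_adjoint pp' x y.
have E q q' z : partial_inverse q q' -> oval (transport_op q) z = transport q z.
  by move=> qq'; apply: val_inj; rewrite /= (transport_opE z qq') (transportE z qq').
by rewrite (E _ _ x pp') (E _ _ y p'p).
Qed.

Definition shift_map (n : int) : int -> option int := fun i => Some (i - n).
Definition scale_map (m : int) : int -> option int :=
  fun i => if (m %| i)%Z then Some (i %/ m)%Z else None.
Definition unscale_map (m : int) : int -> option int := fun i => Some (m * i).

Lemma shift_inverse n : partial_inverse (shift_map n) (shift_map (- n)).
Proof. by move=> i j; rewrite /shift_map opprK; split=> -[<-]; congr Some; ring. Qed.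

Lemma scale_inverse m : m != 0 -> partial_inverse (scale_map m) (unscale_map m).
Proof.
move=> m0 i j; rewrite /scale_map /unscale_map; split.
  by case: ifP => // /divzK mi [<-]; rewrite mulrC mi.
by move=> [<-]; rewrite dvdz_mulr ?dvdzz// mulKz.
Qed.

Definition rep_u (n : int) : opalg := transport_op (shift_map n).
Definition rep_s (m : int) : opalg := transport_op (scale_map m).

Lemma rep_uE n x i : hval (oval (rep_u n) x) i = hval x (i - n).
Proof. by rewrite (transport_opE x (shift_inverse n)). Qed.

Lemma rep_sE m x i : m != 0 -> hval (oval (rep_s m) x) i =
  if (m %| i)%Z then hval x (i %/ m)%Z else 0.
Proof.
by move=> m0; rewrite (transport_opE x (scale_inverse m0)) /pull /scale_map; case: ifP.
Qed.

Lemma star_rep_u n : star (rep_u n) = rep_u (- n).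
Proof. exact: transport_op_star (shift_inverse n). Qed.

Lemma star_rep_sE m x i : m != 0 -> hval (oval (star (rep_s m)) x) i = hval x (m * i).
Proof.
move=> m0; rewrite (transport_op_star (scale_inverse m0)).
by rewrite (transport_opE x (partial_inverse_sym (scale_inverse m0))).
Qed.

Lemma operator_ext (S1 S2 : opalg) :
  (forall x i, hval (oval S1 x) i = hval (oval S2 x) i) -> S1 = S2.
Proof. by move=> E; apply: operator_eq => x; apply: hilbertP => i; exact: E. Qed.

Lemma op_mulE (S1 S2 : opalg) x : oval (S1 * S2) x = oval S1 (oval S2 x).
Proof. by []. Qed.

Lemma op_oneE x : oval (1 : opalg) x = x. Proof. by []. Qed.

Lemma oval_sum (I : Type) (r : seq I) (F : I -> opalg) x i :
  hval (oval (\sum_(k <- r) F k) x) i = \sum_(k <- r) hval (oval (F k) x) i.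
Proof. by elim: r => [|k r IH]; rewrite ?big_nil// !big_cons -IH. Qed.

(** In the last relation, exactly one of the residues [0, ..., |m| - 1] is
    congruent to a given integer modulo [m]. *)
Lemma rep_relations : UZ_relations rep_u rep_s.
Proof.
have uu n m : rep_u n * rep_u m = rep_u (n + m).
  by apply: operator_ext => x i; rewrite op_mulE !rep_uE opprD addrA.
have u0 : rep_u 0 = 1 by apply: operator_ext => x i; rewrite rep_uE subr0.
split=> //.
- by move=> n; split; rewrite star_rep_u uu ?addNr ?addrN.
- move=> m m0; apply: operator_ext => x i.
  by rewrite op_mulE star_rep_sE// rep_sE// dvdz_mulr ?dvdzz// mulKz.
- move=> m n m0 n0; apply: operator_ext => x i.
  have mn0 : m * n != 0 by rewrite mulf_neq0.
  rewrite op_mulE !rep_sE//; have [/dvdzP[q ->]|mi] := boolP (m %| i)%Z; last first.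
    by rewrite ifF//; apply/negbTE; apply: contra mi; apply: dvdz_trans; rewrite dvdz_mulr ?dvdzz.
  rewrite mulzK// [q * m]mulrC dvdz_mul2l//.
  have [/dvdzP[t ->]|//] := boolP (n %| q)%Z.
  by rewrite mulzK// mulrCA mulzK.
- move=> m n m0; apply: operator_ext => x i.
  rewrite (op_mulE (rep_s m)) (op_mulE (rep_u _)) rep_uE rep_sE// rep_sE// rep_uE.
  have -> : (m %| i - m * n)%Z = (m %| i)%Z.
    by rewrite rpredBr// dvdz_mulr ?dvdzz.
  have [/dvdzP[q ->]|//] := boolP (m %| i)%Z.
  by rewrite [m * n]mulrC -mulrBl !mulzK.
- move=> m m0; apply: operator_ext => x i; rewrite oval_sum op_oneE.
  have E (k : nat) : hval (oval (rep_u k%:Z * final_projection (rep_s m) * rep_u (- k%:Z)) x) i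
      = if (m %| i - k%:Z)%Z then hval x i else 0.
    rewrite !op_mulE rep_uE rep_sE// star_rep_sE//; case: ifP => // /divzK mi.
    by rewrite mulrC mi rep_uE opprK subrK.
  under eq_bigr do rewrite E.
  have iE := divz_eq i m; set r := (i %% m)%Z in iE.
  have r0 : 0 <= r by rewrite modz_ge0.
  have rm : r < `|m|%N%:Z by rewrite /r -modz_abs; apply: ltz_pmod; rewrite ltz_nat absz_gt0.
  case: r r0 rm iE => // r _ rm iE.
  rewrite big_mkord (bigD1 (Ordinal (rm : (r < `|m|)%N)))//= big1 ?addr0.
    by rewrite ifT// iE addrK dvdz_mull ?dvdzz.
  move=> k kr; rewrite ifF//; apply/negbTE; apply: contra kr => mk.
  have : (m %| k%:Z - r%:Z)%Z.
    have -> : k%:Z - r%:Z = ((i %/ m)%Z * m) - (i - k%:Z) by rewrite {2}iE; ring.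
    by rewrite rpredB// dvdz_mull ?dvdzz.
  move/dvdzP => [q qE]; apply/eqP/val_inj => /=.
  have kl := ltn_ord k; move: (nat_of_ord k) kl qE => k' kl qE.
  have : q = 0 \/ q <= -1 \/ 1 <= q by lia.
  by case=> [q0|[q0|q0]]; [rewrite q0 mul0r in qE; lia|nia|nia].
Qed.

(** The space has a nonzero vector, the indicator function of 0. *)
Lemma operator_one_neq0 : (1 : opalg) <> 0.
Proof.
move=> one0.
have d2 : (fun i : int => (i == 0)%:R : R[i]) \in l2.
  apply/l2P; apply: (@summableP _ _ 1) => [i|r ur]; first exact: nsq_ge0.
  elim: r ur => [|i r IH]; first by rewrite big_nil ler01.
  rewrite big_cons /= => /andP[ir ur].
  have [i0|i0] := eqVneq i 0; last by rewrite nsq0 add0r IH.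
  rewrite big_seq big1 ?addr0 => [|j jr].
    by rewrite /nsq /= expr1n expr0n addr0.
  by case: eqP => [j0|_]; [rewrite i0 -j0 jr in ir|exact: nsq0].
have /(congr1 (fun S : operator => hval (oval S (Hilbert d2)) 0)) := one0.
by move=> /eqP; rewrite /= oner_eq0.
Qed.

End Representation.

Theorem proposition6p2 (R : realType) (A : cstarAlgType R) (u s : int -> A) :
  is_UZ u s -> cstar_simple A.
Proof.
move=> UZ; split.
  have [f [fh _ _]] := is_UZ_universal UZ (@rep_relations R).
  move=> one0; apply: (@operator_one_neq0 R).
  by rewrite -(star_hom1 fh) one0 -(scale0r 0) (star_homZ fh) scale0r.
move=> J JI; have [J1|J1] := pselect (J 1); [right|left].
  by apply/seteqP; split=> // x _; rewrite -(mulr1 x); exact: Defs.idealMl.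
apply/seteqP; split=> x /=; first exact: (proper_ideal_eq0 UZ JI J1).
by move=> ->; exact: ideal0 JI.
Qed.
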